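(* Let $d\ge4$ be an even integer, let $p,m\in\mathbb{N}_0$ with $0\le m\le p$, and let $\mathbf{x},\mathbf{x}'\in\mathbb{R}^d$ be given in standard polyspherical coordinates, with $r,r',R,R'>0$ and $r\ne r'$. Then $$\begin{aligned} &\frac{1}{(p+m)!(p-m)!}\left(\log(RR')+\log(\chi+\sqrt{\chi^2-1})+2H_{2p}-H_{p+m}-H_{p-m}\right)Q_{m-\frac12}^{p+\frac12}(\chi)\\ &+\frac1{(p+m)!}\sum_{k=0}^{p-m-1}\frac{2m+2k+1}{k!(p-m-k)(p+m+k+1)}\left[1+\frac{k!(p+m)!}{(2m+k)!(p-m)!}\right]Q_{m-\frac12}^{m+k+\frac12}(\chi)\\ &+\frac1{(p-m)!}\sum_{k=0}^{m-1}\frac{2k+1}{(m+k)!(p-k)(p+k+1)}Q_{m-\frac12}^{k+\frac12}(\chi)\\ &=\left(\frac{rr'}{RR'}\right)^p(-1)^{m+\frac d2-1}(2\pi)^{\frac d2-1}\frac{(\zeta^2-1)^{\frac p2+\frac{d-1}4}}{(\chi^2-1)^{\frac p2+\frac14}}\\ &\times\Biggl\{\sum_{l_{d-2}=m}^p\Omega_{d-2}(l_{d-2},m)\sum_{l_{d-3}=l_{d-2}}^p\Omega_{d-3}(l_{d-3},l_{d-2})\cdots\sum_{l=l_2}^p\Omega_1(l,l_2)\\ &\quad\times\biggl[\frac{(-1)^lQ_{l+\frac{d-3}2}^{p+\frac{d-1}2}(\zeta)}{(p-l)!(p+l+d-2)!}\Bigl(\log(rr')+\log(\zeta+\sqrt{\zeta^2-1})+2H_{2p+d-2}+H_p-H_{p+\frac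 d2-1}-H_{p+l+d-2}-H_{p-l}\Bigr)\\ &\quad+\frac{(-1)^l}{(p+l+d-2)!}\sum_{k=0}^{p-l-1}\frac{2l+2k+d-1}{k!(p-l-k)(p+l+k+d-1)}\left[1+\frac{k!(p+l+d-2)!}{(k+2l+d-2)!(p-l)!}\right]Q_{l+\frac{d-3}2}^{k+l+\frac{d-1}2}(\zeta)\\ &\quad+\frac{(-1)^l}{(p-l)!}\sum_{k=0}^{l+\frac d2-2}\frac{2k+1}{(l+\frac d2+k-1)!(p+\frac d2-k-1)(p+\frac d2+k)}Q_{l+\frac{d-3}2}^{k+\frac12}(\zeta)\biggr]\\ &+\sum_{l_{d-2}=m}^\infty\Omega_{d-2}(l_{d-2},m)\cdots\sum_{l_2=l_3}^\infty\Omega_2(l_2,l_3)\sum_{l=\max(p+1,l_2)}^\infty\frac{(-1)^{p+1}(l-p-1)!}{(p+l+d-2)!}\,\Omega_1(l,l_2)\,Q_{l+\frac{d-3}2}^{p+\frac{d-1}2}(\zeta)\Biggr\}. \end{aligned}$$ Here $l=l_1$ and $l_{d-1}=m$.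
   Context: $\mathbb{N}_0=\{0,1,2,\ldots\}$; $H_n=\sum_{j=1}^n\frac1j$ ($n\ge1$), $H_0=0$; empty sums are $0$. Standard polyspherical coordinates on $\mathbb{R}^d$: $x_j=r\sin\theta_1\cdots\sin\theta_{j-1}\cos\theta_j$ for $1\le j\le d-2$, $x_{d-1}=R\cos\phi$, $x_d=R\sin\phi$, where $R=r\sin\theta_1\cdots\sin\theta_{d-2}$, $r\ge0$, $\theta_j\in[0,\pi]$, $\phi\in[-\pi,\pi)$; primed quantities refer to $\mathbf{x}'$. Put $$\zeta=\frac{r^2+r'^2}{2rr'},\qquad \chi=\frac{R^2+R'^2+\sum_{j=1}^{d-2}(x_j-x_j')^2}{2RR'}.$$ For $1\le j\le d-2$ and integers $l_j\ge l_{j+1}\ge0$ put $\Omega_j(l_j,l_{j+1}):=\Theta_j^d(l_j,l_{j+1};\theta_j)\,\Theta_j^d(l_j,l_{j+1};\theta_j')$, where $$\Theta_j^d(l_j,l_{j+1};\theta)=\frac{\Gamma\!\left(l_{j+1}+\frac{d-j+1}2\right)}{2l_{j+1}+d-j-1}\sqrt{\frac{2^{2l_{j+1}+d-j-1}(2l_j+d-j-1)(l_j-l_{j+1})!}{\pi\,(l_j+l_{j+1}+d-j-2)!}}\,(\sin\theta)^{l_{j+1}}\,C_{l_j-l_{j+1}}^{l_{j+1}+(d-j-1)/2}(\cos\theta)$$ and $C_n^\mu$ is the Gegenbauer polynomial. For $z>1$ the associated Legendre function of the second kind is $$Q_\nu^\mu(z)=\frac{\sqrt{\pi}\,e^{i\pi\mu}\,\Gamma(\nu+\mu+1)(z^2-1)^{\mu/2}}{2^{\nu+1}\Gamma(\nu+\frac32)z^{\nu+\mu+1}}\,{}_2F_1\!\left(\tfrac{\nu+\mu+1}{2},\tfrac{\nu+\mu+2}{2};\nu+\tfrac32;\tfrac1{z^2}\right).$$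 *)

(* Defs.v *)
From mathcomp Require Import all_boot all_order all_algebra.
From mathcomp Require Import complex.
From mathcomp Require Import all_classical all_reals all_analysis.
Import Order.TTheory GRing.Theory Num.Theory.
Import numFieldNormedType.Exports.

Set Implicit Arguments.
Unset Strict Implicit.
Unset Printing Implicit Defensive.

Local Open Scope ring_scope.
Local Open Scope complex_scope.

Definition harmonic_number {R : realType} (n : nat) : R := series harmonic n.

(* Euler's integral, meaningful for 0 < x, the only range in which it is used *)
Definition Gamma {R : realType} (x : R) : R :=
  \int[@lebesgue_measure R]_(t in `]0%R, +oo[%classic)
    (t `^ (x - 1) * expR (- t)).

Definition pochhammer {R : realType} (a : R) (n : nat) : R :=
  \prod_(0 <= k < n) (a + k%:R).

Definition hyp2F1 {R : realType} (a b c z : R) : R :=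
  limn (series (fun n : nat =>
    pochhammer a n * pochhammer b n / (pochhammer c n * n`!%:R) * z ^+ n)).

Definition gegenbauer {R : realType} (n : nat) (mu : R) : {poly R} :=
  \sum_(k < n./2.+1)
    ((-1) ^+ k * pochhammer mu (n - k) / (k`!%:R * (n - k.*2)`!%:R))
      *: (2 *: 'X) ^+ (n - k.*2).

Definition expi {R : realType} (t : R) : R[i] := cos t +i* sin t.

(* associated Legendre function of the second kind, for 1 < z *)
Definition legendreQ {R : realType} (nu mu z : R) : R[i] :=
  expi (pi * mu) *
  (Num.sqrt pi * Gamma (nu + mu + 1) * (z ^+ 2 - 1) `^ (mu / 2)
   / (2 `^ (nu + 1) * Gamma (nu + 3 / 2) * z `^ (nu + mu + 1))
   * hyp2F1 ((nu + mu + 1) / 2) ((nu + mu + 2) / 2) (nu + 3 / 2)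
       (z ^+ 2)^-1)%:C.

(* Angles are families th : nat -> R of which only th 1, ..., th (d - 2) matter;
   Cartesian coordinates are numbered 1, ..., d, so that the j-th coordinate is
   the entry of index j - 1 of a row vector. *)

Definition cylradius {R : realType} (d : nat) (r : R) (th : nat -> R) : R :=
  r * \prod_(1 <= k < d - 1) sin (th k).

Definition polycoord {R : realType} (d : nat) (r : R) (th : nat -> R) (ph : R)
    (j : nat) : R :=
  if (j <= d - 2)%N then r * (\prod_(1 <= k < j) sin (th k)) * cos (th j)
  else if j == (d - 1)%N then cylradius d r th * cos ph
  else cylradius d r th * sin ph.

Definition polyspherical {R : realType} (d : nat) (x : 'rV[R]_d)
    (r : R) (th : nat -> R) (ph : R) : Prop :=
  [/\ 0 <= r,
      forall j : nat, (1 <= j <= d - 2)%N -> 0 <= th j <= pi,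
      - pi <= ph < pi
    & x = \row_(i < d) polycoord d r th ph i.+1].

Definition zeta {R : realType} (r r' : R) : R :=
  (r ^+ 2 + r' ^+ 2) / (2 * r * r').

Definition chi {R : realType} (d : nat) (x x' : 'rV[R]_d) (rho rho' : R) : R :=
  (rho ^+ 2 + rho' ^+ 2
   + \sum_(i < d | (i < d - 2)%N) (x 0 i - x' 0 i) ^+ 2) / (2 * rho * rho').

Definition Theta {R : realType} (d j l l' : nat) (t : R) : R :=
  Gamma (l'%:R + (d - j + 1)%:R / 2) / (2 * l' + (d - j - 1))%:R
  * Num.sqrt (2 ^+ (2 * l' + (d - j - 1)) * (2 * l + (d - j - 1))%:R
              * (l - l')`!%:R
              / (pi * (l + l' + (d - j - 2))`!%:R))
  * sin t ^+ l' * (gegenbauer (l - l') (l'%:R + (d - j - 1)%:R / 2)).[cos t].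

Definition Omega {R : realType} (d : nat) (th th' : nat -> R)
    (j l l' : nat) : R :=
  Theta d j l l' (th j) * Theta d j l l' (th' j).

(* nested_sum Om f p n l' is
   \sum_(l_n = l')^p Om n l_n l' * (\sum_(l_(n-1) = l_n)^p Om (n-1) l_(n-1) l_n
     * (... (\sum_(l_1 = l_2)^p Om 1 l_1 l_2 * f l_1))) *)
Fixpoint nested_sum {R : realType} (Om : nat -> nat -> nat -> R)
    (f : nat -> R[i]) (p n l' : nat) : R[i] :=
  if n is n'.+1 then
    \sum_(l' <= l < p.+1) (Om n l l')%:C * nested_sum Om f p n' l
  else f l'.

(* The same with all the sums infinite, the sum over l_n starting at lo n l'.
   The type R[i]^o is R[i] with the topology of its modulus. *)
Fixpoint nested_series {R : realType} (lo : nat -> nat -> nat)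
    (Om : nat -> nat -> nat -> R) (f : nat -> R[i]) (n l' : nat) : R[i] :=
  if n is n'.+1 then
    limn (fun N : nat =>
      (\sum_(lo n l' <= l < N) (Om n l l')%:C * nested_series lo Om f n' l)
        : R[i]^o)
  else f l'.

(* convergence of every series occurring in nested_series *)
Fixpoint nested_series_cvg {R : realType} (lo : nat -> nat -> nat)
    (Om : nat -> nat -> nat -> R) (f : nat -> R[i]) (n l' : nat) : Prop :=
  if n is n'.+1 then
    (forall l : nat, (lo n l' <= l)%N -> nested_series_cvg lo Om f n' l) /\
    cvgn (fun N : nat =>
      (\sum_(lo n l' <= l < N) (Om n l l')%:C * nested_series lo Om f n' l)
        : R[i]^o)
  else True.

(* Main.v *)
Require Import Defs.
From mathcomp Require Import all_boot all_order all_algebra.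
From mathcomp Require Import complex.
From mathcomp Require Import all_classical all_reals all_analysis.
From mathcomp Require Import measurable_realfun.
From mathcomp Require Import ring lra zify.
Import Order.TTheory GRing.Theory Num.Theory.
Import numFieldNormedType.Exports.

Local Open Scope ring_scope.
Local Open Scope complex_scope.

(** With u the cosine of the angle between x and x', and t = cos psi, one has
    r r' (2 zeta - 2 u) = R R' (2 chi - 2 t).  The p-th power of this common value
    times its logarithm is expanded in two ways: in cos (k psi) on the side of chi,
    and in the Gegenbauer polynomials of index d/2 - 1 in u on the side of zeta.
    The addition theorem, applied d - 2 times, turns the second expansion into a
    cosine series, and the coefficients of cos (m psi) agree.

    The Fourier coefficients of (2 z - 2 cos psi)^P log (2 z - 2 cos psi) satisfy
    recurrences in P, which identify them with combinations of the Legendre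
    functions Q_(n - 1/2)^(K + 1/2)(z); differentiating h times in cos psi passes to
    Gegenbauer polynomials of index h and replaces P = p + h by p.  A coefficient
    of index at most P carries harmonic numbers and finite sums, the others are a
    single Legendre function: these are the finite part and the tail. *)

(** Evenness of d makes h = d/2 - 1 a natural number, so every Legendre function that occurs has
    lower index N - 1/2 and upper index K + 1/2. Such a function is elementary: up to a fixed factor
    it is a rational expression in q = z - sqrt (z^2 - 1), determined by its first two values and a
    recurrence in K. The finite parts are therefore rational identities proved by induction, and
    analysis is needed only to match the hypergeometric series and the Gamma values with these
    closed forms. The obstacle is convergence. The tail is a (d - 2)-fold iterated infinite series,
    whereas the expansion yields a single series over l. Each iterated sum is rewritten as a single
    sum weighted by chains of indices; the exchange rests on geometric decay of the coefficients
    against weights that the addition theorem at coincident points bounds polynomially in l. Cosine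
    coefficients are compared without integrals, by averaging over equally spaced angles. *)

Lemma lcD {V : zmodType} {a b a' b' : V} : a = b -> a' = b' -> a + a' = b + b'.
Proof. by move=> -> ->. Qed.

Lemma lcM {V : pzRingType} (k : V) {a b : V} : a = b -> k * a = k * b.
Proof. by move->. Qed.

(** The equation [a = b] is a linear combination of known equations, assembled with [lcD] and [lcM];
    its multipliers serve as a certificate, and the remaining [l - r = a - b] is left to [ring] or
    [field]. *)
Lemma lincomb {V : zmodType} {l r a b : V} : a = b -> l - r = a - b -> l = r.
Proof. by move=> ->; rewrite subrr => /eqP; rewrite subr_eq0 => /eqP. Qed.

(** * Recurrences for the two-sided Fourier coefficients of powers, with and without a logarithm *)

(* Fourier coefficients of (2 z - 2 cos psi)^P g(psi), those of g being given *)
Fixpoint powcoef {R : realFieldType} (z : R) (g : int -> R) (P : nat) : int -> R :=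
  if P is P'.+1 then
    fun n => 2 * z * powcoef z g P' n - powcoef z g P' (n + 1)
             - powcoef z g P' (n - 1)
  else g.

Definition one_coef {R : realFieldType} (n : int) : R := (n == 0)%:R.

(* Fourier coefficients of log (2 z - 2 cos psi), where z = (q + 1/q) / 2 and
   L = - ln q *)
Definition log_coef {R : realFieldType} (L q : R) (n : int) : R :=
  if n == 0 then L else - (q ^+ `|n|%N / `|n|%N%:R).

Lemma powcoefS {R : realFieldType} (z : R) g P n :
  powcoef z g P.+1 n = 2 * z * powcoef z g P n - powcoef z g P (n + 1)
             - powcoef z g P (n - 1).
Proof. by []. Qed.

(* This expresses F' = P w' w^(P-1) log w + w' w^(P-1) for F = w^P log w. *)
Lemma powcoef_deriv {R : realFieldType} (z : R) (f d : int -> R) :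
  (forall n, n%:~R * powcoef z f 1 n = f (n + 1) - f (n - 1)
       + d (n + 1) - d (n - 1)) ->
  forall P n, n%:~R * powcoef z f P.+1 n =
    P.+1%:R * (powcoef z f P (n + 1) - powcoef z f P (n - 1))
    + powcoef z d P (n + 1) - powcoef z d P (n - 1).
Proof.
move=> h; elim=> [|P IH] n; first by rewrite mul1r -h.
rewrite powcoefS.
have h0 := IH n; have h1 := IH (n + 1); have h2 := IH (n - 1).
apply: (lincomb (lcD (lcM (2 * z) h0)
   (lcM (-1) (lcD h1 h2)))).
rewrite !powcoefS !rmorphD !rmorphN /= addrK subrK -[P.+2%:R]natr1.
by ring.
Qed.

(** With w = 2 z - 2 cos psi one has w'' = 2 z - w and w'^2 = 4 z w - w^2 - 4 (z^2 - 1), so (w^Q)''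
    is a combination of w^Q, w^(Q-1) and w^(Q-2), here with Q = P + 2. The logarithm arises by
    differentiating w^Q in Q; accordingly the factors of the [d] terms are the derivatives in Q of
    those of the [f] terms. *)
Lemma powcoef_ode {R : realFieldType} (z : R) (f d : int -> R) :
  (forall n, n%:~R * powcoef z f 1 n = f (n + 1) - f (n - 1)
       + d (n + 1) - d (n - 1)) ->
  (forall n, n%:~R * powcoef z d 1 n = d (n + 1) - d (n - 1)) ->
  forall P n,
  ((P%:R + 2) ^+ 2 - n%:~R ^+ 2) * powcoef z f P.+2 n
    + 2 * (P%:R + 2) * powcoef z d P.+2 n
  = 2 * (P%:R + 2) * (2 * P%:R + 3) * z * powcoef z f P.+1 n
    + (8 * P%:R + 14) * z * powcoef z d P.+1 n
    - 4 * (P%:R + 2) * (P%:R + 1) * (z ^+ 2 - 1) * powcoef z f P n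
    - 4 * (2 * P%:R + 3) * (z ^+ 2 - 1) * powcoef z d P n.
Proof.
move=> hf hd P n.
have kf := powcoef_deriv _ _ _ hf.
have hd0 m : m%:~R * powcoef z d 1 m = d (m + 1) - d (m - 1) + 0 - 0.
  by rewrite hd addr0 subr0.
have kd := powcoef_deriv z d (fun=> 0) hd0.
have k0 Q m : powcoef z (fun=> 0) Q m = 0 :> R.
  by elim: Q m => //= Q IH m; rewrite !IH; ring.
have h1 := kf P.+1 n; have h2 := kf P (n + 1); have h3 := kf P (n - 1).
have h4 := kd P (n + 1); have h5 := kd P (n - 1).
move: h1 h2 h3 h4 h5; rewrite !powcoefS !k0 !rmorphD !rmorphN /= addrK subrK.
rewrite -[P.+2%:R]natr1 -[P.+1%:R]natr1 => h1 h2 h3 h4 h5.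
(* Multiplying [h1] by n gives the second derivative; the other four equations replace the
   coefficients at n + 1 and n - 1 that it leaves with a factor n. *)
apply: (lincomb (lcD (lcM (- n%:~R) h1)
   (lcD (lcM (-(P%:R + 2)) h2)
   (lcD (lcM (P%:R + 2) h3)
   (lcD (lcM (-1) h4) h5))))).
by ring.
Qed.

Lemma one_coef_deriv {R : realFieldType} (z : R) n :
  n%:~R * powcoef z one_coef 1 n = one_coef (n + 1) - one_coef (n - 1).
Proof.
rewrite /= /one_coef; have [->|n0] := eqVneq n 0; first by rewrite mul0r /= subrr.
rewrite mulr0 sub0r.
have [e|n1] := eqVneq (n + 1) 0.
  have -> : n - 1 == 0 = false by lia.
  have -> : n = -1 by lia.
  by rewrite rmorphN rmorph1 mulr0n mulr1n; ring.
have [e|n2] := eqVneq (n - 1) 0.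
  have -> : n = 1 by lia.
  by rewrite rmorph1 mulr1n mulr0n; ring.
by rewrite mulr0n; ring.
Qed.

Lemma powcoefN {R : realFieldType} (z : R) g : (forall n, g (- n) = g n) ->
  forall P n, powcoef z g P (- n) = powcoef z g P n.
Proof.
move=> hg; elim=> [//|P IH] n; rewrite !powcoefS IH.
have -> : - n + 1 = - (n - 1) by lia.
have -> : - n - 1 = - (n + 1) by lia.
by rewrite !IH; ring.
Qed.

Lemma log_coefN {R : realFieldType} (L q : R) n : log_coef L q (- n) = log_coef L q n.
Proof. by rewrite /log_coef oppr_eq0 abszN. Qed.

Lemma one_coefN {R : realFieldType} n : one_coef (- n) = one_coef n :> R.
Proof. by rewrite /one_coef oppr_eq0. Qed.

(** This is (w log w)' = w' log w + w' on coefficients. Evenness reduces it to n >= 0, where n = 1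
    meets the exceptional coefficient L and is computed apart. *)
Lemma log_coef_deriv {R : realFieldType} (L q z : R) : q != 0 ->
  2 * z = q + q^-1 -> forall n,
  n%:~R * powcoef z (log_coef L q) 1 n =
  log_coef L q (n + 1) - log_coef L q (n - 1) + one_coef (n + 1) - one_coef (n - 1).
Proof.
move=> q0 hz.
have pos k : k%:Z%:~R * powcoef z (log_coef L q) 1 k%:Z =
  log_coef L q (k%:Z + 1) - log_coef L q (k%:Z - 1) + one_coef (k%:Z + 1) - one_coef (k%:Z - 1).
  case: k => [|[|k]].
  - by rewrite sub0r add0r log_coefN one_coefN mul0r; ring.
  - rewrite /= hz /log_coef /one_coef.
    have -> : 1%:Z + 1 = 2%:Z by lia.
    have -> : 1%:Z - 1 = 0 by lia.
    by rewrite !absz_nat eqxx /= -pmulrn mulr0n mulr1n; field.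
  - rewrite /= hz /log_coef /one_coef.
    have -> : k.+2%:Z + 1 = k.+3%:Z by lia.
    have -> : k.+2%:Z - 1 = k.+1%:Z by lia.
    rewrite !absz_nat /= -pmulrn !exprS.
    have a1 : k.+1%:R != 0 :> R by rewrite pnatr_eq0.
    have a2 : k.+2%:R != 0 :> R by rewrite pnatr_eq0.
    have a3 : k.+3%:R != 0 :> R by rewrite pnatr_eq0.
    move: a1 a2 a3; rewrite -[k.+3%:R]natr1 -[k.+2%:R]natr1 -[k.+1%:R]natr1 => a1 a2 a3.
    by field; rewrite q0 a1 a2 a3.
move=> n; have [k [->|->]] : exists k : nat, n = k%:Z \/ n = - k%:Z.
  by exists `|n|%N; lia.
  exact: pos.
rewrite powcoefN; last exact: log_coefN.
rewrite rmorphN mulNr pos.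
have -> : - k%:Z + 1 = - (k%:Z - 1) by lia.
have -> : - k%:Z - 1 = - (k%:Z + 1) by lia.
by rewrite !log_coefN !one_coefN; ring.
Qed.

(** * Legendre functions of half-odd indices, and the coefficients that are a single one of them *)

(* The associated Legendre function of the second kind with lower index N - 1/2
   and upper index K + 1/2, up to the factor i (2 pi)^(1/2) (z^2 - 1)^(1/4);
   here z = (q^-1 + q) / 2 and E = (q^-1 - q) / 2 is the square root of z^2 - 1. *)
Fixpoint legS {R : realFieldType} (z E q : R) (N K : nat) : R :=
  match K with
  | 0 => q ^+ N / (2 * E)
  | K1.+1 =>
    match K1 with
    | 0 => - (z / E + N%:R) * (q ^+ N / (2 * E))
    | K2.+1 => - (2 * K1%:R + 1) * (z / E) * legS z E q N K1
               - (K1%:R ^+ 2 - N%:R ^+ 2) * legS z E q N K2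
    end
  end.

Lemma legSS {R : realFieldType} (z E q : R) N K :
  legS z E q N K.+2 = - (2 * K.+1%:R + 1) * (z / E) * legS z E q N K.+1
               - (K.+1%:R ^+ 2 - N%:R ^+ 2) * legS z E q N K.
Proof. by []. Qed.

Lemma sqr_subE {R : realFieldType} (z E q : R) :
  q != 0 -> 2 * z = q^-1 + q -> 2 * E = q^-1 - q -> z ^+ 2 - 1 = E ^+ 2.
Proof.
move=> q0 hz hE.
have -> : z = (q^-1 + q) / 2 by rewrite -hz; field.
have -> : E = (q^-1 - q) / 2 by rewrite -hE; field.
by field.
Qed.

(** Passage between the orders N and N + 1. Each induction step on K uses both relations, so they
    are proved together; the base case is z + E = 1/q and z - E = q. *)
Lemma legS_lower {R : realFieldType} (z E q : R) :
  q != 0 -> E != 0 -> 2 * z = q^-1 + q -> 2 * E = q^-1 - q ->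
  forall K,
  (forall N, - E * legS z E q N.+1 K.+1 =
     z * (K%:R - N%:R) * legS z E q N.+1 K + (K%:R + N%:R + 1) * legS z E q N K) /\
  (forall N, - E * legS z E q N K.+1 =
     z * (K%:R + 1 + N%:R) * legS z E q N K + (K%:R - N%:R) * legS z E q N.+1 K).
Proof.
move=> q0 E0 hz hE.
have hzE : z ^+ 2 = E ^+ 2 + 1 by rewrite -(sqr_subE _ _ _ q0 hz hE); ring.
have zE : z + E = q^-1.
  by apply: (mulfI (x := 2%:R)) => //; rewrite mulrDr hz hE; ring.
have zE' : z - E = q.
  by apply: (mulfI (x := 2%:R)) => //; rewrite mulrBr hz hE; ring.
elim=> [|K [IHb IHb']].
  split=> N.
    have hq : q ^+ N = (z + E) * q ^+ N.+1 by rewrite zE exprS mulKf.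
    by rewrite /legS hq -[N.+1%:R]natr1; field.
  have hq : q ^+ N.+1 = (z - E) * q ^+ N by rewrite zE' exprS.
  by rewrite /legS hq; field.
split=> N.
  have e1 := IHb N; have e2 := IHb' N; rewrite legSS.
  apply: (mulfI E0).
  rewrite (_ : E * _ = - E * (- (2 * K.+1%:R + 1) * z * legS z E q N.+1 K.+1)
      + E ^+ 2 * (K.+1%:R ^+ 2 - N.+1%:R ^+ 2) * legS z E q N.+1 K); last by field.
  move: e1 e2; rewrite -[K.+1%:R]natr1 -[N.+1%:R]natr1 => e1 e2.
  apply: (lincomb (lcD (lcM (- z * (K%:R + N%:R + 2)) e1)
     (lcM (K%:R + N%:R + 2) e2))).
  have -> : E ^+ 2 = z ^+ 2 - 1 by rewrite hzE; ring.
  by ring.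
have e1 := IHb N; have e2 := IHb' N; rewrite legSS.
apply: (mulfI E0).
rewrite (_ : E * _ = - E * (- (2 * K.+1%:R + 1) * z * legS z E q N K.+1)
      + E ^+ 2 * (K.+1%:R ^+ 2 - N%:R ^+ 2) * legS z E q N K); last by field.
move: e1 e2; rewrite -[K.+1%:R]natr1 -?[N.+1%:R]natr1 => e1 e2.
apply: (lincomb (lcD (lcM (- z * (K%:R + 1 - N%:R)) e2)
     (lcM (K%:R + 1 - N%:R) e1))).
have -> : E ^+ 2 = z ^+ 2 - 1 by rewrite hzE; ring.
by ring.
Qed.

(** At K = N the first relation of [legS_lower] loses its first term, which leaves a one-step
    recursion along the diagonal. *)
Lemma legS_diag {R : realFieldType} (z E q : R) :
  q != 0 -> E != 0 -> 2 * z = q^-1 + q -> 2 * E = q^-1 - q ->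
  forall N, (2 * E) ^+ N.+1 * legS z E q N N * N`!%:R = (-1) ^+ N * (2 * N)`!%:R.
Proof.
move=> q0 E0 hz hE; elim=> [|N IH].
  by rewrite /= muln0 fact0; field.
have e : - E * legS z E q N.+1 N.+1 = (2 * N%:R + 1) * legS z E q N N.
  by rewrite (proj1 (legS_lower _ _ _ q0 E0 hz hE N)); ring.
rewrite mulnS add2n !factS !natrM exprS (exprS (-1)).
have -> : (2 * N).+2%:R = 2 * (N.+1)%:R :> R by rewrite -natrM mulnS.
rewrite -[N.+1%:R]natr1 -[(2 * N).+1%:R]natr1 natrM.
apply: (lincomb (lcD (lcM (-2 * (2 * E) ^+ N.+1 * (N%:R + 1) * N`!%:R) e) (lcM (-2 * (2 * N%:R + 1) * (N%:R + 1)) IH))).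
by ring.
Qed.

Lemma delta_far {R : realFieldType} (z : R) P (n : int) : (P < `|n|)%N ->
  powcoef z one_coef P n = 0.
Proof.
elim: P n => [|P IH] n hn.
  by rewrite /= /one_coef; case: eqP hn => // ->.
by rewrite powcoefS !IH; [ring|lia|lia|lia].
Qed.

Lemma ind2 (P : nat -> Prop) : P 0%N -> P 1%N ->
  (forall n, P n -> P n.+1 -> P n.+2) -> forall n, P n.
Proof.
move=> h0 h1 hS n; suff: P n /\ P n.+1 by case.
by elim: n => [//|n [a b]]; split=> //; apply: hS.
Qed.

Lemma fact_neq0 {R : realFieldType} n : n`!%:R != 0 :> R.
Proof. by rewrite pnatr_eq0 -lt0n fact_gt0. Qed.

(** The plain powers have no coefficient at n beyond their degree, so the recurrence of
    [powcoef_ode] becomes homogeneous there; the right-hand side satisfies it by the recurrence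
    defining [legS]. *)
Lemma log_tail {R : realFieldType} (z E q L : R) :
  q != 0 -> E != 0 -> 2 * z = q^-1 + q -> 2 * E = q^-1 - q ->
  forall (n P : nat), (P < n)%N ->
  powcoef z (log_coef L q) P n%:Z =
  - (P`!%:R * (n - P - 1)`!%:R / (P + n)`!%:R * (2 * E) ^+ P.+1 * legS z E q n P).
Proof.
move=> q0 E0 hz hE n.
have hz' : 2 * z = q + q^-1 by rewrite hz addrC.
have zE : z + E = q^-1.
  by apply: (mulfI (x := 2%:R)) => //; rewrite mulrDr hz hE; ring.
have hode := powcoef_ode z (log_coef L q) one_coef (log_coef_deriv _ _ _ q0 hz')
   (one_coef_deriv z).
have n1 k : k.+1%:R != 0 :> R by rewrite pnatr_eq0.
elim/ind2 => [|  |P IH0 IH1] hn.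
- case: n hn => // n _.
  rewrite /= /log_coef /= factS natrM.
  rewrite subn0 subn1 /=.
  by rewrite fact0; field; rewrite fact_neq0 E0 addrC natr1 n1.
- have := powcoef_deriv _ _ _ (log_coef_deriv L _ _ q0 hz') 0 n%:Z.
  have dz (m : int) : (0 < `|m|)%N -> one_coef m = 0 :> R.
    by move=> hm; rewrite /one_coef; case: eqP hm => // ->.
  case: n hn => // -[//|n] _.
  rewrite [powcoef _ one_coef 0]/= !dz; [|by lia|by lia].
  rewrite /= /log_coef.
  have -> : n.+2%:Z + 1 = n.+3%:Z by lia.
  have -> : n.+2%:Z - 1 = n.+1%:Z by lia.
  rewrite !absz_nat /= => h; apply: (mulfI (n1 n.+1)); rewrite h.
  rewrite subn1 subn1 add1n !factS !natrM fact0 !exprS /=.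
  have := fact_neq0 (R := R) n; have := n1 n.+2; have := n1 n.+1; have := n1 n.
  rewrite -[n.+3%:R]natr1 -[n.+2%:R]natr1 -[n.+1%:R]natr1 => a b c e.
  have -> : z = (q^-1 + q) / 2 by rewrite -hz; field.
  have h2 : (q^-1 - q) != 0 by rewrite -hE mulf_neq0.
  have -> : E = (q^-1 - q) / 2 by rewrite -hE; field.
  field; rewrite q0 a b c e /=.
  rewrite andbT; apply: contra_neq h2 => h2.
  by rewrite -[q^-1 - q](mulfK q0) mulrBl mulVf // -mulNr h2 mul0r.
- have [k hk] : exists k, n = (P + k + 3)%N by exists (n - P - 3)%N; lia.
  have lt1 : (P.+1 < n)%N by lia.
  have lt0 : (P < n)%N by lia.
  have := hode P n%:Z; rewrite !delta_far ?absz_nat // IH0 // IH1 //.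
  rewrite legSS (sqr_subE _ _ _ q0 hz hE).
  set S1 := legS _ _ _ _ _; set S0 := legS _ _ _ _ _.
  set F := powcoef _ _ _ _.
  have -> : (n - P - 1 = k.+2)%N by lia.
  have -> : (n - P.+1 - 1 = k.+1)%N by lia.
  have -> : (n - P.+2 - 1 = k)%N by lia.
  have -> : (P.+2 + n = (P + n).+2)%N by lia.
  have -> : (P.+1 + n = (P + n).+1)%N by lia.
  have nE : n%:R = P%:R + k%:R + 3 :> R by rewrite hk !natrD.
  have a1 := n1 (P + n)%N; have a2 := n1 (P + n).+1.
  have c1 : P%:R + 2 - n%:R != 0 :> R.
    by rewrite (_ : _ - _ = - k.+1%:R) ?oppr_eq0 // nE -natr1; ring.
  have c2 : P%:R + 2 + n%:R != 0 :> R.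
    have -> : P%:R + 2 + n%:R = (P + n).+2%:R :> R by rewrite -addn2 !natrD; ring.
    exact: n1.
  (* The leading factor of the recurrence does not vanish, as P + 2 < n. *)
  have c0 : (P%:R + 2) ^+ 2 - n%:R ^+ 2 != 0 :> R by rewrite subr_sqr mulf_neq0.
  rewrite -pmulrn => h; apply: (mulfI c0).
  move: h => /(canRL (addrK _)) ->.
  rewrite !factS !natrM !(exprS (2 * E)).
  move: a1 a2.
  rewrite -[(P + n).+2%:R]natr1 -[(P + n).+1%:R]natr1 natrD -[P.+2%:R]natr1 -[P.+1%:R]natr1.
  rewrite -[k.+2%:R]natr1 -[k.+1%:R]natr1 nE => a1 a2.
  by field; rewrite E0 fact_neq0 a1 a2.
Qed.

Lemma delta_diag {R : realFieldType} (z : R) n :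
  powcoef z one_coef n n%:Z = (-1) ^+ n.
Proof.
elim: n => [//|n IH]; rewrite powcoefS (delta_far _ _ n.+1%:Z) ?(delta_far _ _ (n.+1%:Z + 1)); try lia.
have -> : n.+1%:Z - 1 = n%:Z by lia.
by rewrite IH exprS; ring.
Qed.

(** The recurrence in P is now started at P = n, where [delta_diag] and [legS_diag] give the value,
    and at P = n + 1. Its leading factor (P + 2)^2 - n^2 with P = n + j is (j + 2) (2 n + j + 2),
    hence nonzero. *)
Lemma delta_leg {R : realFieldType} (z E q : R) :
  q != 0 -> E != 0 -> 2 * z = q^-1 + q -> 2 * E = q^-1 - q ->
  forall (n j : nat),
  powcoef z one_coef (n + j) n%:Z =
  (-1) ^+ j * (n + j)`!%:R * (2 * E) ^+ (n + j).+1 * legS z E q n (n + j)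
    / (j`!%:R * (2 * n + j)`!%:R).
Proof.
move=> q0 E0 hz hE n.
have d0 m : m%:~R * powcoef z one_coef 1 m = one_coef (m + 1) - one_coef (m - 1) + 0 - 0 :> R.
  by rewrite one_coef_deriv addr0 subr0.
have z0 m : m%:~R * powcoef z (fun=> 0) 1 m = 0 - 0 :> R.
  by rewrite /=; ring.
have k0 Q m : powcoef z (fun=> 0) Q m = 0 :> R.
  by elim: Q m => //= Q IH m; rewrite !IH; ring.
have hode := powcoef_ode z _ _ d0 z0.
have n1 k : k.+1%:R != 0 :> R by rewrite pnatr_eq0.
elim/ind2 => [|  |j IH0 IH1].
- rewrite !addn0 delta_diag fact0 !mul1r.
  have e := legS_diag _ _ _ q0 E0 hz hE n.
  apply: (mulfI (fact_neq0 (2 * n))); rewrite mulrC -e.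
  by field; rewrite !fact_neq0.
(* For n = 0 the value is computed directly; otherwise the recurrence applies, and the coefficient
   of the lowest of its three powers vanishes. *)
- case: n => [|n].
    rewrite add0n /= /one_coef /= !factS fact0; field.
    by rewrite E0.
  have := hode n n.+1%:Z; rewrite !k0 (delta_far _ n) ?absz_nat // delta_diag.
  have e := legS_diag _ _ _ q0 E0 hz hE n.+1.
  have e1 : (-1) ^+ n.+1 = n.+1`!%:R * (2 * E) ^+ n.+2 * legS z E q n.+1 n.+1 / (2 * n.+1)`!%:R.
    apply: (mulfI (fact_neq0 (2 * n.+1))); rewrite mulrC -e.
    by field; rewrite !fact_neq0.
  rewrite e1 addn1 legSS subrr mul0r subr0 => h.
  have c0 : (n%:R + 2) ^+ 2 - n.+1%:R ^+ 2 != 0 :> R.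
    have -> : (n%:R + 2) ^+ 2 - n.+1%:R ^+ 2 = (2 * n).+3%:R :> R.
      by rewrite -addn3 natrD natrM -natr1; ring.
    exact: n1.
  apply: (mulfI c0).
  move: h => /(canRL (addrK _)); rewrite -pmulrn => ->.
  rewrite addn1 (factS n.+1) (factS (2 * n.+1)) natrM (natrM _ (2 * n.+1).+1) (_ : 1`! = 1%N) //.
  have := n1 (2 * n.+1)%N; rewrite -[(2 * n.+1).+1%:R]natr1 natrM.
  rewrite -[n.+2%:R]natr1 -[n.+1%:R]natr1 => h3.
  rewrite !exprS.
  by field; rewrite E0 h3 !fact_neq0.
- have h := hode (n + j)%N n%:Z; move: h; rewrite !k0 -!addnS IH0 IH1 -pmulrn.
  rewrite (sqr_subE _ _ _ q0 hz hE) !addnS legSS.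
  have c0 : ((n + j)%:R + 2) ^+ 2 - n%:R ^+ 2 != 0 :> R.
    have -> : ((n + j)%:R + 2) ^+ 2 - n%:R ^+ 2 = j.+2%:R * (2 * n + j).+2%:R :> R.
      by rewrite -[j.+2%:R]natr1 -[j.+1%:R]natr1 -[(2 * n + j).+2%:R]natr1 -[(2 * n + j).+1%:R]natr1 (natrD _ (2 * n)) natrM natrD; ring.
    by rewrite mulf_neq0.
  move=> h; apply: (mulfI c0).
  move: h => /(canRL (addrK _)) ->.
  have := n1 (2 * n + j)%N; have := n1 (2 * n + j).+1; have := n1 j; have := n1 j.+1.
  rewrite !factS !natrM !exprS.
  rewrite -[(n + j).+2%:R]natr1 -[(n + j).+1%:R]natr1 natrD -[j.+2%:R]natr1 -[j.+1%:R]natr1.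
  rewrite -[(2 * n + j).+2%:R]natr1 -[(2 * n + j).+1%:R]natr1 (natrD _ (2 * n)) natrM => a b c e.
  have := fact_neq0 (R := R) j; have := fact_neq0 (R := R) (2 * n + j).
  move: ((2 * n + j)`!%:R) ((n + j)`!%:R) (j`!%:R) ((2 * E) ^+ (n + j)) (legS _ _ _ _ _) (legS _ _ _ _ _) => f1 f2 f3 X S1 S0 f10 f30.
  by field; rewrite E0 f10 f30 a b c e.
Qed.

(** * Finite sums of Legendre functions, and the logarithmic coefficients of index at most P *)

Arguments legS : simpl never.
Arguments powcoef : simpl never.

(** Side conditions of [field]: a denominator is shown to be positive from its shape, or by linear
    arithmetic from the nonnegativity facts in the context. *)
Ltac nzlra := repeat (apply/andP; split); try assumption;
  try (apply: lt0r_neq0;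
       first [ solve [ repeat first [ exact: ler0n | exact: ltr01 | exact: ler01
                 | exact: ltr0Sn | apply: ltr_wpDl | apply: addr_ge0 | apply: mulr_ge0 ] ]
             | repeat match goal with h : _ = _ |- _ => clear h end; lra ]).

(** Common shape of the finite sums on both sides of the theorem, with [c K] equal to 1 / (K - n)!
    or to 1 / (K + n)!. The weight is 1 / (P - K) - 1 / (P + K + 1), and its denominator is P (P +
    1) - K (K + 1). *)
Definition legsum {R : realFieldType} (z E q : R) (N : nat) (c : nat -> R) (P : nat) : R :=
  \sum_(0 <= K < P) (2 * K%:R + 1) / ((P%:R - K%:R) * (P%:R + K%:R + 1))
     * c K * legS z E q N K.

(** Applied to the weights, the recurrence that [legS] satisfies in P gives a telescoping sum, so
    that only contributions from the upper end survive. Both signs nu = N and nu = - N occur later;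
    the condition on [c 0] is what the telescoping needs at K = 0. *)
Lemma legsum_rec {R : realFieldType} (z E q nu : R) (N : nat) (c : nat -> R) :
  q != 0 -> E != 0 ->
  nu ^+ 2 = N%:R ^+ 2 -> N%:R * c 0%N = - nu * c 0%N ->
  (forall K, c K = (K.+1%:R - nu) * c K.+1) ->
  forall P,
  (P%:R + 2 - nu) * legsum z E q N c P.+2 + (2 * P%:R + 3) * (z / E) * legsum z E q N c P.+1
    + (P%:R + 1 + nu) * legsum z E q N c P
  = ((P%:R + 2 - nu) * (2 * P%:R + 3) / (2 * (P%:R + 2))
      - (2 * P%:R + 3) * (P%:R + 1 - nu) / (2 * (P%:R + 1))) * c P.+1 * legS z E q N P.+1
   + ((P%:R + 2 - nu) * (2 * P%:R + 1) / (2 * (2 * P%:R + 3))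
      - (2 * P%:R + 3) * (P%:R - nu) / (2 * (2 * P%:R + 1))) * c P * legS z E q N P.
Proof.
move=> q0 E0 hnu hc0 hc P.
have n1 k : k.+1%:R != 0 :> R by rewrite pnatr_eq0.
have p1 : (P%:R + 1 : R) != 0 by rewrite natr1 n1.
have p2 : (P%:R + 2 : R) != 0 by rewrite -natrD addn2.
have p3 : (2 * P%:R + 1 : R) != 0 by rewrite -natrM natr1.
have p4 : (2 * P%:R + 3 : R) != 0 by rewrite -natrM -natrD addn3.
pose X K := ((P%:R + 2 - nu) * ((2 * K%:R + 1) / ((P%:R + 2 - K%:R) * (P%:R + 2 + K%:R + 1)))
   + (2 * P%:R + 3) * (z / E) * ((2 * K%:R + 1) / ((P%:R + 1 - K%:R) * (P%:R + 1 + K%:R + 1)))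
   + (P%:R + 1 + nu) * ((2 * K%:R + 1) / ((P%:R - K%:R) * (P%:R + K%:R + 1))))
     * c K * legS z E q N K.
(* The telescoped partial sums; M < P keeps the denominators nonzero, and K = P and K = P + 1 are
   treated apart. *)
have T M : (M < P)%N -> \sum_(0 <= K < M.+1) X K = (2 * P%:R + 3) * c M *
   ((M%:R + 1 + nu) * legS z E q N M / ((P%:R - M%:R) * (P%:R + M%:R + 3))
    - legS z E q N M.+1 / ((P%:R + 1 - M%:R) * (P%:R + 2 + M%:R))).
  elim: M => [|M IH] hM.
    have p5 : (P%:R : R) != 0 by rewrite pnatr_eq0; lia.
    have p6 : (P%:R + 3 : R) != 0 by rewrite -natrD addn3.
    rewrite big_nat1 /X /legS !addr0 !subr0.
    apply: (lincomb (lcM (- (2 * P%:R + 3) / ((P%:R + 1) * (P%:R + 2)) * (q ^+ N / (2 * E))) hc0)).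
    by field; rewrite E0 p1 p2 p5 p6.
  rewrite big_nat_recr //= IH ?(ltn_trans _ hM) // /X legSS (hc M).
  have [k hk] : exists k, P = (M + k + 2)%N by exists (P - M - 2)%N; lia.
  rewrite hk.
  have := ler0n R M; have := ler0n R k; rewrite -natr1 !natrD.
  move=> h1 h2; rewrite -hnu.
  by field; nzlra.
have sumX : (P%:R + 2 - nu) * (\sum_(0 <= K < P) (2 * K%:R + 1) / ((P%:R + 2 - K%:R) * (P%:R + 2 + K%:R + 1))
       * c K * legS z E q N K)
   + (2 * P%:R + 3) * (z / E) * (\sum_(0 <= K < P) (2 * K%:R + 1) / ((P%:R + 1 - K%:R) * (P%:R + 1 + K%:R + 1))
       * c K * legS z E q N K)
   + (P%:R + 1 + nu) * (\sum_(0 <= K < P) (2 * K%:R + 1) / ((P%:R - K%:R) * (P%:R + K%:R + 1))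
       * c K * legS z E q N K) = \sum_(0 <= K < P) X K.
  rewrite !big_distrr -!big_split /=; apply: eq_bigr => K _; rewrite /X.
  by ring.
have pp := ler0n R P.
have eP2 : P.+2%:R = P%:R + 2 :> R by rewrite -natrD addn2.
have key : (P%:R + 2 - nu) * legsum z E q N c P.+2
    + (2 * P%:R + 3) * (z / E) * legsum z E q N c P.+1
    + (P%:R + 1 + nu) * legsum z E q N c P
  = \sum_(0 <= K < P) X K + ((P%:R + 2 - nu) *
     ((2 * P%:R + 1) / (2 * (2 * P%:R + 3)) * c P * legS z E q N P
      + (2 * P%:R + 3) / (2 * (P%:R + 2)) * c P.+1 * legS z E q N P.+1)
     + (2 * P%:R + 3) * (z / E) * ((2 * P%:R + 1) / (2 * (P%:R + 1)) * c P * legS z E q N P)).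
  rewrite /legsum !big_nat_recr //= eP2 -[P.+1%:R]natr1; apply: (lincomb sumX).
  by field; nzlra.
rewrite key {key}.
have cP : c P = (P%:R + 1 - nu) * c P.+1 by rewrite natr1 -hc.
case: P => [|Q] in X T sumX p1 p2 p3 p4 pp eP2 cP *.
  rewrite big_nil; move: hc0; rewrite cP /legS => hc0.
  apply: (lincomb (lcM (- (3 / 2) * (q ^+ N / (2 * E))) hc0)).
  by field; nzlra.
rewrite T // legSS cP (hc Q) cP -hnu.
have := ler0n R Q; move: pp; rewrite -natr1 => pp qq.
by field; nzlra.
Qed.

(** The derivative relation leads from power and index n to power and index n + 1. The coefficient
    at n + 2 that it also involves lies beyond the degree and is known from [log_tail]. *)
Lemma log_diag {R : realFieldType} (z E q L : R) (H : nat -> R) :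
  q != 0 -> E != 0 -> 2 * z = q^-1 + q -> 2 * E = q^-1 - q ->
  H 0%N = 0 -> (forall n, H n.+1 = H n + n.+1%:R^-1) ->
  forall n, powcoef z (log_coef L q) n n%:Z =
    (-1) ^+ n * (L + H (2 * n)%N)
    + n`!%:R * (2 * E) ^+ n.+1 * legsum z E q n (fun K => (K + n)`!%:R^-1) n.
Proof.
move=> q0 E0 hz hE H0 HS.
have hz' : 2 * z = q + q^-1 by rewrite hz addrC.
have n1 k : k.+1%:R != 0 :> R by rewrite pnatr_eq0.
have hder := powcoef_deriv _ _ _ (log_coef_deriv L _ _ q0 hz').
elim=> [|n IH].
  by rewrite /legsum big_nil /powcoef /log_coef /= H0; ring.
have := hder n n.+1%:Z; rewrite delta_far; last by lia.
have -> : n.+1%:Z - 1 = n%:Z by lia.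
have -> : n.+1%:Z + 1 = n.+2%:Z by lia.
rewrite delta_diag IH (log_tail z E q L q0 E0 hz hE n.+2 n) // -pmulrn.
have -> : (n.+2 - n - 1 = 1)%N by lia.
have -> : (2 * n.+1 = (2 * n).+2)%N by lia.
rewrite !HS => h; apply: (mulfI (n1 n)); rewrite h {h}.
have e2 := proj2 (legS_lower _ _ _ q0 E0 hz hE n) n.+1.
have e2' : legS z E q n.+2 n = E * legS z E q n.+1 n.+1 + z * (2 * n%:R + 2) * legS z E q n.+1 n.
  by apply: (lincomb e2); rewrite -natr1; ring.
(* On the diagonal a bare sign is itself a multiple of a Legendre function, which gives all terms a
   common form. *)
have ed : (-1) ^+ n = - (n.+1`!%:R * (2 * E) ^+ n.+2 * legS z E q n.+1 n.+1 / (2 * n.+1)`!%:R).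
  apply: (mulfI (fact_neq0 (2 * n.+1))).
  have h := legS_diag _ _ _ q0 E0 hz hE n.+1; move: h; rewrite (exprS (-1)) => h.
  by apply: (lincomb h); field; rewrite fact_neq0.
(* Once [legS] of order n is rewritten in order n + 1, the two sums combine and telescope. *)
have T M : (M < n)%N ->
  \sum_(0 <= K < M.+1) ((2 * K%:R + 1) / ((n%:R - K%:R) * (n%:R + K%:R + 1))
     * (K + n)`!%:R^-1 * legS z E q n K
   + 2 * n.+1%:R * E * ((2 * K%:R + 1) / ((n.+1%:R - K%:R) * (n.+1%:R + K%:R + 1))
     * (K + n.+1)`!%:R^-1 * legS z E q n.+1 K))
  = - E * legS z E q n.+1 M.+1 / ((n%:R - M%:R) * (n.+1 + M)`!%:R)
    - E * (n%:R - M%:R) / (n.+1 + M).+1`!%:R * legS z E q n.+1 M.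
  have lower K : legS z E q n K = (- E * legS z E q n.+1 K.+1 - z * (K%:R - n%:R) * legS z E q n.+1 K) / (K%:R + n%:R + 1).
    have c0 : K%:R + n%:R + 1 != 0 :> R by rewrite -natrD natr1.
    apply: (mulfI c0).
    apply: (lincomb (lcM (-1) (proj1 (legS_lower _ _ _ q0 E0 hz hE K) n))).
    by field.
  elim: M => [|M IHM] hM.
    rewrite big_nat1 lower !add0n !addn0 !factS !natrM /legS subr0 !addr0 add0r.
    have := ler0n R n; have nn : n%:R != 0 :> R by rewrite pnatr_eq0; lia.
    rewrite -[n.+2%:R]natr1 -natr1 => h.
    by field; rewrite fact_neq0; nzlra.
  rewrite big_nat_recr //= IHM ?(ltn_trans _ hM) // lower legSS.
  have [k hk] : exists k, n = (M + k + 2)%N by exists (n - M - 2)%N; lia.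
  have -> : (M.+1 + n = (n + M).+1)%N by lia.
  have -> : (M.+1 + n.+1 = (n + M).+2)%N by lia.
  have -> : (n.+1 + M.+1 = (n + M).+2)%N by lia.
  have -> : (n.+1 + M = (n + M).+1)%N by lia.
  rewrite !factS !natrM -[(n + M).+3%:R]natr1 -[(n + M).+2%:R]natr1 -[(n + M).+1%:R]natr1 natrD.
  have -> : n.+1%:R = n%:R + 1 :> R by rewrite natr1.
  have -> : M.+1%:R = M%:R + 1 :> R by rewrite natr1.
  have -> : n%:R = M%:R + k%:R + 2 :> R by rewrite hk !natrD.
  have := ler0n R M; have := ler0n R k => h1 h2.
  by field; rewrite fact_neq0; nzlra.
have S : 2 * n.+1%:R * E * legsum z E q n.+1 (fun K => (K + n.+1)`!%:R^-1) n.+1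
  + legsum z E q n (fun K => (K + n)`!%:R^-1) n
  = - (legS z E q n.+2 n / (2 * n).+2`!%:R)
    - E * legS z E q n.+1 n.+1 / ((2 * n).+2`!%:R * (2 * n%:R + 1)).
  have := ler0n R n => nn.
  case: n => [|m] in IH e2 e2' ed T nn *.
    rewrite /legsum big_nil big_nat1 e2' muln0 !factS fact0 /legS.
    by field; nzlra.
  rewrite /legsum big_nat_recr //= mulrDr addrAC big_distrr -big_split /=.
  under eq_bigr do rewrite addrC.
  rewrite (T m) // e2' legSS.
  have -> : (m.+2 + m = (2 * m).+2)%N by lia.
  have -> : (m.+1 + m.+2 = (2 * m).+3)%N by lia.
  have -> : (2 * m.+1 = (2 * m).+2)%N by lia.
  rewrite !factS !natrM -[(2 * m).+4%:R]natr1 -[(2 * m).+3%:R]natr1 -[(2 * m).+2%:R]natr1.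
  rewrite -[(2 * m).+1%:R]natr1 natrM -[m.+2%:R]natr1 -[m.+1%:R]natr1.
  move: (fact_neq0 (R := R) (2 * m)); move: ((2 * m)`!%:R) => F F0.
  have := ler0n R m => mm.
  by field; nzlra.
apply: (lincomb (lcM (- (n.+1%:R * n`!%:R * (2 * E) ^+ n.+1)) S)).
rewrite (exprS (-1)) {}ed.
have -> : (n + n.+2 = (2 * n).+2)%N by lia.
rewrite (_ : 1`! = 1%N) // !(exprS (2 * E)).
have -> : (2 * n.+1 = (2 * n).+2)%N by lia.
rewrite !factS !natrM -[(2 * n).+2%:R]natr1 -[(2 * n).+1%:R]natr1 natrM -[n.+1%:R]natr1.
have := ler0n R n => nn.
move: (fact_neq0 (R := R) (2 * n)); move: ((2 * n)`!%:R) => F F0.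
by field; nzlra.
Qed.

(** Induction on j with [powcoef_ode], whose inhomogeneous terms are given by [delta_leg]. The two
    sums follow [legsum_rec] with nu = n and nu = - n, and the multiples of [legS] left over are the
    increments of the harmonic numbers. *)
Lemma log_leg {R : realFieldType} (z E q L : R) (H : nat -> R) :
  q != 0 -> E != 0 -> 2 * z = q^-1 + q -> 2 * E = q^-1 - q ->
  H 0%N = 0 -> (forall n, H n.+1 = H n + n.+1%:R^-1) ->
  forall n j, powcoef z (log_coef L q) (n + j) n%:Z =
    (-1) ^+ j * (n + j)`!%:R * (2 * E) ^+ (n + j).+1
    * (legS z E q n (n + j) / (j`!%:R * (2 * n + j)`!%:R)
         * (L + 2 * H (2 * (n + j))%N - H (2 * n + j)%N - H j)
       + legsum z E q n (fun K => if (n <= K)%N then (K - n)`!%:R^-1 else 0) (n + j)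
           / (2 * n + j)`!%:R
       + legsum z E q n (fun K => (K + n)`!%:R^-1) (n + j) / j`!%:R).
Proof.
move=> q0 E0 hz hE H0 HS n.
have hz' : 2 * z = q + q^-1 by rewrite hz addrC.
have n1 k : k.+1%:R != 0 :> R by rewrite pnatr_eq0.
have hld := log_coef_deriv L _ _ q0 hz'.
have hode := powcoef_ode _ _ _ hld (one_coef_deriv z).
have nn := ler0n R n.
set cp := fun K => if _ then _ else _; set cm := fun K => (K + n)`!%:R^-1.
have recp := legsum_rec z E q n%:R n cp q0 E0 erefl.
have recm := legsum_rec z E q (- n%:R) n cm q0 E0 (sqrrN _).
have {}recp : _ := recp _ _ _.
have {}recm : _ := recm _ _ _.
have hp0 : n%:R * cp 0%N = - n%:R * cp 0%N.
  by rewrite /cp; case: (n) => [|k] /=; ring.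
have hp K : cp K = (K.+1%:R - n%:R) * cp K.+1.
  rewrite /cp; have [h|h] := leqP n K.
    rewrite (leqW h) subSn // factS natrM -natrB ?(leqW h) // subSn //.
    by field; rewrite fact_neq0 addrC natr1 n1.
  have [h2|h2] := leqP n K.+1; last by rewrite mulr0.
  have -> : n = K.+1 by lia.
  by rewrite subrr mul0r.
have hm0 : n%:R * cm 0%N = - (- n%:R) * cm 0%N by ring.
have hm K : cm K = (K.+1%:R - (- n%:R)) * cm K.+1.
  rewrite /cm addSn factS natrM -[(K + n).+1%:R]natr1 natrD -natr1.
  have := ler0n R K => kk.
  by field; rewrite fact_neq0; nzlra.
have {}recp := recp hp0 hp; have {}recm := recm hm0 hm.
have lcp : legsum z E q n cp n = 0.
  rewrite /legsum big_nat big1 // => K /andP[_ hK].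
  by rewrite /cp leqNgt hK /= mulr0 mul0r.
have ed : (-1) ^+ n = n`!%:R * (2 * E) ^+ n.+1 * legS z E q n n / (2 * n)`!%:R.
  apply: (mulfI (fact_neq0 (2 * n))).
  have h := legS_diag _ _ _ q0 E0 hz hE n.
  by apply: (lincomb (lcM (-1) h)); field; rewrite fact_neq0.
have lcp1 : legsum z E q n cp n.+1 = (2 * n%:R + 1) / (2 * n%:R + 2) * legS z E q n n.
  rewrite /legsum big_nat_recr //= big_nat big1 => [|K /andP[_ hK]].
    by rewrite /cp leqnn subnn fact0 -[n.+1%:R]natr1; field; nzlra.
  by rewrite /cp leqNgt hK /= mulr0 mul0r.
elim/ind2 => [|  |j IH0 IH1].
- rewrite !addn0 (log_diag z E q L H) // -/cm lcp ed H0 fact0.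
  by field; rewrite !fact_neq0.
- have l1 := log_diag z E q L H q0 E0 hz hE H0 HS n.
  have hder := powcoef_deriv _ _ _ hld n n%:Z.
  move: (powcoefS z (log_coef L q) n n%:Z) hder.
  rewrite l1 -/cm => {l1} e1.
  have -> : n%:Z + 1 = n.+1%:Z by lia.
  rewrite addn1; move: e1.
  have -> : n%:Z + 1 = n.+1%:Z by lia.
  rewrite (log_tail z E q L q0 E0 hz hE n.+1 n) // delta_far ?absz_nat //.
  rewrite subSn // subnn subn1 fact0 -pmulrn.
  have -> : (n + n.+1 = (2 * n).+1)%N by lia.
  have -> : (2 * n.+1 = (2 * n).+2)%N by lia.
  rewrite !HS H0 lcp1 => e1 e2.
  (* For n = 0 the coefficient at n - 1 = -1 is known by evenness. Otherwise it occurs in both [e1]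
     and [e2], and the combination chosen below eliminates it. *)
  case: n => [|m] in nn hode cp cm recp recm hp0 hm0 hp hm ed lcp lcp1 e1 e2 *.
    move: e1; rewrite /legsum !big_nil !big_nat1 /cp /cm /=.
    have -> : 0 - 1 = - 1%:Z :> int by lia.
    rewrite [powcoef _ _ 0 (-1)]log_coefN /powcoef /log_coef /= => ->.
    rewrite ?factS ?fact0 ?muln0 H0 /legS.
    rewrite ?add0n ?HS H0.
    have -> : q = z - E.
      by apply: (mulfI (x := 2%:R)) => //; rewrite mulrBr hz hE; ring.
    by field.
  move: e1 e2.
  have -> : m.+1%:Z - 1 = m%:Z by lia.
  have -> : powcoef z one_coef m.+1 m%:Z =
    - (m.+1`!%:R * (2 * E) ^+ m.+2 * legS z E q m m.+1 / (2 * m).+1`!%:R).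
    by rewrite -addn1 (delta_leg z E q) // !addn1 (_ : 1`! = 1%N) //; field; rewrite fact_neq0.
  have b0 := proj1 (legS_lower _ _ _ q0 E0 hz hE m) m.
  have b1 := proj2 (legS_lower _ _ _ q0 E0 hz hE m) m.
  have b2 := proj1 (legS_lower _ _ _ q0 E0 hz hE m) m.+1.
  have b3 := proj2 (legS_lower _ _ _ q0 E0 hz hE m) m.+1.
  have s1 : legS z E q m m.+1 = z * legS z E q m.+1 m.+1.
    apply: (mulfI E0); apply: (lincomb (lcD (lcM (-1) b1) (lcM z b0))).
    by ring.
  have s2 : legS z E q m.+2 m.+1 = z * legS z E q m.+1 m.+1 + 2 * m.+1%:R * E * legS z E q m.+1 m.
    have hh := sqr_subE _ _ _ q0 hz hE.
    apply: (mulfI E0).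
    apply: (lincomb (lcD (lcM (-1) b2) (lcD (lcM z b3) (lcM (2 * (m%:R + 1) * legS z E q m.+1 m) hh)))).
    by rewrite -!natr1; ring.
  rewrite s1 s2 ed => e1 e2.
  have := recm m.
  have -> : cm m = (2 * m).+1`!%:R^-1 by rewrite /cm addnS addnn mul2n.
  have -> : cm m.+1 = (2 * m).+2`!%:R^-1 by rewrite /cm addnS addSn addnn mul2n.
  move: e1 e2; rewrite legSS subrr mul0r subr0.
  set F := powcoef _ _ _ _; set A2 := legsum _ _ _ _ cm m.+2; set A1 := legsum _ _ _ _ cm m.+1; set A0 := legsum _ _ _ _ cm m.
  set g := powcoef _ _ _ _.
  set S1 := legS _ _ _ _ m.+1; set S0 := legS _ _ _ _ m.
  have -> : (2 * m.+1 + 1 = (2 * m).+3)%N by lia.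
  have -> : (2 * m.+1 = (2 * m).+2)%N by lia.
  rewrite !HS !(exprS _ m.+2) !factS fact0 !natrM.
  have mm := ler0n R m.
  rewrite -[(2 * m).+4%:R]natr1 -[(2 * m).+3%:R]natr1 -[(2 * m).+2%:R]natr1 -[(2 * m).+1%:R]natr1 natrM.
  rewrite -[m.+2%:R]natr1 -[m.+1%:R]natr1.
  move: (fact_neq0 (R := R) (2 * m)) (fact_neq0 (R := R) m).
  move: ((2 * m)`!%:R) (m`!%:R) ((2 * E) ^+ m.+2) => F1 F2 X F10 F20 e1 e2 rm.
  apply: (lincomb (lcD (lcM (m%:R + 2) e1) (lcD (lcM (-1) e2)
     (lcM ((m%:R + 2) * (m%:R + 1) * F2 * 2 * E * X / (2 * m%:R + 3)) rm)))).
  by field; nzlra.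
- have h := hode (n + j)%N n%:Z; move: h.
  rewrite -!addnS IH0 IH1 -pmulrn !(delta_leg _ E q) // (sqr_subE _ _ _ q0 hz hE).
  have rp := recp (n + j)%N; have rm := recm (n + j)%N.
  move: rp rm.
  have -> : cp (n + j)%N = j`!%:R^-1 by rewrite /cp leq_addr addKn.
  have -> : cp (n + j).+1 = j.+1`!%:R^-1 by rewrite /cp -addnS leq_addr addKn.
  have -> : cm (n + j)%N = (2 * n + j)`!%:R^-1 by rewrite /cm addnAC addnn mul2n.
  have -> : cm (n + j).+1 = (2 * n + j).+1`!%:R^-1 by rewrite /cm -addSn addnAC addSn addnn mul2n.
  rewrite !addnS.
  have -> : (2 * (n + j).+2 = (2 * (n + j)).+4)%N by lia.
  have -> : (2 * (n + j).+1 = (2 * (n + j)).+2)%N by lia.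
  rewrite !HS legSS.
  set Ap2 := legsum _ _ _ _ cp (n + j).+2; set Ap1 := legsum _ _ _ _ cp (n + j).+1.
  set Ap0 := legsum _ _ _ _ cp (n + j).
  set Am2 := legsum _ _ _ _ cm (n + j).+2; set Am1 := legsum _ _ _ _ cm (n + j).+1.
  set Am0 := legsum _ _ _ _ cm (n + j).
  set f2 := powcoef _ _ _ _.
  move: (legS _ _ _ _ _) (legS _ _ _ _ _) => S1 S0.
  move: Ap2 Ap1 Ap0 Am2 Am1 Am0 f2 (H _) (H _) (H _) => Ap2 Ap1 Ap0 Am2 Am1 Am0 f2 Ha Hb Hc.
  rewrite !factS !natrM !exprS.
  have jj := ler0n R j.
  rewrite -[j.+2%:R]natr1 -[j.+1%:R]natr1.
  rewrite -[(2 * (n + j)).+4%:R]natr1 -[(2 * (n + j)).+3%:R]natr1.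
  rewrite -[(2 * (n + j)).+2%:R]natr1 -[(2 * (n + j)).+1%:R]natr1.
  rewrite -[(2 * n + j).+2%:R]natr1 -[(2 * n + j).+1%:R]natr1.
  rewrite -[(n + j).+2%:R]natr1 -[(n + j).+1%:R]natr1.
  rewrite [(2 * (n + j))%:R]natrM (natrD _ (2 * n)) natrM (natrD _ n j).
  move: (fact_neq0 (R := R) j) (fact_neq0 (R := R) (2 * n + j)) (fact_neq0 (R := R) (n + j)).
  move: ((2 * n + j)`!%:R) ((n + j)`!%:R) (j`!%:R) ((2 * E) ^+ (n + j)) ((-1) ^+ j).
  move=> F1 F2 F3 X sg F10 F20 F30.
  move=> rp rm h.
  have c0 : (j%:R + 2) * (2 * n%:R + j%:R + 2) != 0 :> R.
    by apply: mulf_neq0; nzlra.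
  apply: (mulfI c0).
  apply: (lincomb (lcD h (lcD
    (lcM (- (sg * (n%:R + j%:R + 2) * (n%:R + j%:R + 1) * F2 * (2 * E) ^+ 3 * X
        / ((2 * n%:R + j%:R + 1) * F1))) rp)
    (lcM (- (sg * (n%:R + j%:R + 2) * (n%:R + j%:R + 1) * F2 * (2 * E) ^+ 3 * X
        / ((j%:R + 1) * F3))) rm)))).
  by field; nzlra.
Qed.

(** * Convergent and absolutely convergent real series *)

Definition is_sum {R : realType} (a : nat -> R) (s : R) : Prop :=
  (series a @ \oo --> s)%classic.

Definition abs_summable {R : realType} (a : nat -> R) : Prop :=
  exists B, forall n, \sum_(0 <= i < n) `|a i| <= B.

Lemma abs_summable_cvg {R : realType} (a : nat -> R) :
  abs_summable a -> cvgn (series a).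
Proof.
move=> [B hB]; apply: normed_cvg.
apply: nondecreasing_is_cvgn.
  by apply: nondecreasing_series => i _ _; exact: normr_ge0.
by exists B => _ [n _ <-]; exact: hB.
Qed.

Lemma is_sum_lim {R : realType} (a : nat -> R) :
  abs_summable a -> is_sum a (limn (series a)).
Proof. by move=> /abs_summable_cvg. Qed.

Lemma is_sum_unique {R : realType} (a : nat -> R) s t :
  is_sum a s -> is_sum a t -> s = t.
Proof. by apply: cvg_unique; exact: Rhausdorff. Qed.

Lemma limn_is_sum {R : realType} (a : nat -> R) s :
  is_sum a s -> limn (series a) = s.
Proof. by move=> h; apply: cvg_lim => //; exact: Rhausdorff. Qed.

Lemma eq_is_sum {R : realType} (a b : nat -> R) s :
  (forall n, a n = b n) -> is_sum a s -> is_sum b s.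
Proof. by move=> h; rewrite (_ : a = b) //; apply/funext. Qed.

Lemma is_sumD {R : realType} (a b : nat -> R) s t :
  is_sum a s -> is_sum b t -> is_sum (fun n => a n + b n) (s + t).
Proof.
move=> ha hb; rewrite /is_sum.
have -> : series (fun n => a n + b n) = (series a \+ series b)%R.
  by apply/funext => n; rewrite /series /= big_split.
exact: cvgD.
Qed.

Lemma is_sumZ {R : realType} k (a : nat -> R) s :
  is_sum a s -> is_sum (fun n => k * a n) (k * s).
Proof.
move=> ha; rewrite /is_sum.
have -> : series (fun n => k * a n) = (fun n => k * series a n).
  by apply/funext => n; rewrite /series /= big_distrr.
exact: cvgMr.
Qed.

Lemma is_sumB {R : realType} (a b : nat -> R) s t :
  is_sum a s -> is_sum b t -> is_sum (fun n => a n - b n) (s - t).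
Proof.
move=> ha hb; rewrite -(mulN1r t).
apply: eq_is_sum (is_sumD _ _ _ _ ha (is_sumZ (-1) _ _ hb)) => n.
by rewrite mulN1r.
Qed.

Lemma is_sum_cons {R : realType} c (a : nat -> R) s :
  is_sum a s -> is_sum (fun n => if n is n'.+1 then a n' else c) (c + s).
Proof.
move=> ha; rewrite /is_sum -cvg_shiftS.
have -> : [sequence series (fun n => if n is n'.+1 then a n' else c) n.+1]_n =
    (fun n => c + series a n).
  by apply/funext => n; rewrite /series /= big_nat_recl.
by apply: cvgD => //; exact: cvg_cst.
Qed.

Lemma ge0_abs_summable {R : realType} (a : nat -> R) B :
  (forall n, 0 <= a n) -> (forall n, \sum_(0 <= i < n) a i <= B) -> abs_summable a.
Proof.
move=> a0 h; exists B => n; apply: le_trans (h n).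
by rewrite (eq_bigr a) // => i _; rewrite ger0_norm.
Qed.

Lemma is_sum_le {R : realType} (a : nat -> R) s B :
  is_sum a s -> (forall n, \sum_(0 <= i < n) a i <= B) -> s <= B.
Proof.
move=> ha h; rewrite -(limn_is_sum _ _ ha); apply: limr_le; first by apply/cvg_ex; exists s.
by near=> n; exact: h.
Unshelve. all: by end_near.
Qed.

Lemma le_abs_summable {R : realType} (a b : nat -> R) :
  (forall n, `|a n| <= b n) -> abs_summable b -> abs_summable a.
Proof.
move=> h [B hB]; exists B => n; apply: le_trans (hB n).
by apply: ler_sum => i _; apply: (le_trans (h i)); exact: ler_norm.
Qed.

Lemma abs_summableZ {R : realType} k (a : nat -> R) :
  abs_summable a -> abs_summable (fun n => k * a n).
Proof.
move=> [B hB]; exists (`|k| * B) => n.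
under eq_bigr do rewrite normrM.
by rewrite -big_distrr /= ler_wpM2l.
Qed.

(** * The hypergeometric series of the Legendre function, summed in closed form *)

Lemma binom_geo {R : realType} (x : R) K M : 0 <= x < 1 ->
  \sum_(0 <= n < M) 'C(n + K, K)%:R * x ^+ n <= (1 - x) ^- K.+1.
Proof.
move=> /andP[x0 x1]; elim: K M => [|K IH] M.
  rewrite (eq_bigr (fun n => x ^+ n)) => [|n _]; last by rewrite bin0 mul1r.
  rewrite expr1 -[leRHS]mul1r ler_pdivlMr ?subr_gt0 // mulrC -opprB mulNr.
  have e : (x - 1) * \sum_(0 <= n < M) x ^+ n = x ^+ M - 1.
    by rewrite big_mkord subrX1.
  by rewrite e opprB lerBlDr lerDl exprn_ge0.
(* Pascal's rule: multiplication by 1 - x lowers K + 1 to K, up to a boundary term of favourable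
   sign. *)
have e : (1 - x) * \sum_(0 <= n < M) 'C(n + K.+1, K.+1)%:R * x ^+ n
   + 'C(M + K, K.+1)%:R * x ^+ M = \sum_(0 <= n < M) 'C(n + K, K)%:R * x ^+ n.
  elim: M => [|M IHM]; first by rewrite !big_nil add0n bin_small // mulr0 mul0r addr0.
  rewrite !big_nat_recr //= mulrDr -IHM addSn binS addnS binS exprS !natrD.
  by ring.
rewrite exprS invfM -[leRHS]mulrC ler_pdivlMr ?subr_gt0 // mulrC.
by apply: le_trans (IH M); rewrite -e lerDl mulr_ge0 ?exprn_ge0.
Qed.

(** The hypergeometric series for the indices N - 1/2 and K + 1/2 in the variable y = 1 / (2 z),
    stripped of constants. Its two Pochhammer symbols, half a step apart, merge into the one
    factorial of the numerator. *)
Definition legterm {R : realType} (y : R) (N K n : nat) : R :=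
  (N + K + 2 * n)`!%:R / ((N + n)`!%:R * n`!%:R) * y ^+ (N + K + 2 * n).+1.

Lemma legterm_ge0 {R : realType} (y : R) N K n : 0 <= y -> 0 <= legterm y N K n.
Proof. by move=> y0; rewrite mulr_ge0 ?exprn_ge0 // divr_ge0. Qed.

Lemma bin_le_exp2 n k : ('C(n, k) <= 2 ^ n)%N.
Proof.
have [h|h] := leqP k n; last by rewrite bin_small.
rewrite (_ : 2 ^ n = \sum_(i < n.+1) 'C(n, i))%N.
  by rewrite (bigD1 (Ordinal (h : (k < n.+1)%N))) //= leq_addr.
rewrite -[X in (X ^ _)%N](addn1 1) expnDn; apply: eq_bigr => i _.
by rewrite !exp1n !muln1.
Qed.

(** The quotient of factorials is K! times two binomial coefficients, one of which is at most 2^(N +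
    2 n); hence convergence for 2 y < 1. *)
Lemma legterm_le {R : realType} (y : R) N K n : 0 <= y ->
  legterm y N K n <= K`!%:R * y ^+ K.+1
    * ('C(N + 2 * n + K, K)%:R * (2 * y) ^+ (N + 2 * n)).
Proof.
move=> y0; rewrite /legterm.
have -> : (N + K + 2 * n)`!%:R / ((N + n)`!%:R * n`!%:R)
   = K`!%:R * 'C(N + 2 * n + K, K)%:R * 'C(N + 2 * n, n)%:R :> R.
  have h1 : ('C(N + 2 * n + K, K) * (K`! * (N + 2 * n)`!) = (N + K + 2 * n)`!)%N.
    have := bin_fact (leq_addl (N + 2 * n) K); rewrite addnK => ->.
    by congr (_ `!); lia.
  have h2 : ('C(N + 2 * n, n) * (n`! * (N + n)`!) = (N + 2 * n)`!)%N.
    have := bin_fact (_ : n <= N + 2 * n)%N => <-; last by lia.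
    by congr (_ * (_ * _ `!))%N; lia.
  rewrite -h1 -h2 !natrM.
  by field; rewrite !fact_neq0.
have -> : (N + K + 2 * n).+1 = (K.+1 + (N + 2 * n))%N by lia.
rewrite exprD exprMn; set C1 := 'C(_ + K, K)%:R; set C2 := 'C(_, n)%:R.
set Y1 := y ^+ K.+1; set Y2 := y ^+ (N + 2 * n).
rewrite [leLHS](_ : _ = K`!%:R * C1 * Y1 * Y2 * C2); last by ring.
rewrite [leRHS](_ : _ = K`!%:R * C1 * Y1 * Y2 * 2 ^+ (N + 2 * n)); last by ring.
by rewrite ler_wpM2l ?mulr_ge0 ?exprn_ge0 // -natrX ler_nat bin_le_exp2.
Qed.

Lemma sum_stride {R : realType} (g : nat -> R) N M : (forall n, 0 <= g n) ->
  \sum_(0 <= n < M) g (N + 2 * n)%N <= \sum_(0 <= m < N + 2 * M) g m.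
Proof.
move=> g0; elim: M => [|M IH].
  by rewrite big_nil sumr_ge0.
rewrite big_nat_recr //= mulnS add2n !addnS !big_nat_recr //=.
by rewrite -addrA lerD // lerDl.
Qed.

Lemma legterm_sum_le {R : realType} (y : R) N K M : 0 <= y -> 2 * y < 1 ->
  \sum_(0 <= n < M) legterm y N K n <= K`!%:R * y ^+ K.+1 * (1 - 2 * y) ^- K.+1.
Proof.
move=> y0 y1.
apply: (@le_trans _ _ (\sum_(0 <= n < M) K`!%:R * y ^+ K.+1
    * ('C(N + 2 * n + K, K)%:R * (2 * y) ^+ (N + 2 * n)))).
  by apply: ler_sum => n _; exact: legterm_le.
rewrite -big_distrr /= ler_wpM2l ?mulr_ge0 ?exprn_ge0 //.
apply: le_trans (sum_stride (fun m => 'C(m + K, K)%:R * (2 * y) ^+ m) N M _) _.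
  by move=> n; rewrite mulr_ge0 // exprn_ge0 // mulr_ge0.
by apply: binom_geo; rewrite y1 mulr_ge0.
Qed.

Lemma legterm_summable {R : realType} (y : R) N K : 0 <= y -> 2 * y < 1 ->
  abs_summable (legterm y N K).
Proof.
move=> y0 y1; apply: (ge0_abs_summable _ (K`!%:R * y ^+ K.+1 * (1 - 2 * y) ^- K.+1)) => n.
  exact: legterm_ge0.
exact: legterm_sum_le.
Qed.

Definition legseries {R : realType} (y : R) (N K : nat) : R :=
  limn (series (legterm y N K)).

Lemma legseries_is_sum {R : realType} (y : R) N K : 0 <= y -> 2 * y < 1 ->
  is_sum (legterm y N K) (legseries y N K).
Proof. by move=> y0 y1; apply: is_sum_lim; exact: legterm_summable. Qed.

(** Compared term by term: [is_sum_cons 0] shifts one series by an index so that equal n means equal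
    powers of y. The next three relations are proved in the same way. *)
Lemma legseries_recK {R : realType} (y : R) N K : 0 < y -> 2 * y < 1 ->
  (y ^- 2 - 4) * legseries y N K.+2
  = (2 * K%:R + 3) / y * legseries y N K.+1
    - (K.+1%:R ^+ 2 - N%:R ^+ 2) * legseries y N K.
Proof.
move=> y0 y1; have y0' := ltW y0.
have h J := legseries_is_sum y N J y0' y1.
have e1 := is_sumB _ _ _ _ (is_sumZ (y ^- 2) _ _ (h K.+2))
   (is_sumZ 4 _ _ (is_sum_cons 0 _ _ (h K.+2))).
have e2 := is_sumB _ _ _ _ (is_sumZ ((2 * K%:R + 3) / y) _ _ (h K.+1))
   (is_sumZ (K.+1%:R ^+ 2 - N%:R ^+ 2) _ _ (h K)).
rewrite mulrBl -[X in _ - _ * X]add0r; apply: is_sum_unique e1 _.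
apply: eq_is_sum e2 => n; rewrite /legterm.
have yn : y != 0 by rewrite gt_eqF.
case: n => [|n].
  rewrite mulr0 muln0 !addn0 subr0 fact0 mulr1 !addnS !factS !natrM !exprS.
  move: (fact_neq0 (R := R) N) => F.
  rewrite -[(N + K).+2%:R]natr1 -[(N + K).+1%:R]natr1 natrD -natr1.
  by field; rewrite F yn.
have -> : (N + K.+1 + 2 * n.+1 = (N + K + 2 * n).+3)%N by lia.
have -> : (N + K.+2 + 2 * n.+1 = (N + K + 2 * n).+4)%N by lia.
have -> : (N + K + 2 * n.+1 = (N + K + 2 * n).+2)%N by lia.
have -> : (N + K.+2 + 2 * n = (N + K + 2 * n).+2)%N by lia.
rewrite addnS; move E : (N + K + 2 * n)%N => A.
have EA : A%:R = N%:R + K%:R + 2 * n%:R :> R by rewrite -E (natrD _ _ (2 * n)) natrM natrD.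
rewrite !factS !natrM !exprS.
move: (fact_neq0 (R := R) (N + n)) (fact_neq0 (R := R) n).
rewrite -[A.+4%:R]natr1 -[A.+3%:R]natr1 -[A.+2%:R]natr1 -[A.+1%:R]natr1 EA.
rewrite -[(N + n).+1%:R]natr1 -[n.+1%:R]natr1 natrD -natr1 => F1 F2.
have := ler0n R n; have := ler0n R N => nN nn.
by field; rewrite F1 F2 yn; nzlra.
Qed.

Lemma legseries_rec1 {R : realType} (y : R) N : 0 < y -> 2 * y < 1 ->
  (y ^- 2 - 4) * legseries y N 1
  = (1 + N%:R) / y * legseries y N 0 - 2 * N%:R * legseries y N.+1 0.
Proof.
move=> y0 y1; have y0' := ltW y0.
have h M J := legseries_is_sum y M J y0' y1.
have e1 := is_sumB _ _ _ _ (is_sumZ (y ^- 2) _ _ (h N 1%N))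
   (is_sumZ 4 _ _ (is_sum_cons 0 _ _ (h N 1%N))).
have e2 := is_sumB _ _ _ _ (is_sumZ ((1 + N%:R) / y) _ _ (h N 0%N))
   (is_sumZ (2 * N%:R) _ _ (is_sum_cons 0 _ _ (h N.+1 0%N))).
rewrite mulrBl -[X in _ - _ * X]add0r -[X in _ = _ - _ * X]add0r.
apply: is_sum_unique e1 _.
apply: eq_is_sum e2 => n; rewrite /legterm.
have yn : y != 0 by rewrite gt_eqF.
case: n => [|n].
  rewrite !mulr0 muln0 !addn0 !subr0 fact0 mulr1 addn1 !factS !natrM !exprS.
  move: (fact_neq0 (R := R) N) => F.
  rewrite -natr1.
  by field; rewrite F yn.
have -> : (N + 1 + 2 * n.+1 = (N + 2 * n).+3)%N by lia.
have -> : (N + 0 + 2 * n.+1 = (N + 2 * n).+2)%N by lia.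
have -> : (N + 1 + 2 * n = (N + 2 * n).+1)%N by lia.
have -> : (N.+1 + 0 + 2 * n = (N + 2 * n).+1)%N by lia.
rewrite addnS addSn; move E : (N + 2 * n)%N => A.
have EA : A%:R = N%:R + 2 * n%:R :> R by rewrite -E (natrD _ _ (2 * n)) natrM.
rewrite !factS !natrM !exprS.
move: (fact_neq0 (R := R) (N + n)) (fact_neq0 (R := R) n).
rewrite -[A.+3%:R]natr1 -[A.+2%:R]natr1 -[A.+1%:R]natr1 EA.
rewrite -[(N + n).+1%:R]natr1 -[n.+1%:R]natr1 natrD => F1 F2.
have := ler0n R n; have := ler0n R N => nN nn.
by field; rewrite F1 F2 yn; nzlra.
Qed.

Lemma legseries_recN {R : realType} (y : R) N : 0 < y -> 2 * y < 1 ->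
  legseries y N.+1 0 = y * (legseries y N 0 + legseries y N.+2 0).
Proof.
move=> y0 y1; have y0' := ltW y0.
have h M := legseries_is_sum y M 0 y0' y1.
have e2 := is_sumZ y _ _ (is_sumD _ _ _ _ (h N) (is_sum_cons 0 _ _ (h N.+2))).
rewrite -[X in _ + X]add0r.
apply: is_sum_unique (h N.+1) _.
apply: eq_is_sum e2 => n; rewrite /legterm.
case: n => [|n].
  rewrite muln0 !addn0 addr0 fact0 !mulr1 !divff ?fact_neq0 // !exprS; by ring.
have -> : (N + 0 + 2 * n.+1 = (N + 2 * n).+2)%N by lia.
have -> : (N.+1 + 0 + 2 * n.+1 = (N + 2 * n).+3)%N by lia.
have -> : (N.+2 + 0 + 2 * n = (N + 2 * n).+2)%N by lia.
rewrite !addSn !addnS; move E : (N + 2 * n)%N => A.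
have EA : A%:R = N%:R + 2 * n%:R :> R by rewrite -E (natrD _ _ (2 * n)) natrM.
rewrite !factS !natrM !exprS.
move: (fact_neq0 (R := R) (N + n)) (fact_neq0 (R := R) n).
rewrite -[A.+3%:R]natr1 -[A.+2%:R]natr1 -[A.+1%:R]natr1 EA.
rewrite -[(N + n).+2%:R]natr1 -[(N + n).+1%:R]natr1 -[n.+1%:R]natr1 natrD => F1 F2.
have := ler0n R n; have := ler0n R N => nN nn.
by field; rewrite F1 F2; nzlra.
Qed.

Lemma legseries_rec0 {R : realType} (y : R) : 0 < y -> 2 * y < 1 ->
  legseries y 0 0 = y * (1 + 2 * legseries y 1 0).
Proof.
move=> y0 y1; have y0' := ltW y0.
have h M := legseries_is_sum y M 0 y0' y1.
have e2 := is_sumZ y _ _ (is_sum_cons 1 _ _ (is_sumZ 2 _ _ (h 1%N))).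
apply: is_sum_unique (h 0%N) _.
apply: eq_is_sum e2 => n; rewrite /legterm.
case: n => [|n].
  rewrite muln0 !addn0 fact0 expr1; by field.
rewrite !add0n.
have -> : (2 * n.+1 = (2 * n).+2)%N by lia.
have -> : (1 + 0 + 2 * n = (2 * n).+1)%N by lia.
rewrite addSn add0n !factS !natrM !exprS.
move: (fact_neq0 (R := R) n).
rewrite -[(2 * n).+2%:R]natr1 -[(2 * n).+1%:R]natr1 -[n.+1%:R]natr1 natrM => F2.
have nn := ler0n R n.
by field; rewrite F2; nzlra.
Qed.

Lemma geometric_le0 {R : realType} (C q a : R) : `|q| < 1 ->
  (forall n, a <= C * q ^+ n) -> a <= 0.
Proof.
move=> q1 h.
have c : ((fun n => C * q ^+ n) @ \oo --> C * 0)%classic by apply: cvgMr; exact: cvg_expr.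
rewrite -(mulr0 C) -(cvg_lim _ c) //; apply: limr_ge; first by apply/cvg_ex; eexists; exact: c.
by near=> n; exact: h.
Unshelve. all: by end_near.
Qed.

(** As a function of N the series solves a recurrence whose solutions are q^N and q^(-N). It is
    bounded in N, which excludes the growing one, and [legseries_rec0] fixes the constant. *)
Lemma legseries_base {R : realType} (q : R) N : 0 < q < 1 ->
  legseries (q^-1 + q)^-1 N 0 = q ^+ N / (q^-1 - q).
Proof.
move=> /andP[q0 q1]; set y := _^-1.
have qn : q != 0 by rewrite gt_eqF.
have y0 : 0 < y by rewrite invr_gt0 addr_gt0 ?invr_gt0.
have y1 : 2 * y < 1.
  rewrite ltr_pdivrMr ?mul1r ?addr_gt0 ?invr_gt0 //.
  rewrite -subr_gt0 (_ : _ - _ = (1 - q) ^+ 2 / q); last by field.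
  by rewrite divr_gt0 // exprn_gt0 // subr_gt0.
have ye : y^-1 = q^-1 + q by rewrite invrK.
(* This difference isolates the growing solution: it is multiplied by 1/q at each step, so
   boundedness forces it to vanish. *)
pose dl n := legseries y n.+1 0 - q * legseries y n 0.
have dlS n : dl n.+1 = dl n / q.
  have := legseries_recN y n y0 y1.
  move=> /(congr1 (fun x => y^-1 * x)); rewrite mulKf ?gt_eqF // ye /dl => h.
  by apply: (lincomb (lcM (-1) h)); field.
have dlE n : dl 0%N = q ^+ n * dl n.
  elim: n => [|n IH]; first by rewrite mul1r.
  by rewrite dlS IH exprS; field.
pose B := y ^+ 1 * (1 - 2 * y) ^- 1.
have sB n : 0 <= legseries y n 0 <= B.
  have h := legseries_is_sum y n 0 (ltW y0) y1.
  apply/andP; split; last first.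
    by apply: is_sum_le h _ => M; have := legterm_sum_le y n 0 M (ltW y0) y1; rewrite fact0 mul1r.
  rewrite -oppr_le0 -mulN1r.
  apply: is_sum_le (is_sumZ (-1) _ _ h) _ => M.
  by rewrite -big_distrr /= mulN1r oppr_le0 sumr_ge0 // => i _; exact: legterm_ge0 (ltW y0).
have dlB n : `|dl n| <= 2 * B.
  have /andP[a b] := sB n; have /andP[c e] := sB n.+1.
  apply: (le_trans (ler_normB _ _)).
  rewrite (ger0_norm c) ger0_norm ?mulr_ge0 ?(ltW q0) //.
  have : q * legseries y n 0 <= legseries y n 0 by rewrite ler_piMl // ltW.
  by move: b e; set s1 := legseries _ _ _; set s2 := legseries _ _ _; lra.
have dl0 : dl 0%N = 0.
  apply/eqP; rewrite -normr_le0; apply: (geometric_le0 (2 * B) q _) => [|M].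
    by rewrite ger0_norm // ltW.
  rewrite (dlE M) normrM (ger0_norm (exprn_ge0 M (ltW q0))) [leLHS]mulrC.
  by apply: ler_wpM2r; [rewrite exprn_ge0 // ltW | exact: dlB].
have dl0' n : legseries y n.+1 0 = q * legseries y n 0.
  apply/eqP; rewrite -subr_eq0 -/(dl n); apply/eqP.
  by elim: n => [//|n IH]; rewrite dlS IH mul0r.
have e0 : legseries y 0 0 = (q^-1 - q)^-1.
  have e := legseries_rec0 y y0 y1; rewrite dl0' in e.
  have qq : q^-1 - q != 0.
    by rewrite subr_eq0 gt_eqF // (lt_trans q1) // invf_gt1.
  apply: (mulfI qq); rewrite divff //.
  move: e => /(congr1 (fun x => y^-1 * x)); rewrite mulKf ?gt_eqF // ye => e.
  by apply: (lincomb e); ring.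
elim: N => [|N IH]; first by rewrite e0 mul1r.
by rewrite dl0' IH exprS mulrA.
Qed.

(** Both sides obey the same recurrence in K and agree for K = 0 and K = 1. *)
Lemma legseries_legS {R : realType} (z E q : R) N K : 0 < q < 1 ->
  2 * z = q^-1 + q -> 2 * E = q^-1 - q ->
  (- 2 * E) ^+ K * legseries (2 * z)^-1 N K = legS z E q N K.
Proof.
move=> q01 hz hE; have /andP[q0 q1] := q01.
have qn : q != 0 by rewrite gt_eqF.
have E0 : E != 0.
  have qq : q^-1 - q != 0.
    by rewrite subr_eq0 gt_eqF // (lt_trans q1) // invf_gt1.
  by apply: contra_neq qq => E0; rewrite -hE E0 mulr0.
have z0 : 0 < 2 * z by rewrite hz addr_gt0 ?invr_gt0.
have y0 : 0 < (2 * z)^-1 by rewrite invr_gt0.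
have y1 : 2 * (2 * z)^-1 < 1.
  rewrite ltr_pdivrMr ?mul1r // hz.
  rewrite -subr_gt0 (_ : _ - _ = (1 - q) ^+ 2 / q); last by field.
  by rewrite divr_gt0 // exprn_gt0 // subr_gt0.
have base M : legseries (2 * z)^-1 M 0 = legS z E q M 0.
  by rewrite hz legseries_base // /legS hE.
have hEE : (2 * z)^-1 ^- 2 - 4 = (2 * E) ^+ 2.
  by rewrite exprVn invrK !exprMn -(sqr_subE _ _ _ qn hz hE); ring.
have hzE : z - E = q.
  by apply: (mulfI (x := 2%:R)) => //; rewrite mulrBr hz hE; ring.
elim/ind2: K => [|  |K IH0 IH1].
- by rewrite mul1r base.
- have := legseries_rec1 _ N y0 y1; rewrite hEE invrK !base => e.
  have e2 : legS z E q N.+1 0 = (z - E) * legS z E q N 0.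
    by rewrite hzE /legS exprS; ring.
  have E2 : - (2 * E) != 0 by rewrite oppr_eq0 mulf_neq0.
  apply: (mulfI E2); rewrite e2 in e; apply: (lincomb e).
  by rewrite /legS; field.
have := legseries_recK _ N K y0 y1; rewrite hEE invrK => e.
rewrite legSS -IH0 -IH1 !exprS.
apply: (lincomb (lcM ((- 2 * E) ^+ K) e)).
by rewrite -natr1; field.
Qed.


(** * Gamma at integers and half-integers through Gaussian moments *)

Lemma is_derive_pair {R : realType} (F : R -> R) (x d : R) :
  is_derive x 1 F d -> derivable F x 1 /\ 'D_1 F x = d.
Proof. by move=> h; split; [exact: ex_derive | exact: derive_val]. Qed.

Lemma derivable_cont {R : realType} (f : R -> R) : (forall x : R, derivable f x 1) -> continuous f.
Proof. by move=> h x; apply: differentiable_continuous; exact/derivable1_diffP. Qed.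

Lemma integral_ge0_FTC {R : realType} (f F : R -> R) (l : R) :
  (forall x, 0 <= x -> 0 <= f x) -> (forall x : R, derivable f x 1) ->
  (forall x : R, derivable F x 1 /\ 'D_1 F x = f x) -> (F x @[x --> +oo] --> l)%classic ->
  (\int[@lebesgue_measure R]_(x in `[0%R, +oo[%classic) (f x)%:E)%E = (l - F 0)%:E.
Proof.
move=> f0 df dF Fl.
have cF : continuous F by apply: derivable_cont => x; have [] := dF x.
rewrite (ge0_continuous_FTC2y f0 _ Fl) //.
- by apply: continuous_subspaceT; exact: derivable_cont.
- by move=> x _; have [] := dF x.
- by apply: cvg_at_right_filter; exact: cF.
- by move=> x _; rewrite derive1E; have [] := dF x.
Qed.

Lemma is_derive_gauss {R : realType} (s : R) :
  is_derive s 1 (@gauss_fun R) (- (2 * s) * gauss_fun s).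
Proof.
rewrite /gauss_fun.
have h : is_derive s 1 (fun x : R => - x ^+ 2) (- (2 * s)).
  apply: is_derive_eq.
  by rewrite /= /GRing.scale /=; ring.
have := @is_derive1_comp R expR (fun x : R => - x ^+ 2) s _ _ (is_derive_expR _) h.
by rewrite mulrC.
Qed.

Lemma is_derive_mongauss {R : realType} a (s : R) :
  is_derive s 1 (fun s : R => s ^+ a.+1 * gauss_fun s)
    ((a.+1%:R * s ^+ a - 2 * s ^+ a.+2) * gauss_fun s).
Proof.
have h : is_derive s 1 (fun x : R => x ^+ a.+1) (a.+1%:R * s ^+ a).
  apply: DeriveDef; first exact: exprn_derivable.
  by rewrite exp_derive /GRing.scale /=; ring.
apply: is_derive_eq (is_deriveM h (is_derive_gauss s)) _.
by rewrite /GRing.scale /= !exprS; ring.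
Qed.

Lemma derivable_mongauss {R : realType} a (s : R) :
  derivable (fun s : R => s ^+ a * gauss_fun s) s 1.
Proof.
case: a => [|a]; last by have := is_derive_mongauss a s.
rewrite (_ : (fun _ => _) = @gauss_fun R); first by have := is_derive_gauss s.
by apply/funext => x; rewrite mul1r.
Qed.

Lemma mongauss_le {R : realType} a (s : R) : 0 <= s ->
  s ^+ a * gauss_fun s <= a`!%:R * expR 1 * expR (- s).
Proof.
move=> s0; have h : s ^+ a <= a`!%:R * expR s.
  case: a => [|a]; first by rewrite fact0 mul1r expr0 -expR0 ler_expR.
  have := expR_ge1Dxn a s0 => h; rewrite mulrC -ler_pdivrMr ?ltr0n ?fact_gt0 //.
  by apply: le_trans h; rewrite lerDr.
apply: le_trans (_ : a`!%:R * expR s * gauss_fun s <= _).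
  by rewrite ler_wpM2r // expR_ge0.
rewrite -!mulrA ler_wpM2l // /gauss_fun -!expRD ler_expR.
by rewrite -subr_ge0 (_ : _ - _ = (s - 1) ^+ 2) ?sqr_ge0 //; ring.
Qed.

Lemma mongauss_cvg0 {R : realType} a :
  ((fun s : R => s ^+ a * gauss_fun s) x @[x --> +oo] --> (0 : R))%classic.
Proof.
apply: (@squeeze_cvgr _ _ _ _ (fun=> 0) (fun s => a`!%:R * expR 1 * expR (- s))).
- near=> s; have s0 : 0 <= s by near: s; exact: nbhs_pinfty_ge.
  by rewrite mongauss_le // andbT mulr_ge0 ?exprn_ge0 ?expR_ge0.
- exact: cvg_cst.
- by rewrite -[X in (_ --> X)%classic](mulr0 (a`!%:R * expR 1)); apply: cvgMr; exact: cvgr_expR.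
Unshelve. all: by end_near.
Qed.

Definition gauss_moment {R : realType} a : \bar R :=
  (\int[@lebesgue_measure R]_(x in `[0%R, +oo[%classic) (x ^+ a * gauss_fun x)%:E)%E.

Lemma gauss_moment0 {R : realType} : @gauss_moment R 0 = (Num.sqrt pi / 2)%:E.
Proof.
rewrite -integral0y_gauss /gauss_moment; apply: eq_integral => x _.
by rewrite mul1r.
Qed.

Lemma is_derive_expRN {R : realType} (s : R) : is_derive s 1 (fun x => expR (- x)) (- expR (- s)).
Proof.
have := @is_derive1_comp R expR (fun x : R => - x) s _ _ (is_derive_expR _) (is_deriveNid s 1).
by rewrite mulrN1.
Qed.

Lemma gauss_moment1 {R : realType} : @gauss_moment R 1 = (1 / 2)%:E.
Proof.
rewrite /gauss_moment (integral_ge0_FTC _ (fun x => - (1 / 2) * gauss_fun x) 0).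
- by congr EFin; rewrite /gauss_fun expr0n /= oppr0 expR0; ring.
- by move=> x x0; rewrite mulr_ge0 ?exprn_ge0 ?expR_ge0.
- exact: derivable_mongauss.
- move=> x; apply: is_derive_pair; apply: is_derive_eq (is_deriveZ _ (is_derive_gauss x)) _.
  by rewrite /GRing.scale /=; field.
- by rewrite -[X in (_ --> X)%classic](mulr0 (- (1 / 2))); apply: cvgMr; exact: cvg_gauss_fun.
Qed.

Lemma integral_0yD {R : realType} (f g : R -> R) :
  (forall x, 0 <= x -> 0 <= f x) -> (forall x, 0 <= x -> 0 <= g x) ->
  (forall x : R, derivable f x 1) -> (forall x : R, derivable g x 1) ->
  (\int[@lebesgue_measure R]_(x in `[0%R, +oo[%classic) (f x + g x)%:E
   = \int[@lebesgue_measure R]_(x in `[0%R, +oo[%classic) (f x)%:E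
   + \int[@lebesgue_measure R]_(x in `[0%R, +oo[%classic) (g x)%:E)%E.
Proof.
move=> f0 g0 df dg; rewrite -ge0_integralD //.
- by move=> x; rewrite /= in_itv /= andbT lee_fin => /f0.
- by apply/measurable_EFinP; apply: measurable_funTS; apply: continuous_measurable_fun;
    exact: derivable_cont.
- by move=> x; rewrite /= in_itv /= andbT lee_fin => /g0.
- by apply/measurable_EFinP; apply: measurable_funTS; apply: continuous_measurable_fun;
    exact: derivable_cont.
Qed.

Lemma integral_0yZ {R : realType} (k : R) (f : R -> R) : 0 <= k ->
  (forall x, 0 <= x -> 0 <= f x) -> (forall x : R, derivable f x 1) ->
  (\int[@lebesgue_measure R]_(x in `[0%R, +oo[%classic) (k * f x)%:E
   = k%:E * \int[@lebesgue_measure R]_(x in `[0%R, +oo[%classic) (f x)%:E)%E.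
Proof.
move=> k0 f0 df; rewrite -ge0_integralZl_EFin //.
- by move=> x; rewrite /= in_itv /= andbT lee_fin => /f0.
- by apply/measurable_EFinP; apply: measurable_funTS; apply: continuous_measurable_fun;
    exact: derivable_cont.
Qed.

(** Integration by parts. [integral_ge0_FTC] asks for a nonnegative integrand, so a multiple of expR
    (- x) is added and its integral cancelled at the end. *)
Lemma gauss_momentSS {R : realType} a :
  (2%:E * @gauss_moment R a.+2 = a.+1%:R%:E * @gauss_moment R a)%E.
Proof.
(* By [mongauss_le] this constant makes C expR (- x) dominate the subtracted term. *)
pose C : R := a.+1%:R * (a`!%:R * expR 1).
have ge0 b (x : R) : 0 <= x -> 0 <= x ^+ b * gauss_fun x.
  by move=> x0; rewrite mulr_ge0 ?exprn_ge0 ?expR_ge0.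
have C0 : 0 <= C by rewrite !mulr_ge0 ?expR_ge0.
have dE (x : R) : derivable (fun x => expR (- x)) x 1 by have := is_derive_expRN x.
have E0 (x : R) : 0 <= x -> 0 <= expR (- x) by rewrite expR_ge0.
have f0 (x : R) : 0 <= x -> 0 <= 2 * (x ^+ a.+2 * gauss_fun x) - a.+1%:R * (x ^+ a * gauss_fun x) + C * expR (- x).
  move=> x0; have h := mongauss_le a x x0.
  have : a.+1%:R * (x ^+ a * gauss_fun x) <= C * expR (- x).
    by rewrite /C -mulrA ler_wpM2l.
  by have := ge0 a.+2 x x0; lra.
have df (x : R) : derivable (fun x : R => 2 * (x ^+ a.+2 * gauss_fun x) - a.+1%:R * (x ^+ a * gauss_fun x) + C * expR (- x)) x 1.
  apply: derivableD; first apply: derivableB.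
  + by apply: derivableZ; exact: derivable_mongauss.
  + by apply: derivableZ; exact: derivable_mongauss.
  + by apply: derivableZ; exact: dE.
have I1 : (\int[@lebesgue_measure R]_(x in `[0%R, +oo[%classic)
   (2 * (x ^+ a.+2 * gauss_fun x) - a.+1%:R * (x ^+ a * gauss_fun x) + C * expR (- x))%:E)%E = C%:E.
  rewrite (integral_ge0_FTC _ (fun x => - (x ^+ a.+1 * gauss_fun x) - C * expR (- x)) 0).
  - by congr EFin; rewrite expr0n /= mul0r oppr0 expR0; ring.
  - exact: f0.
  - exact: df.
  - move=> x; apply: is_derive_pair; apply: is_derive_eq (is_deriveB (is_deriveN (is_derive_mongauss a x)) (is_deriveZ C (is_derive_expRN x))) _.
    by rewrite /GRing.scale /=; ring.
  - rewrite -[X in (_ --> X)%classic](subrr 0) -[X in (_ --> (X - _))%classic]oppr0.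
    rewrite -[X in (_ --> (_ - X))%classic](mulr0 C).
    apply: cvgB; first by apply: cvgN; exact: mongauss_cvg0.
    by apply: cvgMr; exact: cvgr_expR.
have I2 : (\int[@lebesgue_measure R]_(x in `[0%R, +oo[%classic) (expR (- x))%:E)%E = 1%:E.
  rewrite (integral_ge0_FTC _ (fun x => - expR (- x)) 0) //.
  - by congr EFin; rewrite oppr0 expR0; ring.
  - move=> x; apply: is_derive_pair; apply: is_derive_eq (is_deriveN (is_derive_expRN x)) _.
    by rewrite opprK.
  - by rewrite -[X in (_ --> X)%classic]oppr0; apply: cvgN; exact: cvgr_expR.
have z1 : (\int[@lebesgue_measure R]_(x in `[0%R, +oo[%classic) (2 * (x ^+ a.+2 * gauss_fun x))%:E = 2%:E * gauss_moment a.+2)%E.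
  by apply: integral_0yZ => //; [exact: ge0 | exact: derivable_mongauss].
have z2 : (\int[@lebesgue_measure R]_(x in `[0%R, +oo[%classic) (C * expR (- x))%:E = C%:E)%E.
  by rewrite -[RHS]mule1 -I2; apply: integral_0yZ.
have z3 : (\int[@lebesgue_measure R]_(x in `[0%R, +oo[%classic) (a.+1%:R * (x ^+ a * gauss_fun x))%:E = a.+1%:R%:E * gauss_moment a)%E.
  by apply: integral_0yZ => //; [exact: ge0 | exact: derivable_mongauss].
have dm b (k : R) (x : R) : derivable (fun x : R => k * (x ^+ b * gauss_fun x)) x 1.
  by apply: derivableZ; exact: derivable_mongauss.
have : (2%:E * gauss_moment a.+2 + C%:E = a.+1%:R%:E * gauss_moment a + C%:E)%E.
  rewrite -z1 -[in LHS]z2 -integral_0yD.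
  - rewrite -z3 addeC -[in RHS]I1 -integral_0yD //.
    + by apply: eq_integral => x _; congr EFin; ring.
    + by move=> x x0; rewrite mulr_ge0 ?ge0.
  - by move=> x x0; rewrite mulr_ge0 ?ge0.
  - by move=> x x0; rewrite mulr_ge0 ?E0.
  - exact: dm.
  - by move=> x; apply: derivableZ; exact: dE.
by move=> /(congr1 (fun x => x - C%:E)%E); rewrite !addeK.
Qed.


Lemma integral_0y_split {R : realType} (h : R -> R) :
  continuous h -> (forall x, 0 <= x -> 0 <= h x) ->
  (\int[@lebesgue_measure R]_(x in `[0%R, +oo[%classic) (h x)%:E
   = \int[@lebesgue_measure R]_(x in `[0%R, 1%R]%classic) (h x)%:E
   + \int[@lebesgue_measure R]_(x in `[1%R, +oo[%classic) (h x)%:E)%E.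
Proof.
move=> ch h0.
have mh D : measurable_fun D (EFin \o h).
  by apply/measurable_EFinP; apply: measurable_funTS; apply: continuous_measurable_fun.
rewrite -[in X in (_ = _ + X)%E]integral_itv_obnd_cbnd; last exact: mh.
rewrite (@itv_bndbnd_setU _ R _ (BRight 1)) ?bnd_simp //=.
rewrite ge0_integral_setU //.
- by apply: measurable_funTS; exact: mh.
- move=> x [|]; rewrite /= in_itv /= => /andP[x0 _]; rewrite lee_fin h0 //.
  by rewrite (le_trans _ (ltW x0)).
- apply/disj_setPS => x [] /=; rewrite !in_itv /= andbT => /andP[_ a] b.
  by move: (le_lt_trans a b); rewrite ltxx.
Qed.

Lemma near_derive_continuous {R : realType} (F f : R -> R) (x : R) :
  0 < x -> (forall y, 0 < y -> F^`()%classic y = f y) -> {for x, continuous f} ->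
  (F^`() y @[y --> x] --> f x)%classic.
Proof.
move=> x0 hF cf; apply: cvg_trans cf; apply: near_eq_cvg.
near=> y; rewrite hF //; near: y; exact: lt_nbhsr.
Unshelve. all: by end_near.
Qed.

Lemma sqrt_cvgy {R : realType} : (Num.sqrt x @[x --> (+oo : set_system R)] --> +oo)%classic.
Proof.
apply/cvgryPge => A; near=> x.
have x0 : 0 <= x by near: x; exact: nbhs_pinfty_ge.
apply: le_trans (ler_norm A) _.
rewrite -sqrtr_sqr ler_sqrt //; near: x; apply: nbhs_pinfty_ge; exact: num_real.
Unshelve. all: by end_near.
Qed.

(** The substitution t = x^2 in Euler's integral. The square root has no derivative at 0, so the
    half-line is cut at 1: squaring is the substitution on [0, 1], the square root the one on [1,
    +oo[. *)
Lemma Gamma_gauss {R : realType} a :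
  Gamma (a%:R / 2 + 1 : R) = fine (2%:E * gauss_moment a.+1)%E.
Proof.
pose G (t : R) : R := Num.sqrt t ^+ a * expR (- t).
pose g (x : R) := 2 * (x ^+ a.+1 * gauss_fun x).
have cG : continuous G.
  move=> x; apply: cvgM.
    apply: (@continuous_comp _ _ _ Num.sqrt (fun x : R => x ^+ a)).
      exact: sqrt_continuous.
    exact: exprn_continuous.
  by apply: (@derivable_cont R (fun y => expR (- y))) => y; have := is_derive_expRN y.
have cg : continuous g.
  by apply: derivable_cont => x; apply: derivableZ; exact: derivable_mongauss.
have G0 x : 0 <= G x by rewrite mulr_ge0 ?exprn_ge0 ?sqrtr_ge0 ?expR_ge0.
have g0 x : 0 <= x -> 0 <= g x by move=> x0; rewrite !mulr_ge0 ?exprn_ge0 ?expR_ge0.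
have d2 (x : R) : is_derive x 1 (fun x : R => x ^+ 2) (2 * x).
  by apply: DeriveDef; [exact: exprn_derivable | rewrite exp_derive /GRing.scale /=; ring].
have d2E : ((fun x : R => x ^+ 2)^`() = (fun x => 2 * x))%classic.
  by apply/funext => x; rewrite derive1E; have [_ ->] := is_derive_pair _ _ _ (d2 x).
have c2 : continuous (fun x : R => 2 * x).
  by apply: derivable_cont => x; apply: derivableZ; exact: derivable_id.
have ds (x : R) : 0 < x -> (Num.sqrt^`())%classic x = (2 * Num.sqrt x)^-1.
  by move=> x0; rewrite derive1E; have [_ ->] := is_derive_pair _ _ _ (is_derive1_sqrt x0).
have cs (x : R) : 0 < x -> {for x, continuous (fun x : R => (2 * Num.sqrt x)^-1)}.
  move=> x0; apply: cvgV; first by rewrite mulf_neq0 // gt_eqF // sqrtr_gt0.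
  by apply: cvgMr; exact: sqrt_continuous.
have p1 : (\int[@lebesgue_measure R]_(t in `[0%R, 1%R]%classic) (G t)%:E
   = \int[@lebesgue_measure R]_(x in `[0%R, 1%R]%classic) (g x)%:E)%E.
  have := @integration_by_substitution_increasing R (fun x => x ^+ 2) G 0 1 ler01.
  rewrite d2E expr0n expr1n /= => ->.
  - apply: eq_integral => t; rewrite inE /= in_itv /= => /andP[t0 _]; congr EFin.
    rewrite [LHS](_ : _ = G (t ^+ 2) * (2 * t)) //.
    by rewrite /G /g /gauss_fun sqrtr_sqr ger0_norm // (exprS t a); ring.
  - move=> x y; rewrite !in_itv /= => /andP[x0 _] /andP[y0 _] xy.
    by rewrite ltr_pXn2r.
  - by move=> x _; exact: c2.
  - by apply/cvg_ex; exists (2 * 0); apply: cvg_at_right_filter; exact: c2.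
  - by apply/cvg_ex; exists (2 * 1); apply: cvg_at_left_filter; exact: c2.
  - split=> [x _|  |]; first by have := d2 x.
      by apply: cvg_at_right_filter; apply: exprn_continuous.
    by apply: cvg_at_left_filter; apply: exprn_continuous.
  - exact: continuous_subspaceT.
have p2 : (\int[@lebesgue_measure R]_(t in `[1%R, +oo[%classic) (G t)%:E
   = \int[@lebesgue_measure R]_(x in `[1%R, +oo[%classic) (g x)%:E)%E.
  have := @increasing_ge0_integration_by_substitutiony R Num.sqrt g 1.
  rewrite sqrtr1 => ->.
  - apply: eq_integral => t; rewrite inE /= in_itv /= andbT => t1; congr EFin.
    have t0 : 0 < t by rewrite (lt_le_trans ltr01).
    have st : Num.sqrt t != 0 by rewrite gt_eqF // sqrtr_gt0.
    rewrite [RHS](_ : _ = g (Num.sqrt t) * (Num.sqrt^`())%classic t) //.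
    rewrite ds // /G /g /gauss_fun sqr_sqrtr ?(ltW t0) // (exprS _ a).
    by field.
  - move=> x y; rewrite !in_itv /= !andbT => x0 y0 xy.
    by rewrite ltr_sqrt // (lt_le_trans ltr01).
  - move=> x; rewrite in_itv /= andbT => x1.
    have x0 : 0 < x by rewrite (lt_trans ltr01).
    rewrite /continuous_at ds //.
    by apply: (near_derive_continuous _ (fun x => (2 * Num.sqrt x)^-1)) => //; exact: cs.
  - apply/cvg_ex; exists (2 * Num.sqrt 1)^-1; apply: cvg_at_right_filter.
    by apply: (near_derive_continuous _ (fun x => (2 * Num.sqrt x)^-1)) => //; exact: cs.
  - apply/cvg_ex; exists 0.
    have : ((2 * Num.sqrt x)^-1 @[x --> (+oo : set_system R)] --> (0 : R))%classic.
      apply/gtr0_cvgV0.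
        by apply: filterS (nbhs_pinfty_gt (num_real 0)) => x x0; rewrite mulr_gt0 // sqrtr_gt0.
      by apply: gt0_cvgMry => //; exact: sqrt_cvgy.
    apply: cvg_trans; apply: near_eq_cvg.
    by apply: filterS (nbhs_pinfty_gt (num_real 0)) => x x0; rewrite ds.
  - split=> [x|]; last by apply: cvg_at_right_filter; exact: sqrt_continuous.
    rewrite in_itv /= andbT => x1.
    by have [] := is_derive_pair _ _ _ (is_derive1_sqrt (lt_trans ltr01 x1)).
  - exact: sqrt_cvgy.
  - exact: continuous_subspaceT.
  - by move=> x; rewrite in_itv /= andbT => x1; apply: g0; rewrite ltW // (lt_trans ltr01).
rewrite /Gamma /Rintegral; congr fine.
transitivity (\int[@lebesgue_measure R]_(t in `]0%R, +oo[%classic) (G t)%:E)%E.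
  apply: eq_integral => t; rewrite inE /= in_itv /= andbT => t0; congr EFin.
  by rewrite addrK (mulrC a%:R) powRrM powR12_sqrt ?(ltW t0) // powR_mulrn // sqrtr_ge0.
rewrite integral_itv_obnd_cbnd; last first.
  by apply/measurable_EFinP; apply: measurable_funTS; apply: continuous_measurable_fun.
rewrite integral_0y_split // p1 p2 -integral_0y_split // integral_0yZ //.
- by move=> x x0; rewrite mulr_ge0 ?exprn_ge0 ?expR_ge0.
- exact: derivable_mongauss.
Qed.

Lemma Gamma1 {R : realType} : Gamma (1 : R) = 1.
Proof.
have := @Gamma_gauss R 0; rewrite mul0r add0r gauss_moment1 => ->.
by rewrite -EFinM /=; field.
Qed.

Lemma Gamma_three_half {R : realType} : Gamma (1 / 2 + 1 : R) = Num.sqrt pi / 2.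
Proof.
have := @Gamma_gauss R 1; rewrite gauss_momentSS gauss_moment0 => ->.
by rewrite -EFinM /= mul1r.
Qed.

Lemma Gamma_half_rec {R : realType} a :
  Gamma (a.+2%:R / 2 + 1 : R) = (a%:R / 2 + 1) * Gamma (a%:R / 2 + 1 : R).
Proof.
rewrite !Gamma_gauss gauss_momentSS.
(* The moments are extended reals, and [fine] is multiplicative here only once they are known to be
   finite. *)
have [x ->] : exists x : R, gauss_moment a.+1 = x%:E.
  have step b (x : R) : gauss_moment b = x%:E -> exists y : R, gauss_moment b.+2 = y%:E.
    move=> h; have := @gauss_momentSS R b; rewrite h -EFinM.
    case: (gauss_moment b.+2) => [r _| |]; first by exists r.
      by rewrite mulry gtr0_sg // mul1e.
    by rewrite mulrNy gtr0_sg // mul1e.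
  elim/ind2: a => [|  |a [x h] _]; last exact: step h.
    by eexists; exact: gauss_moment1.
  by have [y ->] := step _ _ gauss_moment0; exists y.
by rewrite -!EFinM /= -addn2 natrD -natr1; field.
Qed.

Lemma Gamma_nat {R : realType} n : Gamma (n.+1%:R : R) = n`!%:R.
Proof.
have -> : (n.+1%:R : R) = (2 * n)%:R / 2 + 1 by rewrite natrM -natr1; field.
elim: n => [|n IH]; first by rewrite muln0 mul0r add0r Gamma1.
have -> : (2 * n.+1 = (2 * n).+2)%N by lia.
by rewrite Gamma_half_rec IH factS !natrM -natr1; field.
Qed.

(** * Identification of the Legendre functions with [legS] *)

Lemma pochhammer0 {R : realType} (a : R) : pochhammer a 0 = 1.
Proof. by rewrite /pochhammer big_nil. Qed.

Lemma pochhammerS {R : realType} (a : R) n : pochhammer a n.+1 = pochhammer a n * (a + n%:R).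
Proof. by rewrite /pochhammer big_nat_recr. Qed.

Lemma pochhammer_nat {R : realType} N n :
  pochhammer (N.+1%:R : R) n * N`!%:R = (N + n)`!%:R.
Proof.
elim: n => [|n IH]; first by rewrite pochhammer0 mul1r addn0.
by rewrite pochhammerS mulrAC IH addnS factS natrM -!natr1 natrD; ring.
Qed.

Lemma pochhammer_half {R : realType} (A n : nat) :
  pochhammer (A.+1%:R / 2 : R) n * pochhammer (A.+2%:R / 2) n * A`!%:R * 4 ^+ n
  = (A + 2 * n)`!%:R.
Proof.
elim: n => [|n IH]; first by rewrite !pochhammer0 muln0 addn0; ring.
have -> : (A + 2 * n.+1 = (A + 2 * n).+2)%N by lia.
rewrite !factS !natrM -IH !pochhammerS exprS.
rewrite -[(A + 2 * n).+2%:R]natr1 -[(A + 2 * n).+1%:R]natr1 (natrD _ _ (2 * n)) natrM.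
by rewrite -[A.+2%:R]natr1 -[A.+1%:R]natr1; field.
Qed.

(** The reason why all the Legendre functions of the theorem are purely imaginary; the complex sums
    below are accordingly handled in the form 0 +i* y. *)
Lemma expi_half {R : realType} K :
  expi (pi * (K%:R + 1 / 2) : R) = 0 +i* (-1) ^+ K.
Proof.
elim: K => [|K].
  rewrite add0r mul1r -[X in expi X]mulrC mulrC /expi cos_pihalf sin_pihalf.
  by rewrite expr0.
rewrite /expi => -[h1 h2].
have -> : pi * (K.+1%:R + 1 / 2) = pi * (K%:R + 1 / 2) + pi :> R by rewrite -natr1; ring.
by rewrite cosDpi sinDpi h1 h2 exprS mulN1r oppr0.
Qed.

Definition legQc {R : realType} (z : R) : R :=
  Num.sqrt 2 * Num.sqrt pi * (z ^+ 2 - 1) `^ (1 / 4).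

Lemma hyp2F1_legseries {R : realType} (z : R) N K : 1 < z ->
  hyp2F1 ((N + K).+1%:R / 2) ((N + K).+2%:R / 2) (N.+1%:R) (z ^+ 2)^-1
  = N`!%:R / (N + K)`!%:R * (2 * z) ^+ (N + K).+1 * legseries (2 * z)^-1 N K.
Proof.
move=> z1; have z0 : 0 < z by rewrite (lt_trans ltr01).
have zn : z != 0 by rewrite gt_eqF.
rewrite /hyp2F1; apply: limn_is_sum.
apply: eq_is_sum (is_sumZ _ _ _ (legseries_is_sum _ N K _ _)) => [n| |]; last first.
- by rewrite ltr_pdivrMr ?mulr_gt0 // mul1r ltr_pMr.
- by rewrite invr_ge0 mulr_ge0 // ltW.
rewrite /legterm.
have -> : (N + K + 2 * n).+1 = ((N + K).+1 + 2 * n)%N by lia.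
rewrite -pochhammer_half -(pochhammer_nat N n) exprD exprM.
have P0 : pochhammer (N.+1%:R : R) n != 0.
  have := fact_neq0 (R := R) (N + n).
  by rewrite -pochhammer_nat mulf_eq0 negb_or => /andP[].
rewrite !exprVn [(2 * z) ^+ 2]exprMn (exprMn n) -[2 ^+ 2](_ : 4 = _); last by ring.
have h4 : (4 : R) ^+ n != 0 by rewrite expf_neq0.
have hz : z ^+ (N + K).+1 != 0 by rewrite expf_neq0.
have h2 : (2 * z) ^+ (N + K).+1 != 0 by rewrite expf_neq0 // mulf_neq0.
have hzn : (z ^+ 2) ^+ n != 0 by rewrite !expf_neq0.
by field; rewrite !fact_neq0 P0 h4 h2 hzn.
Qed.

Lemma legendreQ_half {R : realType} (z E q nu mu : R) N K : 0 < q < 1 ->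
  2 * z = q^-1 + q -> 2 * E = q^-1 - q -> nu = N%:R - 1 / 2 -> mu = K%:R + 1 / 2 ->
  legendreQ nu mu z = 0 +i* (legQc z * legS z E q N K).
Proof.
move=> q01 hz hE hnu hmu; have /andP[q0 q1] := q01.
have qn : q != 0 by rewrite gt_eqF.
have E0 : 0 < E.
  by rewrite -(pmulr_rgt0 _ (ltr0n R 2)) hE subr_gt0 (lt_trans q1) // invf_gt1.
have z1 : 1 < z.
  rewrite -(ltr_pM2l (ltr0n R 2)) hz mulr1.
  rewrite -subr_gt0 (_ : _ - _ = (1 - q) ^+ 2 / q); last by field.
  by rewrite divr_gt0 // exprn_gt0 // subr_gt0.
have z0 : 0 < z by rewrite (lt_trans ltr01).
have zE : z ^+ 2 - 1 = E ^+ 2 by exact: (sqr_subE z E q).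
rewrite /legendreQ hmu expi_half -(legseries_legS _ _ _ _ _ q01 hz hE).
have -> : nu + (K%:R + 1 / 2) + 1 = (N + K).+1%:R by rewrite hnu -[(N + K).+1%:R]natr1 natrD; field.
have -> : nu + (K%:R + 1 / 2) + 2 = (N + K).+2%:R
  by rewrite hnu -[(N + K).+2%:R]natr1 -[(N + K).+1%:R]natr1 natrD; field.
have -> : nu + 3 / 2 = N.+1%:R by rewrite hnu -[N.+1%:R]natr1; field.
have -> : nu + 1 = N%:R + 2^-1 by rewrite hnu; field.
rewrite hyp2F1_legseries // !Gamma_nat (powR_mulrn _ (ltW z0)).
have -> : 2 `^ (N%:R + 2^-1) = 2 ^+ N * Num.sqrt 2 :> R.
  by rewrite powRD ?pnatr_eq0 ?implybT // powR_mulrn // powR12_sqrt.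
have -> : (z ^+ 2 - 1) `^ ((K%:R + 1 / 2) / 2) = E ^+ K * (z ^+ 2 - 1) `^ (1 / 4).
  have -> : (K%:R + 1 / 2) / 2 = 2^-1 * K%:R + 1 / 4 :> R by field.
  rewrite powRD; last by rewrite zE expf_neq0 ?implybT // gt_eqF.
  by rewrite powRrM powR12_sqrt ?zE ?exprn_ge0 ?ltW // sqrtr_sqr gtr0_norm // powR_mulrn // ltW.
rewrite /legQc; set X := (z ^+ 2 - 1) `^ _; set L := legseries _ _ _.
have s2 : Num.sqrt 2 != 0 :> R by rewrite gt_eqF // sqrtr_gt0.
have s22 : Num.sqrt 2 ^+ 2 = 2 :> R by rewrite sqr_sqrtr.
have zn : z != 0 by rewrite gt_eqF.
set c := (X in (X)%:C).
have -> : c = Num.sqrt 2 * Num.sqrt pi * X * (2 * E) ^+ K * L.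
  rewrite /c !exprMn.
  have -> : (2 : R) ^+ (N + K).+1 = Num.sqrt 2 ^+ 2 * 2 ^+ N * 2 ^+ K by rewrite s22 exprS exprD mulrA.
  have p1 : (2 : R) ^+ N != 0 by rewrite expf_neq0.
  have p2 : z ^+ (N + K).+1 != 0 by rewrite expf_neq0.
  by field; rewrite !fact_neq0 s2 p1 p2.
have -> : (- 2 * E) ^+ K = (-1) ^+ K * (2 * E) ^+ K :> R by rewrite -exprMn mulN1r mulNr.
apply/eqP; rewrite eq_complex /= !mul0r !mulr0 subrr eqxx /=.
by apply/eqP; ring.
Qed.

(** * Gegenbauer polynomials and their addition theorem *)

(* Gegenbauer polynomials, vanishing for negative degrees *)
Definition gegz {R : realType} (n : int) (mu x : R) : R :=
  if n is Posz n' then (gegenbauer n' mu).[x] else 0.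

(** Extended by 0 so that polynomials of different degrees can be summed over one common range. *)
Definition gegterm {R : realType} (mu x : R) (n k : nat) : R :=
  if (2 * k <= n)%N then
    (-1) ^+ k * pochhammer mu (n - k) / (k`!%:R * (n - 2 * k)`!%:R)
      * (2 * x) ^+ (n - 2 * k)
  else 0.

Lemma gegz_sum {R : realType} (mu x : R) (n M : nat) : (n < 2 * M)%N ->
  gegz n%:Z mu x = \sum_(0 <= k < M) gegterm mu x n k.
Proof.
move=> nM; rewrite /gegz /gegenbauer horner_sum.
have h : (n./2.+1 <= M)%N by lia.
rewrite (big_cat_nat (leq0n _) h) //= [X in _ + X]big_nat [X in _ + X]big1 ?addr0.
  rewrite big_mkord; apply: eq_bigr => k _.
  have hk := ltn_ord k.
  rewrite /gegterm ifT; last by lia.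
  by rewrite hornerZ horner_exp hornerZ hornerX -mul2n.
by move=> k hk; rewrite /gegterm ifF //; lia.
Qed.

Lemma pochhammerSl {R : realType} (mu : R) n :
  mu * pochhammer (mu + 1) n = pochhammer mu n.+1.
Proof.
elim: n => [|n IH]; first by rewrite pochhammerS !pochhammer0; ring.
by rewrite pochhammerS mulrA IH !pochhammerS -natr1; ring.
Qed.

Lemma gegtermA {R : realType} (mu x : R) n k :
  n.+1%:R * gegterm mu x n.+1 k = 2 * mu * (x * gegterm (mu + 1) x n k
    - (if k is k'.+1 then if n is n'.+1 then gegterm (mu + 1) x n' k' else 0 else 0)).
Proof.
rewrite /gegterm; case: k => [|k].
  rewrite !muln0 /= !subn0 subr0 exprS factS natrM -pochhammerSl fact0.
  by field; rewrite fact_neq0 addrC natr1 pnatr_eq0.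
case: (leqP (2 * k.+1) n.+1) => h1; last first.
  rewrite ifF; last by lia.
  case: n h1 => [|n] h1; first by rewrite !mulr0 subrr mulr0.
  by rewrite ifF ?mulr0 ?subrr ?mulr0 //; lia.
case: n h1 => [|n] h1; first by lia.
rewrite (_ : 2 * k <= n)%N; last by lia.
have -> : (n.+2 - k.+1 = (n - k).+1)%N by lia.
rewrite factS natrM exprS -pochhammerSl.
case: (leqP (2 * k.+1) n.+1) => h2.
  have [j hj] : exists j, n = (j + 2 * k + 1)%N by exists (n - 2 * k - 1)%N; lia.
  have -> : (n.+2 - 2 * k.+1 = j.+1)%N by lia.
  have -> : (n.+1 - 2 * k.+1 = j)%N by lia.
  have -> : (n - 2 * k = j.+1)%N by lia.
  have -> : (n.+1 - k.+1 = n - k)%N by lia.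
  have -> : n.+2%:R = j%:R + 2 * k%:R + 3 :> R.
    by rewrite hj -[_.+2%:R]natr1 -[_.+1%:R]natr1 (natrD _ _ 1) (natrD _ j) natrM; ring.
  rewrite exprS factS natrM -!natr1.
  have jj := ler0n R j; have kk := ler0n R k.
  by field; rewrite !fact_neq0; nzlra.
have hn : n = (2 * k)%N by lia.
have -> : (n.+2 - 2 * k.+1 = 0)%N by lia.
have -> : (n - 2 * k = 0)%N by lia.
have -> : n.+2%:R = 2 * k%:R + 2 :> R.
  by rewrite hn -[_.+2%:R]natr1 -[_.+1%:R]natr1 natrM; ring.
rewrite fact0 -natr1.
have kk := ler0n R k.
by field; rewrite !fact_neq0; nzlra.
Qed.

Lemma gegtermB {R : realType} (mu x : R) n k :
  (n%:R + 2 * mu) * gegterm mu x n k = 2 * mu * (gegterm (mu + 1) x n k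
    - x * (if n is n'.+1 then gegterm (mu + 1) x n' k else 0)).
Proof.
rewrite /gegterm; case: (leqP (2 * k) n) => h1; last first.
  case: n h1 => [|n] h1; first by rewrite !mulr0 subrr mulr0.
  by rewrite ifF ?mulr0 ?subrr ?mulr0 //; lia.
have [j hj] : exists j, n = (j + 2 * k)%N by exists (n - 2 * k)%N; lia.
have -> : (n - k = j + k)%N by lia.
have -> : (n - 2 * k = j)%N by lia.
have nE : n%:R = j%:R + 2 * k%:R :> R by rewrite hj natrD natrM.
have P : 2 * mu * pochhammer (mu + 1) (j + k) = 2 * pochhammer mu (j + k) * (mu + j%:R + k%:R).
  by rewrite -mulrA pochhammerSl pochhammerS natrD; ring.
case: j => [|j] in hj nE P *.
  have -> : (if n is n'.+1 then if (2 * k <= n')%N then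
    (-1) ^+ k * pochhammer (mu + 1) (n' - k) / (k`!%:R * (n' - 2 * k)`!%:R) * (2 * x) ^+ (n' - 2 * k) else 0 else 0) = 0.
    by case: (n) hj => // n' hj; rewrite ifF //; lia.
  apply: (lincomb (lcM (- (-1) ^+ k / k`!%:R) P)).
  rewrite nE fact0 mulr0 subr0.
  by field; rewrite fact_neq0.
have [n' hn'] : exists n', n = n'.+1 by exists n.-1; lia.
rewrite hn' in hj nE *.
rewrite ifT; last by lia.
have -> : (n' - k = j + k)%N by lia.
have -> : (n' - 2 * k = j)%N by lia.
apply: (lincomb (lcM (- (-1) ^+ k / (k`!%:R * j.+1`!%:R) * (2 * x) ^+ j.+1) P)).
have P2 : mu * pochhammer (mu + 1) (j + k) = pochhammer mu (j.+1 + k) by rewrite pochhammerSl.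
rewrite -P2 nE exprS factS natrM -natr1.
have jj := ler0n R j.
by field; rewrite !fact_neq0; nzlra.
Qed.

(** This relation and [gegzB] are verified on the summands; the other contiguous relations below are
    linear combinations of the two. *)
Lemma gegzA {R : realType} (mu x : R) (n : int) :
  (n + 1)%:~R * gegz (n + 1) mu x
  = 2 * mu * (x * gegz n (mu + 1) x - gegz (n - 1) (mu + 1) x).
Proof.
case: n => [n|n]; last first.
  have [m hm] : exists m, Negz n - 1 = Negz m by exists n.+1; lia.
  rewrite hm; case: n hm => [|n] hm.
    by rewrite (_ : Negz 0 + 1 = 0) // mul0r /=; ring.
  have [m' ->] : exists m, Negz n.+1 + 1 = Negz m by exists n; lia.
  by rewrite /=; ring.
have -> : n%:Z + 1 = n.+1%:Z by lia.
rewrite -pmulrn (gegz_sum _ _ n.+1 n.+2) ?(gegz_sum _ _ n n.+2); try lia.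
rewrite big_distrr /=; under eq_bigr do rewrite gegtermA.
rewrite -big_distrr /= sumrB -big_distrr /=; congr (_ * (_ - _)).
rewrite big_nat_recl // add0r; case: n => [|n].
  by rewrite (_ : 0%:Z - 1 = Negz 0) // big1.
have -> : n.+1%:Z - 1 = n%:Z by lia.
by rewrite (gegz_sum _ _ n n.+2) //; lia.
Qed.

Lemma gegzB {R : realType} (mu x : R) (n : int) :
  (n%:~R + 2 * mu) * gegz n mu x
  = 2 * mu * (gegz n (mu + 1) x - x * gegz (n - 1) (mu + 1) x).
Proof.
case: n => [n|n]; last first.
  have [m ->] : exists m, Negz n - 1 = Negz m by exists n.+1; lia.
  by rewrite /=; ring.
rewrite -pmulrn !(gegz_sum _ _ n n.+1); try lia.
rewrite big_distrr /=; under eq_bigr do rewrite gegtermB.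
rewrite -big_distrr /= sumrB -big_distrr /=; congr (_ * (_ - _ * _)).
case: n => [|n]; first by rewrite (_ : 0%:Z - 1 = Negz 0) // big1.
have -> : n.+1%:Z - 1 = n%:Z by lia.
by rewrite (gegz_sum _ _ n n.+2) //; lia.
Qed.

Lemma gegz_raise {R : realType} (mu x : R) (n : int) :
  (n%:~R + mu) * gegz n mu x = mu * (gegz n (mu + 1) x - gegz (n - 2) (mu + 1) x).
Proof.
have a := gegzA mu x (n - 1); have b := gegzB mu x n.
move: a; rewrite subrK (_ : n - 1 - 1 = n - 2); last by lia.
move=> a; apply: (mulfI (x := 2%:R)) => //.
by apply: (lincomb (lcD a b)); ring.
Qed.

Lemma gegz_rec {R : realType} (mu x : R) (n : int) :
  2 * (n%:~R + mu) * x * gegz n mu x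
  = (n%:~R + 1) * gegz (n + 1) mu x + (n%:~R + 2 * mu - 1) * gegz (n - 1) mu x.
Proof.
have a := gegzA mu x n; have b := gegzB mu x (n - 1); have c := gegz_raise mu x n.
move: a b c; rewrite (_ : n - 1 - 1 = n - 2); last by lia.
rewrite !rmorphD rmorphN /= => a b c.
by apply: (lincomb (lcD (lcM (-1) a) (lcD (lcM (-1) b) (lcM (2 * x) c)))); ring.
Qed.

Lemma gegz_lower {R : realType} (mu x : R) (n : int) :
  4 * mu * (n%:~R + mu) * (1 - x ^+ 2) * gegz (n - 1) (mu + 1) x
  = (n%:~R + 2 * mu - 1) * (n%:~R + 2 * mu) * gegz (n - 1) mu x
    - n%:~R * (n%:~R + 1) * gegz (n + 1) mu x.
Proof.
have a := gegzA mu x (n - 1); have b := gegzB mu x (n - 1); have c := gegz_rec mu x n.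
move: a b c; rewrite subrK (_ : n - 1 - 1 = n - 2); last by lia.
rewrite !rmorphB /= => a b c.
apply: (lincomb (lcD (lcM (2 * (n%:~R + mu) * x) a) (lcD (lcM (- (2 * (n%:~R + mu))) b) (lcM (- n%:~R) c)))).
by ring.
Qed.

Lemma gegz0 {R : realType} (mu x : R) : gegz 0 mu x = 1.
Proof.
rewrite (gegz_sum _ _ 0 1) // big_nat1 /gegterm /= pochhammer0 fact0 !expr0.
by field.
Qed.

Lemma gegz1 {R : realType} (mu x : R) : gegz 1 mu x = 2 * mu * x.
Proof.
have := gegzA mu x 0; rewrite add0r (_ : 0 - 1 = Negz 0) // gegz0 /= mul1r => ->.
by ring.
Qed.

(* (n + lambda) / lambda times the Gegenbauer polynomial, which makes sense
   also for lambda = 0 *)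
Definition gegE {R : realType} (n : int) (lambda x : R) : R :=
  gegz n (lambda + 1) x - gegz (n - 2) (lambda + 1) x.

Lemma gegE_gegz {R : realType} (n : int) (lambda x : R) :
  (n%:~R + lambda) * gegz n lambda x = lambda * gegE n lambda x.
Proof. exact: gegz_raise. Qed.

Definition gegEa {R : realType} (lambda : R) (k : nat) : R :=
  (k%:R + 1) / (2 * (k%:R + lambda + 1)).

(** At k = 1 the general quotient reads 2 lambda / (2 lambda); its value 1 is imposed so that lambda
    = 0 is covered. *)
Definition gegEb {R : realType} (lambda : R) (k : nat) : R :=
  if k == 1%N then 1 else (k%:R + 2 * lambda - 1) / (2 * (k%:R + lambda - 1)).

Lemma gegE0 {R : realType} (lambda x : R) : gegE 0 lambda x = 1.
Proof. by rewrite /gegE gegz0 (_ : 0 - 2 = Negz 1) //= subr0. Qed.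

Lemma gegE1 {R : realType} (lambda x : R) : gegE 1 lambda x = 2 * (lambda + 1) * x.
Proof. by rewrite /gegE gegz1 (_ : 1 - 2 = Negz 0) //= subr0. Qed.

Lemma gegE_mulX {R : realType} (lambda x : R) (k : nat) : 0 <= lambda ->
  x * gegE k%:Z lambda x = gegEa lambda k * gegE k.+1%:Z lambda x
    + (if k is k'.+1 then gegEb lambda k * gegE k'%:Z lambda x else 0).
Proof.
move=> l0; have k0 := ler0n R k.
have e1 := gegz_rec (lambda + 1) x k%:Z; have e2 := gegz_rec (lambda + 1) x (k%:Z - 2).
case: k => [|[|k]] in k0 e1 e2 *.
- by rewrite gegE0 gegE1 /gegEa; field; nzlra.
- rewrite gegE1 gegE0 /gegEa /gegEb eqxx mulr1.
  move: e1; rewrite subrr gegz0 gegz1 /gegE (_ : 1 + 1 = 2) // (_ : 2 - 2 = 0) // gegz0.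
  set G := gegz _ _ _ => e1.
  apply: (mulfI (x := 2 * (lambda + 2))); first by apply: lt0r_neq0; lra.
  by apply: (lincomb e1); field; nzlra.
rewrite /gegEa /gegEb /gegE (_ : (k.+2 == 1)%N = false) //.
have -> : k.+3%:Z - 2 = k.+1%:Z by lia.
have -> : k.+2%:Z - 2 = k%:Z by lia.
have -> : k.+1%:Z - 2 = k%:Z - 1 by lia.
move: e1 e2.
have -> : k.+2%:Z - 2 = k%:Z by lia.
have -> : k.+2%:Z + 1 = k.+3%:Z by lia.
have -> : k.+2%:Z - 1 = k.+1%:Z by lia.
have -> : k%:Z + 1 = k.+1%:Z by lia.
rewrite -!pmulrn.
set G0 := gegz _ _ _; set G1 := gegz _ _ _; set G2 := gegz _ _ _.
set G3 := gegz k%:Z _ _; set G4 := gegz (k%:Z - 1) _ _.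
have kk := ler0n R k.
have -> : k.+2%:R = k%:R + 2 :> R by rewrite -!natr1; ring.
move=> e1 e2.
have c1 : 2 * (k%:R + lambda + 3) != 0 by apply: lt0r_neq0; lra.
have c2 : 2 * (k%:R + lambda + 1) != 0 by apply: lt0r_neq0; lra.
apply: (mulfI c1); apply: (mulfI c2).
apply: (lincomb (lcD (lcM (2 * (k%:R + lambda + 1)) e1) (lcM (- (2 * (k%:R + lambda + 3))) e2))).
by field; nzlra.
Qed.

(** Constants of the addition theorem, with N = n - k. Paired with [gegE] instead of Gegenbauer
    polynomials they carry no denominator lambda - 1/2, so lambda = 1/2 is included. *)
Definition addcoef {R : realType} (lambda : R) (k N : nat) : R :=
  4 ^+ k * pochhammer lambda k ^+ 2 * N`!%:R / pochhammer (2 * lambda) (2 * k + N).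

Definition addterm {R : realType} (lambda w x y : R) (n k : nat) : R :=
  if (k <= n)%N then
    addcoef lambda k (n - k) * w ^+ k * gegz (n - k)%N%:Z (lambda + k%:R) x
      * gegz (n - k)%N%:Z (lambda + k%:R) y
  else 0.

Lemma pochhammer_gt0 {R : realType} (a : R) n : 0 < a -> 0 < pochhammer a n.
Proof.
by move=> a0; elim: n => [|n IH]; rewrite ?pochhammer0 // pochhammerS mulr_gt0 // ltr_wpDr.
Qed.

Lemma addcoefSr {R : realType} (lambda : R) (k N : nat) : 0 < lambda ->
  addcoef lambda k N.+1 = addcoef lambda k N * (N%:R + 1)
   / (2 * lambda + 2 * k%:R + N%:R).
Proof.
move=> l0; rewrite /addcoef addnS pochhammerS factS natrM -natr1 (natrD _ (2 * k)) natrM.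
have h : pochhammer (2 * lambda) (2 * k + N) != 0.
  by rewrite gt_eqF // pochhammer_gt0 // mulr_gt0.
have := ler0n R k; have := ler0n R N => k0 N0.
by field; nzlra.
Qed.

Lemma addcoefSl {R : realType} (lambda : R) (k N : nat) : 0 < lambda ->
  addcoef lambda k.+1 N = addcoef lambda k N * 4 * (lambda + k%:R) ^+ 2
   / ((2 * lambda + 2 * k%:R + N%:R) * (2 * lambda + 2 * k%:R + N%:R + 1)).
Proof.
move=> l0; rewrite /addcoef (_ : 2 * k.+1 + N = (2 * k + N).+2)%N; last by lia.
rewrite !pochhammerS -natr1 (natrD _ (2 * k)) natrM exprS.
have h : pochhammer (2 * lambda) (2 * k + N) != 0.
  by rewrite gt_eqF // pochhammer_gt0 // mulr_gt0.
have := ler0n R k; have := ler0n R N => k0 N0.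
by field; nzlra.
Qed.

(** Expresses the neighbour k - 1, whose polynomials have index lambda + k - 1, with the constants
    of the term k; the factor k makes the formula valid at k = 0. *)
Lemma addterm_pred {R : realType} (lambda w x y : R) (k j : nat) : 0 < lambda ->
  w * (if k is k'.+1 then gegEa (lambda - 1 / 2) k' * addterm lambda w x y (k + j + 1) k' else 0)
  = addcoef lambda k j * w ^+ k * ((j%:R + 1) * (j%:R + 2) / (4 * (lambda + k%:R - 1) ^+ 2))
    * (k%:R / (2 * k%:R + 2 * lambda - 1))
    * gegz j.+2%:Z (lambda + k%:R - 1) x * gegz j.+2%:Z (lambda + k%:R - 1) y.
Proof.
move=> l0; case: k => [|k]; first by rewrite mul0r !mulr0 !mul0r.
rewrite /addterm ifT; last by lia.
have -> : (k.+1 + j + 1 - k = j.+2)%N by lia.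
have -> : lambda + k.+1%:R - 1 = lambda + k%:R by rewrite -natr1; ring.
rewrite /gegEa !addcoefSr // addcoefSl // (exprS w) -!natr1.
have := ler0n R k; have := ler0n R j => j0 k0.
by field; nzlra.
Qed.

(** Everything is reduced to the polynomials of index lambda + k and of degrees j and j + 2 in x and
    in y, with w^2 replaced by (1 - x^2) (1 - y^2); what remains is a rational identity. *)
Lemma addterm_rec_bulk {R : realType} (lambda w x y : R) (k j : nat) :
  0 < lambda -> w ^+ 2 = (1 - x ^+ 2) * (1 - y ^+ 2) ->
  (k + j + 2)%:R * addterm lambda w x y (k + j + 2) k =
  2 * ((k + j + 1)%:R + lambda) *
   (x * y * addterm lambda w x y (k + j + 1) k
    + w * ((if k is k'.+1 then gegEa (lambda - 1 / 2) k' * addterm lambda w x y (k + j + 1) k' else 0)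
      + gegEb (lambda - 1 / 2) k.+1 * addterm lambda w x y (k + j + 1) k.+1))
  - ((k + j)%:R + 2 * lambda) * addterm lambda w x y (k + j) k.
Proof.
move=> l0 hw; rewrite (mulrDr w) addterm_pred // /addterm.
have kk := ler0n R k; have jj := ler0n R j.
rewrite !ifT; try lia.
have -> : (k + j + 2 - k = j.+2)%N by lia.
have -> : (k + j + 1 - k = j.+1)%N by lia.
have -> : (k + j - k = j)%N by lia.
have -> : (k + j + 1 - k.+1 = j)%N by lia.
pose nu := lambda + k%:R.
have nu1 : lambda + k.+1%:R = nu + 1 by rewrite -natr1 addrA.
rewrite nu1.
pose M : R := j%:R + 1.
have ej : j.+1%:Z%:~R = M :> R by rewrite -pmulrn -natr1.
have rx := gegz_rec nu x j.+1%:Z; have ry := gegz_rec nu y j.+1%:Z.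
have lx := gegz_lower nu x j.+1%:Z; have ly := gegz_lower nu y j.+1%:Z.
have ix := gegz_raise (nu - 1) x j.+2%:Z; have iy := gegz_raise (nu - 1) y j.+2%:Z.
move: rx ry lx ly ix iy; rewrite !ej !subrK.
have -> : j.+1%:Z - 1 = j%:Z by lia.
have -> : j.+1%:Z + 1 = j.+2%:Z by lia.
have -> : j.+2%:Z - 2 = j%:Z by lia.
have -> : j.+2%:Z%:~R = M + 1 :> R by rewrite -pmulrn /M !natr1.
have M0 : 0 < M by rewrite /M; lra.
have n0 : 0 < nu by rewrite /nu; lra.
set p := gegz j.+2%:Z nu x; set m := gegz j%:Z nu x; set g := gegz j.+1%:Z nu x.
set p' := gegz j.+2%:Z nu y; set m' := gegz j%:Z nu y; set g' := gegz j.+1%:Z nu y.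
set l := gegz j%:Z (nu + 1) x; set l' := gegz j%:Z (nu + 1) y.
set h := gegz j.+2%:Z (nu - 1) x; set h' := gegz j.+2%:Z (nu - 1) y.
move=> rx ry lx ly ix iy.
have Mn : M + nu != 0 by apply: lt0r_neq0; lra.
have nn : nu != 0 by apply: lt0r_neq0.
have rx' : x * g = ((M + 1) * p + (M + 2 * nu - 1) * m) / (2 * (M + nu)).
  apply: (mulfI (x := 2 * (M + nu))); first by rewrite mulf_neq0.
  by apply: (lincomb rx); field; nzlra.
have ry' : y * g' = ((M + 1) * p' + (M + 2 * nu - 1) * m') / (2 * (M + nu)).
  apply: (mulfI (x := 2 * (M + nu))); first by rewrite mulf_neq0.
  by apply: (lincomb ry); field; nzlra.
have lx' : (1 - x ^+ 2) * l = ((M + 2 * nu - 1) * (M + 2 * nu) * m - M * (M + 1) * p) / (4 * nu * (M + nu)).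
  apply: (mulfI (x := 4 * nu * (M + nu))); first by rewrite !mulf_neq0.
  by apply: (lincomb lx); field; nzlra.
have ly' : (1 - y ^+ 2) * l' = ((M + 2 * nu - 1) * (M + 2 * nu) * m' - M * (M + 1) * p') / (4 * nu * (M + nu)).
  apply: (mulfI (x := 4 * nu * (M + nu))); first by rewrite !mulf_neq0.
  by apply: (lincomb ly); field; nzlra.
have hx' : h = (nu - 1) * (p - m) / (M + nu).
  apply: (mulfI (x := M + nu)) => //.
  by apply: (lincomb ix); field; nzlra.
have hy' : h' = (nu - 1) * (p' - m') / (M + nu).
  apply: (mulfI (x := M + nu)) => //.
  by apply: (lincomb iy); field; nzlra.
have Exy c : x * y * (c * w ^+ k * g * g') = c * w ^+ k * ((x * g) * (y * g')) by ring.
have Ew c : w * (c * w ^+ k.+1 * l * l') = c * w ^+ k * ((1 - x ^+ 2) * l * ((1 - y ^+ 2) * l')).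
  by rewrite exprS; apply: (lincomb (lcM (c * w ^+ k * l * l') hw)); ring.
rewrite [w * (gegEb _ _ * _)]mulrCA Ew Exy rx' ry' lx' ly' hx' hy' /gegEb.
rewrite !addcoefSr // addcoefSl //.
have -> : (k + j + 2)%:R = k%:R + j%:R + 2 :> R by rewrite !natrD.
have -> : (k + j + 1)%:R = k%:R + j%:R + 1 :> R by rewrite !natrD.
have -> : (k + j)%:R = k%:R + j%:R :> R by rewrite !natrD.
move: (addcoef _ _ _) (w ^+ k) => C W.
clear - l0 kk jj Mn nn.
(* For k = 0 the coefficient [gegEb] at k + 1 takes its exceptional value. *)
case: eqP => [[k0]|k1].
  move: (kk) Mn nn; rewrite /M /nu k0 mulr0n !(mul0r, mulr0, add0r, addr0) => _ Mn nn.
  by field; nzlra.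
have k1' : 1 <= k%:R :> R by rewrite ler1n; case: (k) k1.
rewrite -natr1 /M /nu.
by field; nzlra.
Qed.

Arguments gegz : simpl never.
Arguments gegE : simpl never.

(** Completes the previous recurrence at k = n + 1 and k = n + 2, where some of the terms are cut
    off. *)
Lemma addterm_rec {R : realType} (lambda w x y : R) (n k : nat) :
  0 < lambda -> w ^+ 2 = (1 - x ^+ 2) * (1 - y ^+ 2) -> (k <= n + 2)%N ->
  (n + 2)%:R * addterm lambda w x y (n + 2) k =
  2 * ((n + 1)%:R + lambda) *
   (x * y * addterm lambda w x y (n + 1) k
    + w * ((if k is k'.+1 then gegEa (lambda - 1 / 2) k' * addterm lambda w x y (n + 1) k' else 0)
      + gegEb (lambda - 1 / 2) k.+1 * addterm lambda w x y (n + 1) k.+1))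
  - (n%:R + 2 * lambda) * addterm lambda w x y n k.
Proof.
move=> l0 hw kn; have [k_le|k_gt] := leqP k n.
  have := addterm_rec_bulk lambda w x y k (n - k) l0 hw.
  by have -> : (k + (n - k) = n)%N by lia.
have n0 := ler0n R n.
have [->|->] : k = n.+1 \/ k = n.+2 by lia.
  rewrite /addterm /gegEa.
  rewrite (_ : n.+1 <= n + 2)%N; last by lia.
  rewrite (_ : n.+1 <= n + 1)%N; last by lia.
  rewrite (_ : n <= n + 1)%N; last by lia.
  rewrite (_ : n.+2 <= n + 1 = false)%N; last by lia.
  rewrite ltnn.
  have -> : (n + 2 - n.+1 = 1)%N by lia.
  have -> : (n + 1 - n.+1 = 0)%N by lia.
  have -> : (n + 1 - n = 1)%N by lia.
  rewrite !gegz1 !gegz0 !addcoefSr // !addcoefSl // (exprS w n) !natrD -!natr1 !mulr0 !mulr1 !subr0.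
  by field; nzlra.
rewrite /addterm /gegEa.
rewrite (_ : n.+2 <= n + 2)%N; last by lia.
rewrite (_ : n.+1 <= n + 1)%N; last by lia.
rewrite (_ : n.+2 <= n + 1 = false)%N; last by lia.
rewrite (_ : n.+3 <= n + 1 = false)%N; last by lia.
rewrite (_ : n.+1 < n = false)%N; last by lia.
have -> : (n + 2 - n.+2 = 0)%N by lia.
have -> : (n + 1 - n.+1 = 0)%N by lia.
rewrite !gegz0 (addcoefSl _ n.+1) // (exprS w n.+1) !natrD -!natr1 !mulr0 !mulr1 !subr0.
by field; nzlra.
Qed.

(** Both sides obey the three-term recurrence in n. On the right, multiplication by t passes to the
    neighbours of k by [gegE_mulX], and a shift of the summation index brings this to the form of
    [addterm_rec]. *)
Lemma gegen_addition {R : realType} (lambda w x y t : R) (n : nat) :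
  1 / 2 <= lambda -> w ^+ 2 = (1 - x ^+ 2) * (1 - y ^+ 2) ->
  gegz n%:Z lambda (x * y + w * t)
  = \sum_(0 <= k < n.+1) addterm lambda w x y n k * gegE k%:Z (lambda - 1 / 2) t.
Proof.
move=> l12 hw; have l0 : 0 < lambda by lra.
have mu0 : 0 <= lambda - 1 / 2 by lra.
have wide m M : (m < M)%N ->
    \sum_(0 <= k < m.+1) addterm lambda w x y m k * gegE k%:Z (lambda - 1 / 2) t
    = \sum_(0 <= k < M) addterm lambda w x y m k * gegE k%:Z (lambda - 1 / 2) t.
  move=> mM; rewrite [RHS](big_cat_nat (leq0n _) mM) /= [X in _ = _ + X]big_nat.
  rewrite [X in _ = _ + X]big1 ?addr0 // => k /andP[hk _].
  by rewrite /addterm leqNgt hk mul0r.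
elim/ind2: n => [|  |n IH0 IH1].
- rewrite gegz0 big_nat1 gegE0 /addterm /addcoef leqnn subnn !gegz0 !pochhammer0 fact0 !expr0.
  by field.
- rewrite gegz1 !big_nat_recr //= big_nil gegE0 gegE1 /addterm /= !gegz0 !gegz1.
  have c0 : addcoef lambda 0 0 = 1.
    by rewrite /addcoef !pochhammer0 fact0 !expr0; field.
  rewrite addcoefSr // addcoefSl // c0 addr0.
  by field; nzlra.
have := gegz_rec lambda (x * y + w * t) n.+1%:Z.
have -> : n.+1%:Z + 1 = n.+2%:Z by lia.
have -> : n.+1%:Z - 1 = n%:Z by lia.
rewrite IH0 IH1 (wide n n.+3) ?(wide n.+1 n.+3); try lia.
move=> e; apply: (mulfI (x := n.+2%:R)); first by rewrite pnatr_eq0.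
have l1 : n.+2%:R * (\sum_(0 <= k < n.+3) addterm lambda w x y n.+2 k * gegE k%:Z (lambda - 1 / 2) t)
  = \sum_(0 <= k < n.+3) (n.+2%:R * addterm lambda w x y n.+2 k) * gegE k%:Z (lambda - 1 / 2) t.
  by rewrite big_distrr /=; apply: eq_bigr => k _; rewrite mulrA.
pose a k := gegEa (lambda - 1 / 2) k; pose b k := gegEb (lambda - 1 / 2) k.
pose T k := addterm lambda w x y n.+1 k; pose E k := gegE k%:Z (lambda - 1 / 2) t.
have T0 k : (n.+1 < k)%N -> T k = 0 by move=> h; rewrite /T /addterm leqNgt h.
have tE k : t * E k = a k * E k.+1 + (if k is k'.+1 then b k * E k' else 0).
  exact: gegE_mulX.
have shift : \sum_(0 <= k < n.+3) T k * (t * E k)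
   = \sum_(0 <= k < n.+3) ((if k is k'.+1 then a k' * T k' else 0) + b k.+1 * T k.+1) * E k.
  under eq_bigr do rewrite tE mulrDr.
  under [RHS]eq_bigr do rewrite mulrDl.
  rewrite !big_split /=; congr (_ + _).
    rewrite big_nat_recr // (T0 n.+2) // mul0r [LHS]addr0 [RHS]big_nat_recl // mul0r add0r.
    by apply: eq_bigr => k _; ring.
  rewrite big_nat_recl // mulr0 add0r [RHS]big_nat_recr // (T0 n.+3) // mulr0 mul0r [RHS]addr0.
  by apply: eq_bigr => k _; ring.
have tS : \sum_(0 <= k < n.+3) T k * (t * E k) = t * \sum_(0 <= k < n.+3) T k * E k.
  by rewrite big_distrr /=; apply: eq_bigr => k _; rewrite mulrCA.
have key : \sum_(0 <= k < n.+3) n.+2%:R * addterm lambda w x y n.+2 k * E k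
  = 2 * (n.+1%:R + lambda) * (x * y * (\sum_(0 <= k < n.+3) T k * E k)
      + w * (\sum_(0 <= k < n.+3) T k * (t * E k)))
    - (n%:R + 2 * lambda) * (\sum_(0 <= k < n.+3) addterm lambda w x y n k * E k).
  rewrite shift mulrDr !big_distrr /= -big_split -sumrB /=.
  apply: eq_big_nat => k hk.
  have := addterm_rec lambda w x y n k l0 hw; rewrite addn2 addn1 => -> //.
  by rewrite /T /a /b; case: k hk => [|k] hk; ring.
rewrite l1 key tS; move: e; rewrite -!pmulrn -/(T _) => e.
apply: (lincomb (lcM (-1) e)).
by rewrite /T /E -[n.+2%:R]natr1 -[n.+1%:R]natr1; ring.
Qed.

(** * Zonal kernels and the factors [Omega] *)

Lemma gegE_cos {R : realType} (phi : R) (k : nat) :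
  gegE k%:Z 0 (cos phi) = (if k == 0%N then 1 else 2) * cos (k%:R * phi).
Proof.
elim/ind2: k => [|  |k IH0 IH1].
- by rewrite gegE0 mul0r cos0 mul1r.
- by rewrite gegE1 /= mul1r; ring.
have := gegE_mulX 0 (cos phi) k.+1 (lexx 0).
have k0 := ler0n R k.
have -> : gegEa (0 : R) k.+1 = 1 / 2.
  by rewrite /gegEa -[k.+1%:R]natr1; field; nzlra.
have e : (if k.+1 is k'.+1 then gegEb (0 : R) k.+1 * gegE k'%:Z 0 (cos phi) else 0) = cos (k%:R * phi).
  rewrite /gegEb; case: k k0 IH0 {IH1} => [|k] k0 IH0 /=.
    by rewrite gegE0 mul0r cos0; ring.
  rewrite IH0 /= -[k.+2%:R]natr1.
  move: k0; rewrite -[k.+1%:R]natr1 => k0; have k1 := ler0n R k.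
  by field; nzlra.
rewrite /= in e; rewrite e {e} IH1 /= => h.
apply: (lincomb (lcM (-2) h)).
have -> : k.+2%:R * phi = k.+1%:R * phi + phi by rewrite -[k.+2%:R]natr1; ring.
have -> : k%:R * phi = k.+1%:R * phi - phi by rewrite -[k.+1%:R]natr1; ring.
by rewrite cosB cosD; field.
Qed.

(** The reciprocal of the area of the unit sphere in dimension a + 2. *)
Definition zonal_const {R : realType} (a : nat) : R :=
  Gamma (a%:R / 2 + 1) / (2 * pi * Num.sqrt pi ^+ a).

(** The reproducing kernel of the spherical harmonics of degree l on that sphere; for a = 0 it is
    the cosine kernel of the circle. *)
Definition zonal {R : realType} (a l : nat) (u : R) : R :=
  zonal_const a * gegE l%:Z (a%:R / 2) u.

Lemma Gamma_half_gt0 {R : realType} a : 0 < Gamma (a%:R / 2 + 1 : R).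
Proof.
elim/ind2: a => [|  |a IH _].
- by rewrite mul0r add0r Gamma1.
- by rewrite Gamma_three_half divr_gt0 // sqrtr_gt0 pi_gt0.
by rewrite Gamma_half_rec mulr_gt0 // ltr_wpDl.
Qed.

Lemma zonal_const_gt0 {R : realType} a : 0 < zonal_const a :> R.
Proof.
by rewrite divr_gt0 ?Gamma_half_gt0 // !mulr_gt0 ?exprn_gt0 ?sqrtr_gt0 ?pi_gt0.
Qed.

Lemma Gamma_half_poch {R : realType} a k :
  Gamma ((2 * k + a)%:R / 2 + 1 : R) = pochhammer (a%:R / 2 + 1) k * Gamma (a%:R / 2 + 1).
Proof.
elim: k => [|k IH]; first by rewrite pochhammer0 mul1r.
have -> : (2 * k.+1 + a = (2 * k + a).+2)%N by lia.
rewrite Gamma_half_rec IH pochhammerS (natrD _ (2 * k)) natrM.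
by field.
Qed.

Lemma Gamma_duplication {R : realType} b :
  2 ^+ b.+1 * Gamma (b.+1%:R / 2 + 1 : R) * Gamma (b%:R / 2 + 1) = Num.sqrt pi * b.+1`!%:R.
Proof.
elim: b => [|b IH].
  by rewrite Gamma_three_half mul0r add0r Gamma1 !factS fact0; field.
rewrite exprS Gamma_half_rec factS natrM.
apply: (lincomb (lcM b.+2%:R IH)).
by rewrite -[b.+2%:R]natr1 -[b.+1%:R]natr1; field.
Qed.

(** With kernels normalised by the area of the sphere, the coefficients of the addition theorem are
    exactly [Omega]; the duplication formula reconciles the powers of 2 and of pi. *)
Lemma Omega_addition {R : realType} (d j b l : nat) (th th' : nat -> R) (t : R) :
  (d - j - 1 = b.+1)%N ->
  zonal b.+1 l (cos (th j) * cos (th' j) + sin (th j) * sin (th' j) * t)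
  = \sum_(0 <= k < l.+1) Omega d th th' j l k * zonal b k t.
Proof.
move=> hd; set w := sin (th j) * sin (th' j).
pose lam : R := b.+1%:R / 2.
have bb := ler0n R b.
have l0 : 0 < lam by rewrite /lam -[b.+1%:R]natr1; lra.
have hw : w ^+ 2 = (1 - cos (th j) ^+ 2) * (1 - cos (th' j) ^+ 2).
  by rewrite -!sin2cos2 exprMn.
have lb : lam - 1 / 2 = b%:R / 2 by rewrite /lam -[b.+1%:R]natr1; field.
have l12 : 1 / 2 <= lam by rewrite /lam -[b.+1%:R]natr1; lra.
have := gegen_addition lam w (cos (th j)) (cos (th' j)) t l l12 hw.
have := gegE_gegz l%:Z lam (cos (th j) * cos (th' j) + w * t).
rewrite lb => e1 e2; rewrite e2 -pmulrn in e1.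
have -> : zonal b.+1 l (cos (th j) * cos (th' j) + w * t) =
   zonal_const b.+1 * ((l%:R + lam) / lam * \sum_(0 <= k < l.+1) addterm lam w (cos (th j)) (cos (th' j)) l k * gegE k (b%:R / 2) t).
  rewrite /zonal -/lam; congr (_ * _).
  have ln : lam != 0 by rewrite gt_eqF.
  by apply: (mulfI ln); rewrite -e1; field.
rewrite !big_distrr /=; apply: eq_big_nat => k hk.
rewrite /zonal; set F := gegE k _ t; rewrite !mulrA; congr (_ * _).
rewrite /addterm ifT; last by lia.
rewrite /Omega /Theta.
have -> : k%:R + (d - j + 1)%:R / 2 = (2 * k + b.+1)%:R / 2 + 1 :> R.
  have -> : (d - j + 1 = b.+3)%N by lia.
  by rewrite (natrD _ (2 * k)) natrM -[b.+3%:R]natr1 -[b.+2%:R]natr1; field.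
have -> : (d - j - 2 = b)%N by lia.
have -> : k%:R + (d - j - 1)%:R / 2 = lam + k%:R by rewrite hd addrC.
rewrite hd /gegz.
set X := 2 ^+ _ * _ * _ / _.
have X0 : 0 <= X by rewrite divr_ge0 ?mulr_ge0 ?exprn_ge0 // pi_ge0.
have sX : Num.sqrt X * Num.sqrt X = X by rewrite -expr2 sqr_sqrtr.
set G1 := (gegenbauer _ _).[_]; set G2 := (gegenbauer _ _).[_].
rewrite Gamma_half_poch.
set GG := Gamma _; set P := pochhammer _ k.
transitivity ((P * GG / (2 * k + b.+1)%:R) ^+ 2 * X * w ^+ k * G1 * G2 * zonal_const b); last first.
  move: sX; set S := Num.sqrt X => <-; by rewrite /w (exprMn k) /zonal_const; ring.
rewrite /X /addcoef.
have P0 : P = pochhammer lam k * (lam + k%:R) / lam.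
  apply: (mulfI (x := lam)); first by rewrite gt_eqF.
  by rewrite /P pochhammerSl pochhammerS; field; rewrite gt_eqF.
have -> : pochhammer (2 * lam) (2 * k + (l - k)) = (b + l + k)`!%:R / b`!%:R.
  have -> : 2 * lam = b.+1%:R by rewrite /lam; field.
  have -> : (2 * k + (l - k) = l + k)%N by lia.
  by rewrite -addnA -pochhammer_nat mulfK // fact_neq0.
have -> : (l + k + b = b + l + k)%N by lia.
have -> : (2 * k + b.+1)%:R = 2 * (lam + k%:R) :> R.
  by rewrite (natrD _ (2 * k)) natrM /lam; field.
have -> : (2 * l + b.+1)%:R = 2 * (lam + l%:R) :> R.
  by rewrite (natrD _ (2 * l)) natrM /lam; field.
have dup := @Gamma_duplication R b.
rewrite /zonal_const -/GG; move: dup; rewrite -/GG; set GB := Gamma _ => dup.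
have s0 : Num.sqrt pi != 0 :> R by rewrite gt_eqF // sqrtr_gt0 pi_gt0.
have s2 : (pi : R) = Num.sqrt pi ^+ 2 by rewrite sqr_sqrtr // pi_ge0.
have GBn : GB != 0 by rewrite gt_eqF // Gamma_half_gt0.
have GGn : GG != 0 by rewrite gt_eqF // Gamma_half_gt0.
have GE : 2 ^+ b.+1 = Num.sqrt pi * (2 * lam * b`!%:R) / (GG * GB).
  have -> : 2 * lam = b.+1%:R by rewrite /lam; field.
  rewrite -natrM -factS -dup; by field; rewrite GBn GGn.
rewrite P0 (exprD _ (2 * k)) GE exprM s2 sqrtr_sqr ger0_norm ?sqrtr_ge0 //.
rewrite (_ : 2 ^+ 2 = 4); last by ring.
rewrite (exprS (Num.sqrt pi) b).
have sb : Num.sqrt pi ^+ b != 0 :> R by rewrite expf_neq0.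
have kk := ler0n R k.
by field; rewrite !fact_neq0 sb s0 GBn GGn; nzlra.
Qed.

Lemma gegz_half_one {R : realType} n : gegz n%:Z (1 / 2 : R) 1 = 1.
Proof.
elim/ind2: n => [|  |n IH0 IH1]; first by rewrite gegz0.
  by rewrite gegz1; field.
have := gegz_rec (1 / 2 : R) 1 n.+1%:Z.
have -> : n.+1%:Z + 1 = n.+2%:Z by lia.
have -> : n.+1%:Z - 1 = n%:Z by lia.
rewrite IH0 IH1 -pmulrn => h.
apply: (mulfI (x := n.+2%:R)); first by rewrite pnatr_eq0.
by apply: (lincomb (lcM (-1) h)); rewrite -[n.+2%:R]natr1; field.
Qed.

Lemma gegE_gegz_gt0 {R : realType} (mu : R) : 0 <= mu ->
  (forall n : nat, 0 < gegE n%:Z mu 1) -> forall n : nat, 0 < gegz n%:Z (mu + 1) 1.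
Proof.
move=> mu0 h; elim/ind2 => [|  |n IH0 IH1]; first by rewrite gegz0.
  by rewrite gegz1 mulr1 mulr_gt0 // ltr_wpDl.
have -> : gegz n.+2%:Z (mu + 1) 1 = gegE n.+2%:Z mu 1 + gegz n%:Z (mu + 1) 1.
  by rewrite /gegE (_ : n.+2%:Z - 2 = n%:Z) ?subrK //; lia.
by rewrite addr_gt0.
Qed.

Lemma gegz_gegE_gt0 {R : realType} (mu : R) : 0 < mu ->
  (forall n : nat, 0 < gegz n%:Z mu 1) -> forall n : nat, 0 < gegE n%:Z mu 1.
Proof.
move=> mu0 h n; have e := gegE_gegz n%:Z mu 1.
by rewrite -(pmulr_rgt0 _ mu0) -e -pmulrn mulr_gt0 // ltr_wpDl.
Qed.

(** From cosines (a = 0) and Legendre polynomials (a = 1) upwards in steps of two: a Gegenbauer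
    value of index mu + 1 is a sum of values of [gegE] of index mu. *)
Lemma gegE_gt0 {R : realType} a (n : nat) : 0 < gegE n%:Z (a%:R / 2 : R) 1.
Proof.
elim/ind2: a n => [|  |a IH _] n.
- rewrite mul0r -[X in gegE _ _ X]cos0 gegE_cos mulr0 cos0 mulr1.
  by case: ifP.
- apply: gegz_gegE_gt0 => [|k]; first by rewrite mul1r invr_gt0.
  by rewrite gegz_half_one.
- have -> : a.+2%:R / 2 = a%:R / 2 + 1 :> R.
    by rewrite -[a.+2%:R]natr1 -[a.+1%:R]natr1; field.
  apply: gegz_gegE_gt0; first by rewrite ltr_wpDl.
  by apply: gegE_gegz_gt0.
Qed.

Lemma zonal_gt0 {R : realType} a l : 0 < zonal a l 1 :> R.
Proof. by rewrite mulr_gt0 ?zonal_const_gt0 ?gegE_gt0. Qed.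

(** A product of one factor in theta and one in theta' is at most the mean of their squares. These
    squares are diagonal values of [Omega], and at coincident points the addition theorem evaluates
    their sum, as cos^2 + sin^2 = 1. *)
Lemma Omega_abs {R : realType} (d j b l : nat) (th th' : nat -> R) :
  (d - j - 1 = b.+1)%N ->
  \sum_(0 <= k < l.+1) `|Omega d th th' j l k| * zonal b k 1 <= zonal b.+1 l 1.
Proof.
move=> hd.
have diag (f : nat -> R) : \sum_(0 <= k < l.+1) Omega d f f j l k * zonal b k 1 = zonal b.+1 l 1.
  by rewrite -Omega_addition // mulr1 -!expr2 cos2Dsin2.
have -> : zonal b.+1 l 1 = \sum_(0 <= k < l.+1)
   ((Omega d th th j l k + Omega d th' th' j l k) / 2 * zonal b k 1).
  under eq_bigr => k _ do rewrite mulrAC mulrDl.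
  by rewrite -big_distrl big_split /= !diag; field.
apply: ler_sum => k _; rewrite ler_pM2r ?zonal_gt0 // /Omega normrM.
set x := Theta _ _ _ _ _; set y := Theta _ _ _ _ _.
rewrite -subr_ge0 -[x * x]real_normK ?num_real // -[y * y]real_normK ?num_real //.
rewrite (_ : _ - _ = (`|x| - `|y|) ^+ 2 / 2); last by field.
by rewrite divr_ge0 // sqr_ge0.
Qed.

(** * Iterated sums as single sums over chains of indices *)

Lemma is_sum_finite {R : realType} (a : nat -> R) N :
  (forall n, (N <= n)%N -> a n = 0) -> is_sum a (\sum_(0 <= n < N) a n).
Proof.
move=> h; rewrite /is_sum.
have c : ((fun=> \sum_(0 <= n < N) a n) @ \oo --> \sum_(0 <= n < N) a n)%classic.
  exact: cvg_cst.
apply: cvg_trans c; apply: near_eq_cvg.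
near=> n; have hn : (N <= n)%N by near: n; exact: nbhs_infty_ge.
symmetry; rewrite /series /= (big_cat_nat (leq0n _) hn) /= [X in _ + X]big_nat.
by rewrite [X in _ + X]big1 ?addr0 // => k /andP[hk _]; exact: h.
Unshelve. all: by end_near.
Qed.

Lemma is_sum_abs_le {R : realType} (a b : nat -> R) s t :
  is_sum a s -> is_sum b t -> (forall n, `|a n| <= b n) -> `|s| <= t.
Proof.
move=> ha hb h; rewrite -subr_le0.
have cd : ((fun n => `|series a n| - series b n) @ \oo --> `|s| - t)%classic.
  by apply: cvgB; [apply: cvg_norm; exact: ha | exact: hb].
rewrite -(cvg_lim _ cd) //; apply: limr_le; first by apply/cvg_ex; exists (`|s| - t).
near=> n; rewrite subr_le0; apply: (le_trans (ler_norm_sum _ _ _)).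
by apply: ler_sum.
Unshelve. all: by end_near.
Qed.

Lemma is_sum_big {R : realType} (a : nat -> nat -> R) (s : nat -> R) N :
  (forall k, (k < N)%N -> is_sum (a^~ k) (s k)) ->
  is_sum (fun l => \sum_(0 <= k < N) a l k) (\sum_(0 <= k < N) s k).
Proof.
elim: N => [|N IH] h.
  have h0 := is_sum_finite (fun=> 0 : R) 0 (fun _ _ => erefl).
  rewrite big_nil in h0; rewrite big_nil; apply: (eq_is_sum _ _ _ _ h0) => n.
  by rewrite big_nil.
rewrite big_nat_recr //=.
have h1 := is_sumD _ _ _ _ (IH (fun k hk => h k (ltnW hk))) (h N (ltnSn N)).
by apply: (eq_is_sum _ _ _ _ h1) => n; rewrite big_nat_recr.
Qed.

(** The first N columns contain the first N rows completely, so after N columns the error is at most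
    the tail of the absolute row sums. *)
Lemma triangular_sums {R : realType} (a : nat -> nat -> R) :
  (forall l k, (l < k)%N -> a l k = 0) ->
  abs_summable (fun l => \sum_(0 <= k < l.+1) `|a l k|) ->
  is_sum (fun k => limn (series (a^~ k)))
    (limn (series (fun l => \sum_(0 <= k < l.+1) a l k))).
Proof.
move=> a0 hs; set r := fun l => \sum_(0 <= k < l.+1) `|a l k|.
set s := limn (series _); set col := fun k => limn _.
have r0 l : 0 <= r l by apply: sumr_ge0.
have hr := is_sum_lim _ hs; rewrite -/r in hr; set T := limn _ in hr.
have rows : is_sum (fun l => \sum_(0 <= k < l.+1) a l k) s.
  apply: is_sum_lim; apply: le_abs_summable hs => l.
  exact: ler_norm_sum.
have cols k : is_sum (a^~ k) (col k).
  apply: is_sum_lim; apply: le_abs_summable hs => l.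
  have [h|h] := leqP k l; last by rewrite a0 // normr0; exact: r0.
  rewrite big_mkord (bigD1 (Ordinal (h : (k < l.+1)%N))) //= lerDl.
  exact: sumr_ge0.
have bound N : `|\sum_(0 <= k < N) col k - s| <= T - \sum_(0 <= l < N) r l.
  have h1 := is_sumB _ _ _ _ (is_sum_big a col N (fun k _ => cols k)) rows.
  have h2 : is_sum (fun l => if (l < N)%N then r l else 0) (\sum_(0 <= l < N) r l).
    rewrite (_ : \sum_(0 <= l < N) r l = \sum_(0 <= l < N) if (l < N)%N then r l else 0).
      by apply: is_sum_finite => n; rewrite ltnNge => ->.
    by apply: eq_big_nat => l /andP[_ ->].
  apply: is_sum_abs_le h1 (is_sumB _ _ _ _ hr h2) _ => l.
  have [h|h] := ltnP l N.
    rewrite (big_cat_nat (leq0n _) (h : (l.+1 <= N)%N)) /= addrAC subrr add0r subrr.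
    by rewrite big_nat big1 ?normr0 // => k /andP[hk _]; rewrite a0.
  rewrite subr0 [X in _ - X](big_cat_nat (leq0n _) (leqW h)) /= opprD addrA subrr sub0r normrN.
  rewrite /r (big_cat_nat (leq0n _) (leqW h)) /=.
  apply: (le_trans (ler_norm_sum _ _ _)).
  by rewrite lerDr sumr_ge0.
rewrite /is_sum -/s; apply/cvgrPdist_le => e e0.
have hT : (series r @ \oo --> T)%classic by exact: hr.
have /cvgrPdist_le/(_ e e0) := hT; apply: filterS => N hN.
rewrite distrC; apply: (le_trans (bound N)); apply: le_trans hN.
exact: ler_norm.
Qed.

(* total weight of the index chains l = k_0 >= k_1 >= ... >= k_n = l' *)
Fixpoint pathw {R : realType} (Om : nat -> nat -> nat -> R) (n l l' : nat) : R :=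
  if n is n'.+1 then \sum_(0 <= k < l.+1)
    (if (l' <= k)%N then pathw Om n' l k * Om n k l' else 0)
  else (l == l')%:R.

Lemma pathw_small {R : realType} (Om : nat -> nat -> nat -> R) n l l' :
  (l < l')%N -> pathw Om n l l' = 0.
Proof.
case: n => [|n] h; first by rewrite /= ltn_eqF.
by rewrite /= big_nat big1 // => k hk; rewrite ifF //; lia.
Qed.

Lemma pathw_abs {R : realType} (Om : nat -> nat -> nat -> R) n l l' :
  `|pathw Om n l l'| <= pathw (fun j k k' => `|Om j k k'|) n l l'.
Proof.
elim: n l' => [|n IH] l'; first by rewrite /= normr_nat.
rewrite /=; apply: (le_trans (ler_norm_sum _ _ _)); apply: ler_sum => k _.
by case: ifP => _; rewrite ?normr0 // normrM ler_wpM2r.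
Qed.

Lemma pathw1 {R : realType} (Om : nat -> nat -> nat -> R) l l' :
  pathw Om 1 l l' = if (l' <= l)%N then Om 1%N l l' else 0.
Proof.
rewrite /= big_nat_recr //= eqxx mul1r big_nat big1 ?add0r // => k hk.
by rewrite gtn_eqF ?mul0r ?if_same //; case/andP: hk.
Qed.

Lemma sum_from {V : nmodType} (F : nat -> V) lo N :
  \sum_(lo <= l < N) F l = \sum_(0 <= l < N) (if (lo <= l)%N then F l else 0).
Proof.
have [h|h] := leqP lo N.
  rewrite [RHS](big_cat_nat (leq0n _) h) /= [X in _ = X + _]big_nat.
  rewrite [X in _ = X + _]big1 ?add0r => [|k hk]; last by rewrite ifF //; lia.
  by apply: eq_big_nat => k /andP[-> _].
rewrite big_geq ?(ltnW h) // big_nat big1 // => k hk; rewrite ifF //; lia.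
Qed.

Lemma mul_realC_im {R : realType} (x y : R) : x%:C * (0 +i* y) = 0 +i* (x * y).
Proof. by apply/eqP; rewrite eq_complex /= !(mul0r, mulr0, subr0, addr0) !eqxx. Qed.

Lemma sum_im {R : realType} (f : nat -> R) a b :
  \sum_(a <= l < b) (0 +i* f l) = 0 +i* \sum_(a <= l < b) f l :> R[i].
Proof.
apply: (big_ind2 (fun (x : R[i]) y => x = 0 +i* y)) => // x y x' y' -> ->.
by apply/eqP; rewrite eq_complex /= addr0 !eqxx.
Qed.

(** Exchanging the sums makes the innermost index the outer one; [pathw] gathers the contributions
    of all the others. *)
Lemma nested_sum_im {R : realType} (Om : nat -> nat -> nat -> R) (f : nat -> R) p n l' :
  (l' <= p)%N ->
  nested_sum Om (fun l => 0 +i* f l) p n l'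
  = 0 +i* \sum_(0 <= l < p.+1) f l * pathw Om n l l'.
Proof.
elim: n l' => [|n IH] l' h.
  rewrite /= big_mkord (bigD1 (Ordinal (h : (l' < p.+1)%N))) //= eqxx mulr1 big1 ?addr0 //.
  by move=> k; rewrite -val_eqE /= => /negbTE ->; rewrite mulr0.
rewrite /=; under eq_big_nat => l hl.
  rewrite IH ?mul_realC_im; last by lia.
  over.
rewrite sum_im; congr (0 +i* _).
rewrite sum_from.
transitivity (\sum_(0 <= k < p.+1) \sum_(0 <= l < p.+1)
    (if (l' <= k)%N then f l * (pathw Om n l k * Om n.+1 k l') else 0)).
  apply: eq_bigr => k _; case: ifP => _; last by rewrite big1.
  by rewrite big_distrr /=; apply: eq_bigr => l _; ring.
rewrite exchange_big_nat /=; apply: eq_big_nat => l hl.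
rewrite (big_cat_nat (leq0n _) (_ : l.+1 <= p.+1)%N) /=; last by lia.
rewrite [X in _ + X]big_nat [X in _ + X]big1 ?addr0; last first.
  by move=> k hk; rewrite pathw_small ?mul0r ?mulr0 ?if_same //; lia.
rewrite big_distrr /=; apply: eq_bigr => k _.
by case: ifP => _ //; rewrite mulr0.
Qed.

Lemma cvg_im {R : realType} (u : nat -> R) (s : R) : (u @ \oo --> s)%classic ->
  ((fun N => 0 +i* u N : R[i]^o) @ \oo --> (0 +i* s : R[i]^o))%classic.
Proof.
move=> /cvgrPdist_lt h; apply/cvgrPdist_lt => e e0.
have [e1 e2] : 0 < complex.Re e /\ e = (complex.Re e)%:C.
  by case: e e0 => a b; rewrite ltcE /= => /andP[/eqP -> ->].
have := h _ e1; apply: filterS => N hN.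
rewrite e2 (_ : _ - _ = 0 +i* (s - u N)); last first.
  by apply/eqP; rewrite eq_complex /= subrr !eqxx.
rewrite normc_def /= ltcR expr0n /= add0r sqrtr_sqr.
exact: hN.
Qed.

Lemma limn_im {R : realType} (u : nat -> R) (s : R) (v : nat -> R[i]^o) :
  (forall N, v N = 0 +i* u N) -> (u @ \oo --> s)%classic ->
  cvgn v /\ limn v = 0 +i* s.
Proof.
move=> hv hu; have -> : v = (fun N => 0 +i* u N) by apply/funext.
have c := cvg_im _ _ hu; split; first by apply/cvg_ex; eexists; exact: c.
by apply: cvg_lim => //; exact: norm_hausdorff.
Qed.

Arguments pathw : simpl never.

Lemma pathwS {R : realType} (Om : nat -> nat -> nat -> R) n l l' :
  pathw Om n.+1 l l' = \sum_(0 <= k < l.+1)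
    (if (l' <= k)%N then pathw Om n l k * Om n.+1 k l' else 0).
Proof. by []. Qed.

(** The infinite analogue, with [triangular_sums] at each level. Setting g to 0 up to p encodes the
    lower limit max (p + 1) l_2 of the innermost sum; the claim starts at level 1 since level 0 does
    not see that limit. *)
Lemma nested_series_im {R : realType} (Om : nat -> nat -> nat -> R) (t : nat -> R)
    (p N : nat) (lo : nat -> nat -> nat) :
  (forall j l', lo j l' = if j == 1%N then maxn p.+1 l' else l') ->
  let g l := if (l <= p)%N then 0 else t l in
  (forall n l', (n <= N)%N ->
    abs_summable (fun l => g l * pathw (fun j k k' => `|Om j k k'|) n l l')) ->
  forall n l', (n.+1 <= N)%N ->
  nested_series_cvg lo Om (fun l => 0 +i* t l) n.+1 l' /\
  nested_series lo Om (fun l => 0 +i* t l) n.+1 l'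
  = 0 +i* limn (series (fun l => g l * pathw Om n.+1 l l')).
Proof.
move=> hlo g hs.
have hs' n l' : (n <= N)%N -> is_sum (fun l => g l * pathw Om n l l')
    (limn (series (fun l => g l * pathw Om n l l'))).
  move=> hn; apply: is_sum_lim; have [B hB] := hs n l' hn; exists B => M.
  apply: le_trans (hB M); apply: ler_sum => l _; rewrite !normrM ler_wpM2l //.
  by apply: (le_trans (pathw_abs _ _ _ _)); exact: ler_norm.
elim=> [|n IH] l' hn.
  have := limn_im (series (fun l => g l * pathw Om 1 l l')) _ (fun M : nat =>
     (\sum_(lo 1%N l' <= l < M) (Om 1%N l l')%:C * (0 +i* t l)) : R[i]^o) _ (hs' 1%N l' hn).
  case.
    move=> M; under eq_bigr do rewrite mul_realC_im.
    rewrite sum_im sum_from /series /=; congr (0 +i* _); apply: eq_bigr => l _.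
    rewrite hlo /= -/(pathw Om 1 l l') pathw1 /g geq_max ltnNge.
    by case: (leqP l p) => /= h1; case: leqP => h2; rewrite ?mul0r ?mulr0 // mulrC.
  move=> c e; split; first by split.
  exact: e.
(* The column sums are the terms of the outermost series, the row sums those of the single
   series. *)
set a := fun l k => if (l' <= k)%N then g l * pathw Om n.+1 l k * Om n.+2 k l' else 0.
have a0 l k : (l < k)%N -> a l k = 0.
  by move=> h; rewrite /a pathw_small // mulr0 mul0r if_same.
have rowE l : \sum_(0 <= k < l.+1) a l k = g l * pathw Om n.+2 l l'.
  rewrite (pathwS Om n.+1) big_distrr /=; apply: eq_bigr => k _.
  by rewrite /a; case: ifP => _; rewrite ?mulr0 ?mulrA.
have as_ : abs_summable (fun l => \sum_(0 <= k < l.+1) `|a l k|).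
  apply: le_abs_summable (_ : abs_summable (fun l => `|g l * pathw (fun j k k' => `|Om j k k'|) n.+2 l l'|)).
    move=> l; rewrite ger0_norm ?sumr_ge0 // normrM.
    rewrite (ger0_norm (le_trans (normr_ge0 _) (pathw_abs Om n.+2 l l'))).
    rewrite (pathwS _ n.+1) big_distrr /=; apply: ler_sum => k _.
    rewrite /a; case: ifP => _; last by rewrite normr0 mulr0.
    rewrite !normrM -mulrA ler_wpM2l // ler_wpM2r //.
    exact: pathw_abs.
  have [B hB] := hs n.+2 l' hn; exists B => M; apply: le_trans (hB M).
  by apply: ler_sum => l _; rewrite normr_id.
have T := triangular_sums a a0 as_.
have colE k : limn (series (a^~ k)) = if (l' <= k)%N then Om n.+2 k l' * limn (series (fun l => g l * pathw Om n.+1 l k)) else 0.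
  apply: limn_is_sum; rewrite /a; case: ifP => h.
    apply: eq_is_sum (is_sumZ (Om n.+2 k l') _ _ (hs' n.+1 k (ltnW hn))) => l.
    by ring.
  have h0 := is_sum_finite (fun=> 0 : R) 0 (fun _ _ => erefl).
  by rewrite big_nil in h0.
have := limn_im _ _ (fun M : nat =>
     (\sum_(lo n.+2 l' <= l < M) (Om n.+2 l l')%:C * nested_series lo Om (fun l => 0 +i* t l) n.+1 l) : R[i]^o) _ T.
case.
  move=> M; under eq_bigr => k _ do rewrite (proj2 (IH k (ltnW hn))) mul_realC_im.
  rewrite sum_im sum_from hlo /series /=; congr (0 +i* _); apply: eq_bigr => k _.
  by rewrite colE.
move=> c e; split.
  split; last exact: c.
  by move=> l _; have [] := IH l (ltnW hn).
rewrite [LHS]e; congr (0 +i* limn (series _)).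
by apply/funext => l; rewrite rowE.
Qed.

(* the cosine of the angle between two points, as a function of the cosine t of
   the angle between their projections obtained by dropping n coordinates *)
Fixpoint chain_cos {R : realType} (th th' : nat -> R) (n : nat) (t : R) : R :=
  if n is n'.+1 then
    chain_cos th th' n' (cos (th n) * cos (th' n) + sin (th n) * sin (th' n) * t)
  else t.

Lemma triangular_exchange {R : realType} (F : nat -> nat -> R) l :
  \sum_(0 <= k < l.+1) \sum_(0 <= k' < k.+1) F k k'
  = \sum_(0 <= k' < l.+1) \sum_(0 <= k < l.+1) (if (k' <= k)%N then F k k' else 0).
Proof.
rewrite exchange_big_nat /=; apply: eq_big_nat => k hk.
rewrite [RHS](big_cat_nat (leq0n _) (_ : k.+1 <= l.+1)%N) /=; last by lia.
rewrite [X in _ = _ + X]big_nat [X in _ = _ + X]big1 ?addr0; last first.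
  by move=> k' hk'; rewrite ifF //; lia.
by apply: eq_big_nat => k' hk'; rewrite ifT //; lia.
Qed.

(** [Omega_addition] iterated, each step lowering the dimension of the sphere by one. *)
Lemma chain_zonal {R : realType} (d n l : nat) (th th' : nat -> R) (t : R) :
  (n <= d - 2)%N ->
  zonal (d - 2) l (chain_cos th th' n t)
  = \sum_(0 <= k < l.+1) pathw (Omega d th th') n l k * zonal (d - 2 - n) k t.
Proof.
elim: n t => [|n IH] t hn.
  rewrite subn0 big_nat_recr //= /pathw eqxx mul1r big_nat big1 ?add0r // => k hk.
  by rewrite gtn_eqF ?mul0r //; case/andP: hk.
rewrite [chain_cos _ _ _ _]/= IH ?(ltnW hn) //.
have [b hb] : exists b, (d - 2 - n = b.+1)%N by exists (d - 2 - n).-1; lia.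
have -> : (d - 2 - n.+1 = b)%N by lia.
rewrite hb; under eq_bigr => k _.
  rewrite (Omega_addition d n.+1 b); last by lia.
  rewrite big_distrr /=.
  over.
rewrite triangular_exchange; apply: eq_bigr => k _.
rewrite pathwS big_distrl /=; apply: eq_bigr => k' _.
by case: ifP => _; rewrite ?mul0r // mulrA.
Qed.

Lemma chain_abs {R : realType} (d n l : nat) (th th' : nat -> R) :
  (n <= d - 2)%N ->
  \sum_(0 <= k < l.+1) pathw (fun j k k' => `|Omega d th th' j k k'|) n l k * zonal (d - 2 - n) k 1
  <= zonal (d - 2) l 1.
Proof.
elim: n => [|n IH] hn.
  rewrite subn0 big_nat_recr //= /pathw eqxx mul1r big_nat big1 ?add0r // => k hk.
  by rewrite gtn_eqF ?mul0r //; case/andP: hk.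
apply: le_trans (IH (ltnW hn)).
have [b hb] : exists b, (d - 2 - n = b.+1)%N by exists (d - 2 - n).-1; lia.
have -> : (d - 2 - n.+1 = b)%N by lia.
rewrite hb; set Om := (fun j k k' : nat => `|Omega d th th' j k k'|).
have h k : pathw Om n l k * \sum_(0 <= k' < k.+1) `|Omega d th th' n.+1 k k'| * zonal b k' 1
    <= pathw Om n l k * zonal b.+1 k 1.
  apply: ler_wpM2l; last by apply: Omega_abs; lia.
  exact: le_trans (normr_ge0 _) (pathw_abs (Omega d th th') n l k).
apply: le_trans (ler_sum _ (fun k _ => h k)).
under [leRHS]eq_bigr do rewrite big_distrr /=.
rewrite triangular_exchange le_eqVlt; apply/orP; left; apply/eqP; apply: eq_bigr => k _.
rewrite pathwS big_distrl /=; apply: eq_bigr => k' _.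
by case: ifP => _; [rewrite -mulrA | rewrite mul0r].
Qed.

(** A single term of the nonnegative sum in [chain_abs]. This bound on the weights is what makes the
    series converge. *)
Lemma pathw_le_zonal {R : realType} (d n l k : nat) (th th' : nat -> R) :
  (n <= d - 2)%N ->
  `|pathw (fun j k k' => `|Omega d th th' j k k'|) n l k|
  <= (zonal (d - 2 - n) k 1)^-1 * zonal (d - 2) l 1.
Proof.
move=> hn; set Om := (fun j k k' : nat => `|Omega d th th' j k k'|).
have p0 k' : 0 <= pathw Om n l k'.
  exact: le_trans (normr_ge0 _) (pathw_abs (Omega d th th') n l k').
rewrite ger0_norm // mulrC ler_pdivlMr ?zonal_gt0 //.
apply: le_trans (chain_abs d n l th th' hn).
have t0 k' : 0 <= pathw Om n l k' * zonal (d - 2 - n) k' 1.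
  by rewrite mulr_ge0 // ltW // zonal_gt0.
have [h|h] := leqP k l.
  rewrite big_mkord (bigD1 (Ordinal (h : (k < l.+1)%N))) //= lerDl.
  by apply: sumr_ge0 => k' _; exact: t0.
by rewrite {1}/Om pathw_small // mul0r sumr_ge0.
Qed.

(** * Geometry of polyspherical coordinates *)

Lemma chain_cos_bound {R : realType} (th th' : nat -> R) n (t : R) :
  -1 <= t <= 1 -> -1 <= chain_cos th th' n t <= 1.
Proof.
elim: n t => [//|n IH] t ht; apply: IH.
rewrite -ler_norml in ht; rewrite -ler_norml.
set c := cos _; set c' := cos _; set s := sin _; set s' := sin _.
have e : c ^+ 2 + s ^+ 2 = 1 by exact: cos2Dsin2.
have e' : c' ^+ 2 + s' ^+ 2 = 1 by exact: cos2Dsin2.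
apply: (le_trans (ler_normD _ _)); rewrite !normrM.
have h : `|s| * `|s'| * `|t| <= `|s| * `|s'| by rewrite ler_piMr // mulr_ge0.
move: e e'; rewrite -[c ^+ 2]real_normK ?num_real // -[s ^+ 2]real_normK ?num_real //.
rewrite -[c' ^+ 2]real_normK ?num_real // -[s' ^+ 2]real_normK ?num_real //.
have := sqr_ge0 (`|c| - `|c'|); have := sqr_ge0 (`|s| - `|s'|).
by nra.
Qed.

(** For n = d - 2 the last product is R R' t, so the right-hand side is the inner product of two
    points whose last two coordinates enclose an angle of cosine t. *)
Lemma chain_cos_coord {R : realType} (d n : nat) (r r' ph ph' : R) (th th' : nat -> R) t :
  (n <= d - 2)%N ->
  r * r' * chain_cos th th' n t
  = \sum_(1 <= j < n.+1) polycoord d r th ph j * polycoord d r' th' ph' j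
    + (r * \prod_(1 <= k < n.+1) sin (th k)) * (r' * \prod_(1 <= k < n.+1) sin (th' k)) * t.
Proof.
elim: n t => [|n IH] t hn; first by rewrite !big_geq //=; ring.
rewrite [chain_cos _ _ _ _]/= IH ?(ltnW hn) // [in RHS]big_nat_recr //=.
rewrite ![in RHS](big_nat_recr n.+1) //=.
have e a b c : polycoord d a b c n.+1 = a * (\prod_(1 <= k < n.+1) sin (b k)) * cos (b n.+1) :> R.
  by rewrite /polycoord hn.
by rewrite !e; ring.
Qed.

Lemma polycoord_norm {R : realType} (d n : nat) (r ph : R) (th : nat -> R) :
  (n <= d - 2)%N ->
  r ^+ 2 = \sum_(1 <= j < n.+1) polycoord d r th ph j ^+ 2
    + (r * \prod_(1 <= k < n.+1) sin (th k)) ^+ 2.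
Proof.
elim: n => [|n IH] hn; first by rewrite !big_geq //=; ring.
rewrite IH ?(ltnW hn) // [in RHS]big_nat_recr //= ![in RHS](big_nat_recr n.+1) //=.
have -> : polycoord d r th ph n.+1 = r * (\prod_(1 <= k < n.+1) sin (th k)) * cos (th n.+1).
  by rewrite /polycoord hn.
have e := cos2Dsin2 (th n.+1).
apply: (lincomb (lcM (- (r * \prod_(1 <= k < n.+1) sin (th k)) ^+ 2) e)).
by ring.
Qed.

(** For |t| <= 1 both sides are the squared distance of two points with the given radii and polar
    angles whose azimuths differ by an angle of cosine t. *)
Lemma chi_chain {R : realType} (d : nat) (x x' : 'rV[R]_d)
    (r r' : R) (th th' : nat -> R) (ph ph' t : R) :
  (2 <= d)%N ->
  polyspherical x r th ph -> polyspherical x' r' th' ph' ->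
  0 < r -> 0 < r' -> 0 < cylradius d r th -> 0 < cylradius d r' th' ->
  cylradius d r th * cylradius d r' th' *
    (2 * chi x x' (cylradius d r th) (cylradius d r' th') - 2 * t)
  = r * r' * (2 * zeta r r' - 2 * chain_cos th th' (d - 2) t).
Proof.
move=> hd [_ _ _ hx] [_ _ _ hx'] r0 r0' R0 R0'.
have e1 := polycoord_norm d (d - 2) r ph th (leqnn _).
have e2 := polycoord_norm d (d - 2) r' ph' th' (leqnn _).
have e3 := chain_cos_coord d (d - 2) r r' ph ph' th th' t (leqnn _).
have hd1 : (d - 2).+1 = (d - 1)%N by lia.
move: e1 e2 e3; rewrite hd1 -!/(cylradius _ _ _).
rewrite /chi /zeta; set rho := cylradius d r th; set rho' := cylradius d r' th'.
have -> : \sum_(i < d | (i < d - 2)%N) (x 0 i - x' 0 i) ^+ 2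
  = \sum_(1 <= j < d - 1) (polycoord d r th ph j - polycoord d r' th' ph' j) ^+ 2.
  rewrite big_add1 /=.
  have -> : (d - 1).-1 = (d - 2)%N by lia.
  rewrite big_mkord (big_ord_widen_cond _ xpredT (fun i => (polycoord d r th ph i.+1 - polycoord d r' th' ph' i.+1) ^+ 2) (leq_subr 2 d)) /=.
  by apply: eq_bigr => i _; rewrite hx hx' !mxE.
move=> e1 e2 e3.
have -> : \sum_(1 <= j < d - 1) (polycoord d r th ph j - polycoord d r' th' ph' j) ^+ 2
  = \sum_(1 <= j < d - 1) polycoord d r th ph j ^+ 2
   + \sum_(1 <= j < d - 1) polycoord d r' th' ph' j ^+ 2
   - 2 * \sum_(1 <= j < d - 1) polycoord d r th ph j * polycoord d r' th' ph' j.
  rewrite big_distrr -big_split -sumrB /=; apply: eq_bigr => j _; ring.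
apply: (lincomb (lcD (lcM (-1) e1) (lcD (lcM (-1) e2) (lcM 2 e3)))).
have r1 : r != 0 by rewrite gt_eqF.
have r2 : r' != 0 by rewrite gt_eqF.
have r3 : rho != 0 by rewrite gt_eqF.
have r4 : rho' != 0 by rewrite gt_eqF.
by field; rewrite r1 r2 r3 r4.
Qed.

(** * The cosine series of the logarithm *)

Definition poisson_den {R : realType} (g x : R) : R := 1 - 2 * x * cos g + x ^+ 2.

Lemma poisson_den_ge {R : realType} (g x : R) : 0 <= x -> (1 - x) ^+ 2 <= poisson_den g x.
Proof.
move=> x0; rewrite -subr_ge0 (_ : _ - _ = 2 * x * (1 - cos g)); last by rewrite /poisson_den; ring.
by rewrite !mulr_ge0 // subr_ge0 cos_le1.
Qed.

Lemma cos_geometric {R : realType} (g x : R) M :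
  poisson_den g x * \sum_(0 <= n < M) x ^+ n * cos (n.+1%:R * g)
  = cos g - x - x ^+ M * cos (M.+1%:R * g) + x ^+ M.+1 * cos (M%:R * g).
Proof.
elim: M => [|M IH]; first by rewrite big_nil mul0r cos0 expr0 mul1r expr1 mul1r; ring.
rewrite big_nat_recr //= mulrDr IH.
have -> : M.+2%:R * g = M.+1%:R * g + g by rewrite -[M.+2%:R]natr1; ring.
have -> : M%:R * g = M.+1%:R * g - g by rewrite -[M.+1%:R]natr1; ring.
by rewrite cosB cosD !exprS /poisson_den; ring.
Qed.

Lemma is_derive_cos_series {R : realType} (g x : R) M :
  is_derive x 1 (fun x : R => \sum_(0 <= n < M) (2 * cos (n.+1%:R * g) / n.+1%:R) * x ^+ n.+1)
    (2 * \sum_(0 <= n < M) x ^+ n * cos (n.+1%:R * g)).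
Proof.
elim: M => [|M IH].
  rewrite big_nil mulr0 (_ : (fun _ => _) = cst 0); first exact: is_derive_cst.
  by apply/funext => y; rewrite big_nil.
rewrite big_nat_recr //= (_ : (fun _ => _) = (fun x : R => \sum_(0 <= n < M) (2 * cos (n.+1%:R * g) / n.+1%:R) * x ^+ n.+1)
  \+ (fun x : R => (2 * cos (M.+1%:R * g) / M.+1%:R) * x ^+ M.+1)); last first.
  by apply/funext => y; rewrite big_nat_recr.
have h : is_derive x 1 (fun x : R => x ^+ M.+1) (M.+1%:R * x ^+ M).
  apply: DeriveDef; first exact: exprn_derivable.
  by rewrite exp_derive /GRing.scale /=; ring.
apply: is_derive_eq (is_deriveD IH (is_deriveZ (2 * cos (M.+1%:R * g) / M.+1%:R) h)) _.
have m0 : M.+1%:R != 0 :> R by rewrite pnatr_eq0.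
rewrite /GRing.scale /= mulrDr; congr (_ + _).
by move: (cos _) m0 => c; move: (M.+1%:R) => k k0; field.
Qed.

Lemma is_derive_ln_den {R : realType} (g x : R) : 0 < poisson_den g x ->
  is_derive x 1 (fun x => ln (poisson_den g x)) ((2 * x - 2 * cos g) / poisson_den g x).
Proof.
move=> h.
have d : is_derive x 1 (poisson_den g) (2 * x - 2 * cos g).
  rewrite /poisson_den (_ : (fun _ => _) = (cst 1 - (fun x : R => (2 * cos g) * x)) + (fun x : R => x ^+ 2)); last first.
    by apply/funext => y; rewrite /poisson_den !fctE; ring.
  have h2 : is_derive x 1 (fun x : R => x ^+ 2) (2 * x).
    apply: DeriveDef; first exact: exprn_derivable.
    by rewrite exp_derive /GRing.scale /=; ring.
  have h1 : is_derive x 1 (fun x : R => (2 * cos g) * x) (2 * cos g).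
    have h3 := is_deriveZ (2 * cos g) (is_derive_id x (1 : R)).
    by apply: is_derive_eq h3 _; rewrite /GRing.scale /= mulr1.
  have h0 : is_derive x (1 : R) (cst 1 : R -> R) 0 by exact: is_derive_cst.
  apply: is_derive_eq (is_deriveD (is_deriveB h0 h1) h2) _.
  by ring.
have := @is_derive1_comp R (@ln R) (poisson_den g) x _ _ (is_derive1_ln h) d.
by rewrite mulrC.
Qed.

(** As a function of x, the error after M terms vanishes at 0, and by [cos_geometric] its derivative
    is of the order of x^M. The mean value theorem turns this into a geometric bound. *)
Lemma poisson_log {R : realType} (g q : R) : 0 < q < 1 ->
  is_sum (fun n => (2 * cos (n.+1%:R * g) / n.+1%:R) * q ^+ n.+1) (- ln (poisson_den g q)).
Proof.
move=> /andP[q0 q1].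
have bound M : `|\sum_(0 <= n < M) (2 * cos (n.+1%:R * g) / n.+1%:R) * q ^+ n.+1
     - - ln (poisson_den g q)| <= 4 / (1 - q) ^+ 2 * q ^+ M.
  pose f x := \sum_(0 <= n < M) (2 * cos (n.+1%:R * g) / n.+1%:R) * x ^+ n.+1 + ln (poisson_den g x).
  pose df x := 2 * (\sum_(0 <= n < M) x ^+ n * cos (n.+1%:R * g)) + (2 * x - 2 * cos g) / poisson_den g x.
  have den0 x : 0 <= x -> x <= q -> (1 - q) ^+ 2 <= poisson_den g x.
    move=> x0 xq; apply: (le_trans _ (poisson_den_ge g x x0)).
    by rewrite ler_pXn2r ?nnegrE ?subr_ge0 ?lerB // ?(ltW q1) // (le_trans xq) // ltW.
  have q2 : 0 < (1 - q) ^+ 2 by rewrite exprn_gt0 // subr_gt0.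
  have dfE x : 0 <= x -> x <= q -> is_derive x 1 f (df x).
    move=> x0 xq; apply: is_deriveD; first exact: is_derive_cos_series.
    by apply: is_derive_ln_den; apply: lt_le_trans (den0 x x0 xq).
  have [c /andP[c0 cq] e] : exists2 c, c \in `]0, q[ & f q - f 0 = df c * (q - 0).
    apply: MVT => // [x|].
      by rewrite in_itv /= => /andP[a b]; apply: dfE; exact: ltW.
    apply: derivable_within_continuous => x; rewrite in_itv /= => /andP[a b].
    by have := dfE x a b.
  rewrite !bnd_simp in c0 cq.
  have f0 : f 0 = 0.
    rewrite /f /poisson_den big1 => [|n _]; last by rewrite expr0n mulr0.
    by rewrite expr0n /= !(mulr0, mul0r, subr0, addr0, add0r) ln1.
  rewrite opprK -/(f q); move: e; rewrite f0 !subr0 => ->.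
  have dc := lt_le_trans q2 (den0 c (ltW c0) (ltW cq)).
  have -> : df c = 2 * (c ^+ M.+1 * cos (M%:R * g) - c ^+ M * cos (M.+1%:R * g)) / poisson_den g c.
    have hc := cos_geometric g c M.
    have dn : poisson_den g c != 0 by rewrite gt_eqF.
    apply: (mulfI dn); rewrite /df.
    apply: (lincomb (lcM 2 hc)).
    by field.
  rewrite !normrM normfV (gtr0_norm dc) (gtr0_norm q0) (ger0_norm (ler0n _ 2)).
  have cM : c ^+ M <= q ^+ M by rewrite lerXn2r ?nnegrE ?ltW.
  have h1 : `|c ^+ M.+1 * cos (M%:R * g) - c ^+ M * cos (M.+1%:R * g)| <= 2 * q ^+ M.
    apply: (le_trans (ler_normB _ _)); rewrite !normrM !normrX (gtr0_norm c0).
    have a1 : `|cos (M%:R * g)| <= 1 by rewrite ler_norml cos_geN1 cos_le1.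
    have a2 : `|cos (M.+1%:R * g)| <= 1 by rewrite ler_norml cos_geN1 cos_le1.
    have b1 : c ^+ M * `|cos (M.+1%:R * g)| <= c ^+ M by rewrite ler_piMr // exprn_ge0 // ltW.
    have b2 : c ^+ M.+1 * `|cos (M%:R * g)| <= c ^+ M.
      apply: le_trans (_ : c ^+ M.+1 <= _); first by rewrite ler_piMr // exprn_ge0 // ltW.
      by rewrite exprS ler_piMl ?exprn_ge0 ?ltW // (lt_trans cq).
    by lra.
  have h2 : (poisson_den g c)^-1 <= ((1 - q) ^+ 2)^-1.
    by rewrite lef_pV2 ?posrE // den0 // ltW.
  apply: le_trans (_ : 2 * (2 * q ^+ M) / (1 - q) ^+ 2 * 1 <= _); last first.
    by rewrite le_eqVlt; apply/orP; left; apply/eqP; ring.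
  have Y0 : 0 <= (poisson_den g c)^-1 by rewrite invr_ge0 ltW.
  apply: ler_pM; [by rewrite !mulr_ge0|exact: ltW| |exact: ltW].
  by apply: ler_pM => //; rewrite ?mulr_ge0 // ler_wpM2l.
rewrite /is_sum; apply: (@squeeze_cvgr _ _ _ _ (fun M => - ln (poisson_den g q) - 4 / (1 - q) ^+ 2 * q ^+ M)
  (fun M => - ln (poisson_den g q) + 4 / (1 - q) ^+ 2 * q ^+ M)).
- by near=> M; have := bound M; rewrite ler_distl.
- rewrite -[X in (_ --> X)%classic]subr0 -[X in (_ --> (_ - X))%classic](mulr0 (4 / (1 - q) ^+ 2)).
  apply: cvgB; first exact: cvg_cst.
  by apply: cvgMr; apply: cvg_expr; rewrite gtr0_norm.
- rewrite -[X in (_ --> X)%classic]addr0 -[X in (_ --> (_ + X))%classic](mulr0 (4 / (1 - q) ^+ 2)).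
  apply: cvgD; first exact: cvg_cst.
  by apply: cvgMr; apply: cvg_expr; rewrite gtr0_norm.
Unshelve. all: by end_near.
Qed.

Lemma log_series {R : realType} (q z u : R) : 0 < q < 1 -> 2 * z = q^-1 + q -> -1 <= u <= 1 ->
  is_sum (fun n => log_coef (- ln q) q n%:Z * gegE n%:Z 0 u) (ln (2 * z - 2 * u)).
Proof.
move=> q01 hz hu; have /andP[q0 q1] := q01.
have -> : u = cos (acos u) by rewrite acosK // in_itv.
have := poisson_log (acos u) q q01; move: (acos u) => g h.
have dg : 0 < poisson_den g q.
  by apply: lt_le_trans (poisson_den_ge g q (ltW q0)); rewrite exprn_gt0 // subr_gt0.
have -> : ln (2 * z - 2 * cos g) = - ln q + (-1) * - ln (poisson_den g q).
  rewrite mulN1r opprK hz -lnV ?posrE // -lnM ?posrE ?invr_gt0 //.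
  by congr ln; rewrite /poisson_den; field; rewrite gt_eqF.
apply: (eq_is_sum _ _ _ _ (is_sum_cons (- ln q) _ _ (is_sumZ (-1) _ _ h))) => -[|n].
  by rewrite /log_coef /= gegE0 mulr1.
rewrite gegE_cos /log_coef /=; by ring.
Qed.

(** * Geometric decay, and expansions in Gegenbauer polynomials of index h *)

Definition geo_bounded {R : realType} (q : R) (a : nat -> R) : Prop :=
  exists C, forall n, `|a n| <= C * q ^+ n.

Lemma expr_le_bin (n D : nat) : (n.+1 ^ D <= D`! * 'C(n + D, D))%N.
Proof.
rewrite mulnC bin_ffact; elim: D => [|D IH]; first by rewrite expn0 ffactn0.
have -> : (n + D.+1 = (n + D).+1)%N by lia.
by rewrite ffactSS expnS leq_mul //; lia.
Qed.

Lemma geo_poly_summable {R : realType} (q : R) D : 0 < q < 1 ->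
  abs_summable (fun n => q ^+ n * n.+1%:R ^+ D).
Proof.
move=> /andP[q0 q1].
apply: (ge0_abs_summable _ (D`!%:R * (1 - q) ^- D.+1)) => n.
  by rewrite mulr_ge0 ?exprn_ge0 // ltW.
apply: le_trans (_ : \sum_(0 <= i < n) D`!%:R * ('C(i + D, D)%:R * q ^+ i) <= _).
  apply: ler_sum => i _; rewrite mulrA mulrC ler_wpM2r ?exprn_ge0 ?(ltW q0) //.
  by rewrite -natrX -natrM ler_nat expr_le_bin.
by rewrite -big_distrr ler_wpM2l // binom_geo // q1 ltW.
Qed.

Lemma geo_bounded_summable {R : realType} (q : R) (a b : nat -> R) (C : R) D : 0 < q < 1 ->
  geo_bounded q a -> (forall n, `|b n| <= C * n.+1%:R ^+ D) ->
  abs_summable (fun n => a n * b n).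
Proof.
move=> q01 [C1 h1] h2; have /andP[q0 q1] := q01.
apply: le_abs_summable (abs_summableZ (C1 * C) _ (geo_poly_summable q D q01)) => n.
rewrite normrM (_ : _ * _ * (_ * _) = (C1 * q ^+ n) * (C * n.+1%:R ^+ D)); last by ring.
by apply: ler_pM.
Qed.

Lemma gegE0_bound {R : realType} (u : R) (n : nat) : -1 <= u <= 1 -> `|gegE n%:Z 0 u| <= 2.
Proof.
move=> hu; have -> : u = cos (acos u) by rewrite acosK // in_itv.
rewrite gegE_cos normrM.
have a1 : `|cos (n%:R * acos u)| <= 1 by rewrite ler_norml cos_geN1 cos_le1.
by case: ifP => _; rewrite ger0_norm //; lra.
Qed.

(** A crude polynomial bound suffices against geometrically decaying coefficients. [gegz_raise]
    gives the step in h, with an inner induction in steps of two on the degree. *)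
Lemma gegz_bound {R : realType} (u : R) (h n : nat) : -1 <= u <= 1 ->
  `|gegz n%:Z h.+1%:R u| <= n.+1%:R ^+ (2 * h + 1).
Proof.
move=> hu; elim: h n => [|h IH] n.
  rewrite muln0 expr1 (_ : 1%:R = 0 + 1 :> R); last by rewrite add0r.
  have e (k : nat) : gegz k.+2%:Z (0 + 1) u = gegE k.+2%:Z 0 u + gegz k%:Z (0 + 1) u.
    by rewrite /gegE (_ : k.+2%:Z - 2 = k%:Z) ?subrK //; lia.
  elim/ind2: n => [|  |n IH0 IH1]; first by rewrite gegz0 normr1.
    by have := gegE0_bound u 1 hu; rewrite gegE1 gegz1.
  rewrite e; apply: (le_trans (ler_normD _ _)).
  have := gegE0_bound u n.+2 hu; rewrite -[n.+3%:R]natr1 -[n.+2%:R]natr1; lra.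
have e (k : nat) : gegz k%:Z h.+2%:R u = (k%:R + h.+1%:R) / h.+1%:R * gegz k%:Z h.+1%:R u
    + gegz (k%:Z - 2) h.+2%:R u.
  have hn : h.+1%:R != 0 :> R by rewrite pnatr_eq0.
  have := gegz_raise h.+1%:R u k%:Z; rewrite natr1 -pmulrn => r.
  by apply: (mulfI hn); apply: (lincomb (lcM (-1) r)); field.
have b1 (k : nat) : `|(k%:R + h.+1%:R) / h.+1%:R * gegz k%:Z h.+1%:R u| <= k.+1%:R ^+ (2 * h + 2) :> R.
  rewrite normrM (_ : 2 * h + 2 = (2 * h + 1).+1)%N; last by lia.
  rewrite exprS; apply: ler_pM => //.
  rewrite ger0_norm ?divr_ge0 ?addr_ge0 // ler_pdivrMr ?ltr0n //.
  rewrite -[h.+1%:R]natr1 -[k.+1%:R]natr1.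
  by have := ler0n R k; have := ler0n R h; nra.
have m1 (k : nat) : (k.+1%:R : R) ^+ (2 * h + 2) <= k.+1%:R ^+ (2 * h.+1 + 1).
  by rewrite ler_weXn2l ?ler1n //; lia.
elim/ind2: n => [|  |n IH0 IH1].
- by rewrite gegz0 normr1 expr1n.
- rewrite e (_ : 1%:Z - 2 = Negz 0) // /gegz addr0 -/(gegz 1%:Z _ u).
  exact: le_trans (b1 1%N) (m1 1%N).
rewrite e (_ : n.+2%:Z - 2 = n%:Z); last by lia.
apply: (le_trans (ler_normD _ _)).
apply: le_trans (lerD (b1 n.+2) IH0) _.
have -> : (2 * h.+1 + 1 = (2 * h + 2).+1)%N by lia.
rewrite !exprS.
have k0 : 0 <= (n.+1%:R : R) ^+ (2 * h + 2) by rewrite exprn_ge0.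
have k1 : (n.+1%:R : R) ^+ (2 * h + 2) <= n.+3%:R ^+ (2 * h + 2).
  have hl : (n.+1 <= n.+3)%N by lia.
  by rewrite lerXn2r ?nnegrE ?ler_nat.
have n0 := ler0n R n.
have h3 : (n.+1%:R : R) * n.+1%:R ^+ (2 * h + 2) <= (n%:R + 1) * n.+3%:R ^+ (2 * h + 2).
  by rewrite natr1 ler_wpM2l.
have : 0 <= (n.+3%:R : R) ^+ (2 * h + 2) by rewrite exprn_ge0.
move: h3; move: (n.+3%:R ^+ _) (n.+1%:R * _) => K K1.
by rewrite -[n.+3%:R]natr1 -[n.+2%:R]natr1 -[n.+1%:R]natr1 => h3 K0; nra.
Qed.

Lemma gegE_bound {R : realType} (u : R) (h n : nat) : -1 <= u <= 1 ->
  `|gegE n%:Z h%:R u| <= 2 * n.+1%:R ^+ (2 * h + 1).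
Proof.
move=> hu; rewrite /gegE natr1; apply: (le_trans (ler_normB _ _)).
rewrite mulrDl mul1r; apply: lerD; first exact: gegz_bound.
case: n => [|[|n]].
- by rewrite (_ : 0%:Z - 2 = Negz 1) // normr0 exprn_ge0.
- by rewrite (_ : 1%:Z - 2 = Negz 0) // normr0 exprn_ge0.
rewrite (_ : n.+2%:Z - 2 = n%:Z); last by lia.
apply: (le_trans (gegz_bound _ _ _ hu)).
have hl : (n.+1 <= n.+3)%N by lia.
by rewrite lerXn2r ?nnegrE ?ler_nat.
Qed.

Lemma powcoef_bound {R : realType} (q z : R) (g : int -> R) P : 0 < q < 1 ->
  (exists C, forall n, `|g n| <= C * q ^+ `|n|%N) ->
  exists C, forall n, `|powcoef z g P n| <= C * q ^+ `|n|%N.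
Proof.
move=> /andP[q0 q1] hg; elim: P => [//|P [C hC]].
have C0 : 0 <= C by have := hC 0; rewrite mulr1; exact: le_trans.
exists (2 * `|z| * C + 2 * C / q) => n; rewrite powcoefS.
have st m : (`|n| <= `|m|.+1)%N -> `|powcoef z g P m| <= C / q * q ^+ `|n|%N.
  move=> hm; apply: (le_trans (hC m)); rewrite -mulrA ler_wpM2l // ler_pdivlMl // -exprS.
  by apply: ler_wiXn2l => //; exact: ltW.
have t1 : `|2 * z * powcoef z g P n| <= 2 * `|z| * C * q ^+ `|n|%N.
  by rewrite !normrM (ger0_norm (ler0n _ 2)) -!mulrA !ler_wpM2l.
have t2 : `|powcoef z g P (n + 1)| <= C / q * q ^+ `|n|%N by apply: st; lia.
have t3 : `|powcoef z g P (n - 1)| <= C / q * q ^+ `|n|%N by apply: st; lia.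
rewrite (_ : (2 * `|z| * C + 2 * C / q) * q ^+ `|n|%N = 2 * `|z| * C * q ^+ `|n|%N
    + C / q * q ^+ `|n|%N + C / q * q ^+ `|n|%N); last by ring.
apply: le_trans (lerD (lerD t1 t2) t3).
by apply: (le_trans (ler_normB _ _)); rewrite lerD2r ler_normB.
Qed.

Lemma log_coef_bound {R : realType} (L q : R) : 0 < q < 1 ->
  exists C, forall n, `|log_coef L q n| <= C * q ^+ `|n|%N.
Proof.
move=> /andP[q0 q1]; exists (`|L| + 1) => n; rewrite /log_coef.
have [->|n0] := eqVneq n 0; first by rewrite mulr1 lerDl.
rewrite normrN normrM normrX (gtr0_norm q0) mulrC ler_wpM2r ?exprn_ge0 ?(ltW q0) //.
have h : 1 <= `|n|%N%:R :> R by rewrite ler1n; lia.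
rewrite normfV ger0_norm //; apply: le_trans (_ : 1 <= _); last by rewrite lerDr.
by rewrite invf_le1 // (lt_le_trans ltr01).
Qed.

Lemma one_coef_bound {R : realType} (q : R) : 0 < q < 1 ->
  exists C, forall n, `|one_coef n : R| <= C * q ^+ `|n|%N.
Proof.
move=> /andP[q0 q1]; exists 1 => n; rewrite /one_coef mul1r.
have [->|n0] := eqVneq n 0; first by rewrite normr1.
by rewrite normr0 exprn_ge0 // ltW.
Qed.

Lemma is_sum_shift {R : realType} (a : nat -> R) s :
  is_sum a s -> is_sum (fun n => a n.+1) (s - a 0%N).
Proof.
move=> ha; rewrite /is_sum.
have h : ((fun n => series a n.+1 - a 0%N) @ \oo --> s - a 0%N)%classic.
  apply: cvgB; last exact: cvg_cst.
  by rewrite cvg_shiftS; exact: ha.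
apply: cvg_trans h; apply: near_eq_cvg; near=> n.
by rewrite /series /= big_nat_recl // addrAC subrr add0r.
Unshelve. all: by end_near.
Qed.

(** At index 0, [gegE] contains the factor 2 that folds a two-sided even series into a one-sided
    one; evenness of g supplies the coefficient at -1 when n = 0. *)
Lemma series_mulX {R : realType} (q z u s : R) (g : int -> R) : 0 < q < 1 ->
  -1 <= u <= 1 -> (forall n, g (- n) = g n) ->
  (exists C, forall n, `|g n| <= C * q ^+ `|n|%N) ->
  is_sum (fun n => g n%:Z * gegE n%:Z 0 u) s ->
  is_sum (fun n => powcoef z g 1 n%:Z * gegE n%:Z 0 u) ((2 * z - 2 * u) * s).
Proof.
move=> q01 hu hN [C hC] hs.
have sA : abs_summable (fun n => g n%:Z * gegE n.+1%:Z 0 u).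
  apply: (geo_bounded_summable q _ _ 2 0) => //; first by exists C => n; exact: hC.
  by move=> n; rewrite mulr1; exact: gegE0_bound.
have := is_sum_lim _ sA; set A := limn _ => hA.
have mX n : 2 * u * gegE n%:Z 0 u = gegE n.+1%:Z 0 u
   + (if n is n'.+1 then (if n' == 0%N then 2 else 1) * gegE n'%:Z 0 u else 0).
  have := gegE_mulX 0 u n (lexx 0).
  have -> : gegEa (0 : R) n = 1 / 2.
    by rewrite /gegEa addr0; have := ler0n R n => n0; field; nzlra.
  case: n => [|n]; first by rewrite addr0 => h; apply: (lincomb (lcM 2 h)); rewrite addr0; field.
  have -> : gegEb (0 : R) n.+1 = (if n == 0%N then 2 else 1) / 2.
    rewrite /gegEb eqSS; case: eqP => h; first by field.
    have : 0 < n%:R :> R by rewrite ltr0n; lia.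
    by rewrite -[n.+1%:R]natr1 => n0; field; nzlra.
  by move=> h; apply: (lincomb (lcM 2 h)); case: (n == 0%N); field.
have hB := is_sumB _ _ _ _ (is_sumZ (2 * u) _ _ hs) hA.
have hB' := is_sum_shift _ _ hB.
have hA' := is_sum_cons 0 _ _ hA.
have hT := is_sumB _ _ _ _ (is_sumZ (2 * z) _ _ hs) (is_sumD _ _ _ _ hA' hB').
have -> : (2 * z - 2 * u) * s = 2 * z * s - (0 + A + (2 * u * s - A - (2 * u * (g 0 * gegE 0 0 u) - g 0 * gegE 1 0 u))).
  by rewrite gegE0 gegE1; ring.
apply: (eq_is_sum _ _ _ _ hT) => n.
have b k : 2 * u * (g k.+1%:Z * gegE k.+1%:Z 0 u) - g k.+1%:Z * gegE k.+2%:Z 0 u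
   = g k.+1%:Z * ((if k == 0%N then 2 else 1) * gegE k%:Z 0 u).
  by rewrite mulrCA mX; ring.
rewrite b powcoefS -[powcoef z g 0]/g.
have -> : n%:Z + 1 = n.+1%:Z by lia.
case: n => [|n].
  have -> : g (0%:Z - 1) = g 1%:Z by rewrite -(hN 1%:Z); congr g; lia.
  by rewrite /=; ring.
have -> : n.+1%:Z - 1 = n%:Z by lia.
by rewrite /=; ring.
Qed.

(** Summation by parts: [gegE] of index h is a difference of Gegenbauer polynomials of index h + 1
    and degrees n and n - 2, and these in turn are multiples of [gegE] of index h + 1. The sum
    itself does not change. *)
Lemma series_raise {R : realType} (q u s : R) (h : nat) (a : nat -> R) : 0 < q < 1 ->
  -1 <= u <= 1 -> geo_bounded q a ->
  is_sum (fun n => a n * gegE n%:Z h%:R u) s ->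
  is_sum (fun n => h.+1%:R * (a n - a n.+2) / (n + h.+1)%:R * gegE n%:Z h.+1%:R u) s.
Proof.
move=> q01 hu ha hs.
have sG : abs_summable (fun n => a n * gegz n%:Z h.+1%:R u).
  apply: (geo_bounded_summable q _ _ 1 (2 * h + 1)) => // n.
  by rewrite mul1r; exact: gegz_bound.
have hG := is_sum_lim _ sG.
have hB := is_sumB _ _ _ _ hG hs.
have hT := is_sumB _ _ _ _ hG (is_sum_shift _ _ (is_sum_shift _ _ hB)).
move: hT; rewrite /gegE natr1 (_ : 0%:Z - 2 = Negz 1) // (_ : 1%:Z - 2 = Negz 0) //.
rewrite {4 8}/gegz !subr0 !subrr !subr0 opprB addrCA subrr addr0 => hT.
apply: (eq_is_sum _ _ _ _ hT) => n.
have -> : n.+2%:Z - 2 = n%:Z by lia.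
have r := gegz_raise h.+1%:R u n%:Z.
have nh : (n + h.+1)%:R != 0 :> R by rewrite addnS pnatr_eq0.
move: r; rewrite -pmulrn -natrD => r.
rewrite -/(gegz n%:Z h.+1%:R u) /gegE.
by apply: (lincomb (lcM ((a n - a n.+2) / (n + h.+1)%:R) r)); field.
Qed.

Lemma is_sum_one {R : realType} (u : R) :
  is_sum (fun n => one_coef n%:Z * gegE n%:Z 0 u) 1.
Proof.
have h := is_sum_finite (fun n => one_coef n%:Z * gegE n%:Z 0 u) 1.
rewrite big_nat1 gegE0 mulr1 in h; apply: h => -[//|n] _.
by rewrite /one_coef /= mul0r.
Qed.

Lemma is_sum_pow {R : realType} (q z u s : R) (g : int -> R) p : 0 < q < 1 ->
  -1 <= u <= 1 -> (forall n, g (- n) = g n) ->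
  (exists C, forall n, `|g n| <= C * q ^+ `|n|%N) ->
  is_sum (fun n => g n%:Z * gegE n%:Z 0 u) s ->
  is_sum (fun n => powcoef z g p n%:Z * gegE n%:Z 0 u) ((2 * z - 2 * u) ^+ p * s).
Proof.
move=> q01 hu hN hC hs; elim: p => [|p IH]; first by rewrite mul1r.
rewrite exprS -mulrA; apply: (series_mulX q _ _ _ (powcoef z g p)) => //.
  exact: powcoefN.
exact: powcoef_bound.
Qed.

(** The product of the factors - (i + 1) / (p + i + 1) for i < h, one for each use of
    [series_raise]. *)
Definition raise_const {R : realType} (p h : nat) : R :=
  (-1) ^+ h * h`!%:R * p`!%:R / (p + h)`!%:R.

Lemma raise_constS {R : realType} p h :
  raise_const p h.+1 = - (raise_const p h * h.+1%:R / (p + h).+1%:R) :> R.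
Proof.
rewrite /raise_const addnS !factS !natrM exprS.
have : (p + h).+1%:R != 0 :> R by rewrite pnatr_eq0.
by move: (_.+1%:R) => K K0; field; rewrite fact_neq0 K0.
Qed.

Lemma geo_bounded_int {R : realType} (q : R) (g : int -> R) h : 0 < q < 1 ->
  (exists C, forall n, `|g n| <= C * q ^+ `|n|%N) -> geo_bounded q (fun n => g (n + h)%N%:Z).
Proof.
move=> /andP[q0 q1] [C hC]; exists C => n; apply: (le_trans (hC _)).
have C0 : 0 <= C by have := hC 0; rewrite mulr1; exact: le_trans.
by rewrite ler_wpM2l // ler_wiXn2l ?leq_addr // ltW.
Qed.

Lemma geo_boundedZ {R : realType} (q c : R) a : geo_bounded q a -> geo_bounded q (fun n => c * a n).
Proof. by move=> [C hC]; exists (`|c| * C) => n; rewrite normrM -mulrA ler_wpM2l. Qed.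

Lemma geo_boundedD {R : realType} (q : R) a b : geo_bounded q a -> geo_bounded q b ->
  geo_bounded q (fun n => a n + b n).
Proof.
move=> [C hC] [D hD]; exists (C + D) => n; apply: (le_trans (ler_normD _ _)).
by rewrite mulrDl lerD.
Qed.

Lemma one_powcoef_deriv {R : realFieldType} (z : R) P n :
  n%:~R * powcoef z one_coef P.+1 n =
  P.+1%:R * (powcoef z one_coef P (n + 1) - powcoef z one_coef P (n - 1)).
Proof.
have d0 m : m%:~R * powcoef z one_coef 1 m = one_coef (m + 1) - one_coef (m - 1) + 0 - 0 :> R.
  by rewrite one_coef_deriv addr0 subr0.
have k0 Q m : powcoef z (fun=> 0) Q m = 0 :> R.
  by elim: Q m => [//|Q IHQ] m; rewrite powcoefS !IHQ; ring.
by rewrite (powcoef_deriv z one_coef (fun=> 0) d0) !k0 addr0 subr0.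
Qed.

(** The function stays fixed while h grows: the difference of coefficients two apart produced by
    [series_raise] is, by the derivative relation, a coefficient of the next power. *)
Lemma zonal_pow_series {R : realType} (q z u : R) p h : 0 < q < 1 -> -1 <= u <= 1 ->
  is_sum (fun n => raise_const p h * powcoef z one_coef (p + h) (n + h)%N%:Z
     * gegE n%:Z h%:R u) ((2 * z - 2 * u) ^+ p).
Proof.
move=> q01 hu; elim: h => [|h IH].
  have := is_sum_pow q z u 1 one_coef p q01 hu (@one_coefN R) (one_coef_bound q q01) (is_sum_one u).
  rewrite mulr1; apply: eq_is_sum => n.
  by rewrite /raise_const !addn0 fact0 expr0 !mul1r divff ?fact_neq0 // mul1r.
have hb : geo_bounded q (fun n => raise_const p h * powcoef z one_coef (p + h) (n + h)%N%:Z).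
  by apply: geo_boundedZ; apply: geo_bounded_int => //; apply: powcoef_bound => //; exact: one_coef_bound.
apply: eq_is_sum (series_raise q u _ h _ q01 hu hb IH) => n.
congr (_ * _).
have := one_powcoef_deriv z (p + h) (n + h.+1)%N%:Z.
rewrite -pmulrn.
have -> : (n + h.+1)%N%:Z - 1 = (n + h)%N%:Z by lia.
have -> : (n + h.+1)%N%:Z + 1 = (n.+2 + h)%N%:Z by lia.
have nN : (n + h.+1)%:R != 0 :> R by rewrite addnS pnatr_eq0.
rewrite raise_constS (addnS p h) => e.
have nP : (p + h).+1%:R != 0 :> R by rewrite pnatr_eq0.
apply: (mulfI nN); apply: (lincomb (lcM (raise_const p h * h.+1%:R / (p + h).+1%:R) e)).
by move: ((p + h).+1%:R) ((n + h.+1)%:R) nP nN => K M K0 M0; field; rewrite K0 M0.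
Qed.

(** As for the plain power, but the derivative relation of the logarithm contributes an extra 1 / (p
    + h + 1) at each step; these add up to H_(p+h) - H_p. *)
Lemma zonal_log_series {R : realType} (q z u : R) (H : nat -> R) p h :
  0 < q < 1 -> 2 * z = q^-1 + q -> -1 <= u <= 1 ->
  (forall n, H n.+1 = H n + n.+1%:R^-1) ->
  is_sum (fun n => raise_const p h * (powcoef z (log_coef (- ln q) q) (p + h) (n + h)%N%:Z
       - (H (p + h)%N - H p) * powcoef z one_coef (p + h) (n + h)%N%:Z)
     * gegE n%:Z h%:R u) ((2 * z - 2 * u) ^+ p * ln (2 * z - 2 * u)).
Proof.
move=> q01 hz hu HS; have /andP[q0 q1] := q01.
have qn : q != 0 by rewrite gt_eqF.
have hz' : 2 * z = q + q^-1 by rewrite hz addrC.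
set lc := log_coef _ _; have lcN : forall n, lc (- n) = lc n by exact: log_coefN.
have lcb := log_coef_bound (- ln q) q q01; rewrite -/lc in lcb.
elim: h => [|h IH].
  have := is_sum_pow q z u _ lc p q01 hu lcN lcb (log_series q z u q01 hz hu).
  apply: eq_is_sum => n.
  by rewrite /raise_const !addn0 fact0 expr0 !mul1r divff ?fact_neq0 // mul1r subrr mul0r subr0.
have hb : geo_bounded q (fun n => raise_const p h * (powcoef z lc (p + h) (n + h)%N%:Z
       - (H (p + h)%N - H p) * powcoef z one_coef (p + h) (n + h)%N%:Z)).
  apply: geo_boundedZ; apply: geo_boundedD.
    by apply: geo_bounded_int => //; apply: powcoef_bound.
  apply: (geo_bounded_int q (fun m => - ((H (p + h)%N - H p) * powcoef z one_coef (p + h) m))) => //.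
  have [C hC] := powcoef_bound q z _ (p + h) q01 (one_coef_bound q q01).
  exists (`|H (p + h)%N - H p| * C) => m; rewrite normrN normrM -mulrA.
  by rewrite ler_wpM2l.
apply: eq_is_sum (series_raise q u _ h _ q01 hu hb IH) => n.
congr (_ * _).
have := powcoef_deriv z _ _ (log_coef_deriv (- ln q) q z qn hz') (p + h) (n + h.+1)%N%:Z.
have := one_powcoef_deriv z (p + h) (n + h.+1)%N%:Z.
rewrite -pmulrn -/lc.
have -> : (n + h.+1)%N%:Z - 1 = (n + h)%N%:Z by lia.
have -> : (n + h.+1)%N%:Z + 1 = (n.+2 + h)%N%:Z by lia.
have nN : (n + h.+1)%:R != 0 :> R by rewrite addnS pnatr_eq0.
have nP : (p + h).+1%:R != 0 :> R by rewrite pnatr_eq0.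
rewrite raise_constS (addnS p h) HS => e1 e2.
set eta := H _ - H p.
rewrite (_ : H (p + h)%N + (p + h).+1%:R^-1 - H p = eta + (p + h).+1%:R^-1); last by rewrite /eta; ring.
apply: (mulfI nN); apply: (lincomb (lcD
  (lcM (- (raise_const p h * h.+1%:R / (p + h).+1%:R * (eta + (p + h).+1%:R^-1))) e1)
  (lcM (raise_const p h * h.+1%:R / (p + h).+1%:R) e2))).
by move: ((p + h).+1%:R) ((n + h.+1)%:R) nP nN => K M K0 M0; field; rewrite K0 M0.
Qed.

(** * Uniqueness of the coefficients of a cosine series *)

Lemma cos_sin_2pi {R : realType} (k : nat) :
  cos (k%:R * (pi * 2) : R) = 1 /\ sin (k%:R * (pi * 2) : R) = 0.
Proof.
elim: k => [|k [c s]]; first by rewrite mul0r cos0 sin0.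
rewrite -natr1 mulrDl mul1r cosD sinD c s mulr_natr cos2pi sin2pi.
by split; ring.
Qed.

Lemma cos_grid_sum {R : realType} (M k : nat) : (0 < k < M)%N ->
  \sum_(0 <= j < M) cos (k%:R * (j%:R * (pi * 2 / M%:R)) : R) = 0.
Proof.
move=> /andP[k0 kM]; have M0 : (0 < M)%N by lia.
have Mr : M%:R != 0 :> R by rewrite pnatr_eq0 -lt0n.
pose a : R := k%:R * pi / M%:R.
have sa : 0 < sin a.
  apply: sin_gt0_pi; rewrite divr_gt0 ?mulr_gt0 ?ltr0n ?pi_gt0 //=.
  by rewrite ltr_pdivrMr ?ltr0n // [ltLHS]mulrC ltr_pM2l ?pi_gt0 // ltr_nat.
apply: (mulfI (x := 2 * sin a)); first by rewrite mulf_neq0 // gt_eqF.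
rewrite mulr0.
have T m : 2 * sin a * \sum_(0 <= j < m) cos (k%:R * (j%:R * (pi * 2 / M%:R)) : R)
    = sin (2 * m%:R * a - a) + sin a.
  elim: m => [|m IH]; first by rewrite big_nil mulr0 mulr0 mul0r sub0r sinN addNr.
  rewrite big_nat_recr //= mulrDr IH.
  have -> : k%:R * (m%:R * (pi * 2 / M%:R)) = 2 * m%:R * a by rewrite /a; field.
  have -> : 2 * m.+1%:R * a - a = 2 * m%:R * a + a by rewrite -natr1; ring.
  by rewrite sinB sinD; ring.
rewrite T.
have -> : 2 * M%:R * a - a = k%:R * (pi * 2) + - a by rewrite /a; field.
have [c s] := @cos_sin_2pi R k.
by rewrite sinD c s sinN cosN; ring.
Qed.

(** Discrete orthogonality. For n < M - m the frequencies n + m and |n - m| stay below M, so a grid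
    of M angles does not confuse them with 0. *)
Lemma cos_grid_pair {R : realType} (M m n : nat) (K := \sum_(0 <= j < M)
    cos (n%:R * (j%:R * (pi * 2 / M%:R)) : R) * cos (m%:R * (j%:R * (pi * 2 / M%:R)))) :
  (m < M - m)%N -> (n < M - m)%N ->
  (n != m -> K = 0) /\ (n = m -> M%:R / 2 <= K).
Proof.
move=> hm hn.
pose C k : R := \sum_(0 <= j < M) cos (k%:R * (j%:R * (pi * 2 / M%:R)) : R).
have C0 k : (0 < k < M)%N -> C k = 0 by exact: cos_grid_sum.
have CM : C 0%N = M%:R.
  rewrite /C (eq_bigr (fun=> 1)) => [|j _]; last by rewrite mul0r cos0.
  by rewrite big_const_nat subn0 iter_addr addr0.
have KE (k k' : nat) : (k' <= k)%N -> \sum_(0 <= j < M)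
    cos (k%:R * (j%:R * (pi * 2 / M%:R)) : R) * cos (k'%:R * (j%:R * (pi * 2 / M%:R)))
    = (C (k + k')%N + C (k - k')%N) / 2.
  move=> h; rewrite /C -big_split /= [RHS]mulrC big_distrr /=; apply: eq_bigr => j _.
  set y := j%:R * _; rewrite natrD natrB //.
  have -> : (k%:R + k'%:R) * y = k%:R * y + k'%:R * y by ring.
  have -> : (k%:R - k'%:R) * y = k%:R * y - k'%:R * y by ring.
  by rewrite cosB cosD; field.
split=> [nm|nm].
  have [h|h] := leqP m n.
    by rewrite /K KE // !C0 ?addr0 ?mul0r //; lia.
  rewrite /K; under eq_bigr do rewrite mulrC.
  by rewrite KE ?(ltnW h) // !C0 ?addr0 ?mul0r //; lia.
rewrite /K nm KE // subnn CM; have [->|m0] := posnP m.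
  by rewrite addn0 CM; have := ler0n R M; lra.
by rewrite C0 ?add0r //; lia.
Qed.

(** Averaging over M = N + m equally spaced angles isolates c_m up to frequencies n >= N, so |c_m|
    is at most twice a tail of the absolute series. *)
Lemma cos_series_unique {R : realType} (c : nat -> R) : abs_summable c ->
  (forall psi, is_sum (fun n => c n * cos (n%:R * psi)) 0) -> forall m, c m = 0.
Proof.
move=> hc h m.
have hc' : abs_summable (fun n => `|c n|).
  by have [B hB] := hc; exists B => n; under eq_bigr do rewrite normr_id; exact: hB.
have hT := is_sum_lim _ hc'; set T := limn _ in hT.
have bound N : (m < N)%N -> `|c m| <= 2 * (T - \sum_(0 <= n < N) `|c n|).
  move=> mN; pose M := (N + m)%N.
  have MN : (M - m = N)%N by rewrite /M addnK.
  pose x j : R := j%:R * (pi * 2 / M%:R).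
  pose K n := \sum_(0 <= j < M) cos (n%:R * x j) * cos (m%:R * x j).
  have M0 : (0 : R) < M%:R by rewrite ltr0n; lia.
  have s0 : is_sum (fun n => c n * K n) 0.
    have := is_sum_big (fun n j => cos (m%:R * x j) * (c n * cos (n%:R * x j))) (fun=> 0) M
       (fun j _ => eq_ind _ (is_sum _) (is_sumZ (cos (m%:R * x j)) _ _ (h (x j))) _ (mulr0 _)).
    rewrite big1 //; apply: eq_is_sum => n.
    by rewrite /K big_distrr /=; apply: eq_bigr => j _; ring.
  have pr n (hn : (n < N)%N) := cos_grid_pair (R := R) M m n.
  have K0 n : (n < N)%N -> n != m -> K n = 0.
    by move=> hn nm; apply: (proj1 (pr n hn _ _)) => //; rewrite MN.
  have Km : M%:R / 2 <= K m by apply: (proj2 (pr m mN _ _)) => //; rewrite MN.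
  have Kle n : `|K n| <= M%:R.
    apply: (le_trans (ler_norm_sum _ _ _)).
    apply: le_trans (_ : \sum_(0 <= j < M) (1 : R) <= _).
      apply: ler_sum => j _; rewrite normrM -[leRHS]mulr1; apply: ler_pM => //.
        by rewrite ler_norml cos_geN1 cos_le1.
      by rewrite ler_norml cos_geN1 cos_le1.
    by rewrite big_const_nat subn0 iter_addr addr0.
  have d1 : is_sum (fun n => if n == m then c m * K m else 0) (c m * K m).
    have e1 : \sum_(0 <= n < N) (if n == m then c m * K m else 0) = c m * K m.
      rewrite big_mkord (bigD1 (Ordinal mN)) //= eqxx big1 ?addr0 // => i.
      by rewrite -val_eqE /= => /negbTE ->.
    rewrite -[X in is_sum _ X]e1; apply: is_sum_finite => n hn.
    by rewrite gtn_eqF // (leq_trans mN).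
  have d2 : is_sum (fun n => if (n < N)%N then `|c n| else 0) (\sum_(0 <= n < N) `|c n|).
    have -> : \sum_(0 <= n < N) `|c n| = \sum_(0 <= n < N) (if (n < N)%N then `|c n| else 0).
      by apply: eq_big_nat => n /andP[_ ->].
    by apply: is_sum_finite => n; rewrite ltnNge => ->.
  have b := is_sum_abs_le _ _ _ _ (is_sumB _ _ _ _ s0 d1) (is_sumZ M%:R _ _ (is_sumB _ _ _ _ hT d2)) _.
  have {}b : `|0 - c m * K m| <= M%:R * (T - \sum_(0 <= n < N) `|c n|).
    apply: b => n; have [hn|hn] := ltnP n N.
      rewrite subrr mulr0; case: eqP => [->|/eqP nm]; first by rewrite subrr normr0.
      by rewrite K0 // mulr0 subrr normr0.
    rewrite gtn_eqF ?(leq_trans mN) // !subr0 normrM mulrC.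
    by rewrite ler_wpM2r.
  rewrite sub0r normrN normrM in b.
  have : `|c m| * (M%:R / 2) <= `|c m| * `|K m|.
    by rewrite ler_wpM2l // (le_trans Km) // ler_norm.
  move=> /le_trans/(_ b).
  rewrite -(ler_pM2l M0 `|c m|).
  move: (\sum_(0 <= n < N) _) => S; move: (`|c m|) (M%:R) => y k.
  by lra.
apply/eqP; rewrite -normr_le0.
have hl : ((fun N => 2 * (T - \sum_(0 <= n < N) `|c n|)) @ \oo --> 2 * (T - T))%classic.
  by apply: cvgMr; apply: cvgB; [exact: cvg_cst | exact: hT].
rewrite -[X in _ <= X](mulr0 2) -[X in _ <= _ * X](subrr T) -(cvg_lim _ hl) //.
apply: limr_ge; first by apply/cvg_ex; eexists; exact: hl.
near=> N; apply: bound; near: N; exact: nbhs_infty_gt.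
Unshelve. all: by end_near.
Qed.

(** * The bracket of the statement, with n the shifted lower index and j = P - n *)

Definition legbracket {R : realType} (z E q : R) (n j : nat) (X : R) : R :=
  X / (j`!%:R * (2 * n + j)`!%:R) * legS z E q n (n + j)
  + (2 * n + j)`!%:R^-1 * (\sum_(0 <= k < j)
      ((2 * n + 2 * k + 1)%:R / (k`!%:R * (j - k)%:R * (2 * n + j + k + 1)%:R)
        * (1 + k`!%:R * (2 * n + j)`!%:R / ((2 * n + k)`!%:R * j`!%:R)))
      * legS z E q n (n + k))
  + j`!%:R^-1 * (\sum_(0 <= k < n)
      ((2 * k + 1)%:R / ((n + k)`!%:R * (n + j - k)%:R * (n + j + k + 1)%:R))
      * legS z E q n k).

(** Y stands for an added multiple of the plain power; it joins L and the harmonic numbers in the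
    last argument of [legbracket]. *)
Lemma log_leg_bracket {R : realType} (z E q L Y : R) (H : nat -> R) (n j : nat) :
  q != 0 -> E != 0 -> 2 * z = q^-1 + q -> 2 * E = q^-1 - q ->
  H 0%N = 0 -> (forall n, H n.+1 = H n + n.+1%:R^-1) ->
  powcoef z (log_coef L q) (n + j) n%:Z + Y * powcoef z one_coef (n + j) n%:Z
  = (-1) ^+ j * (n + j)`!%:R * (2 * E) ^+ (n + j).+1
    * legbracket z E q n j (Y + L + 2 * H (2 * (n + j))%N - H (2 * n + j)%N - H j).
Proof.
move=> q0 E0 hz hE H0 HS.
rewrite (log_leg z E q L H) // (delta_leg z E q) // /legbracket.
set S := legS z E q n.
(* Both sums are cut at K = n. Above n the one with 1 / (K + n)! joins the one with 1 / (K - n)!,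
   which is the origin of the factor 1 + ... in the statement. *)
have hsplit : legsum z E q n (fun K => if (n <= K)%N then (K - n)`!%:R^-1 else 0) (n + j)
    / (2 * n + j)`!%:R
  + legsum z E q n (fun K => (K + n)`!%:R^-1) (n + j) / j`!%:R
  = (2 * n + j)`!%:R^-1 * (\sum_(0 <= k < j)
      ((2 * n + 2 * k + 1)%:R / (k`!%:R * (j - k)%:R * (2 * n + j + k + 1)%:R)
        * (1 + k`!%:R * (2 * n + j)`!%:R / ((2 * n + k)`!%:R * j`!%:R)))
      * S (n + k)%N)
  + j`!%:R^-1 * (\sum_(0 <= k < n)
      ((2 * k + 1)%:R / ((n + k)`!%:R * (n + j - k)%:R * (n + j + k + 1)%:R)) * S k).
  rewrite /legsum !(big_cat_nat (leq0n n) (leq_addr j n)) /=.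
  rewrite [X in (X + _) / _ + _]big_nat [X in (X + _) / _ + _]big1 ?add0r; last first.
    by move=> k hk; rewrite ifF ?mulr0 ?mul0r //; lia.
  rewrite mulrDl addrC -addrA addrC; congr (_ + _); last first.
    rewrite mulrC; congr (_ * _); apply: eq_big_nat => k hk.
    rewrite -/(S k) !natrD natrB ?natrM; last by lia.
    rewrite addnC -[RHS]mulrA [RHS]mulrC -[in RHS]mulrA.
    by rewrite !invfM !natrD; ring.
  have shift (F : nat -> R) : \sum_(n <= i < n + j) F i = \sum_(0 <= k < j) F (n + k)%N.
    rewrite -{1}[n]add0n big_addn addKn.
    by apply: eq_big_nat => k _; rewrite addnC.
  rewrite !shift.
  rewrite !big_distrl !big_distrr -big_split /=; apply: eq_big_nat => k hk.
  rewrite leq_addr addKn -/(S (n + k)%N).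
  have -> : (n + k + n = 2 * n + k)%N by lia.
  have hj : (j - k)%:R != 0 :> R by rewrite pnatr_eq0; lia.
  have h1 : (n + j)%:R - (n + k)%:R = (j - k)%:R :> R.
    by rewrite !natrD natrB; [ring | lia].
  have h2 : (n + j)%:R + (n + k)%:R + 1 = (2 * n + j + k + 1)%:R :> R.
    by rewrite -natrD natr1; congr (_%:R); lia.
  have h3 : 2 * (n + k)%:R + 1 = (2 * n + 2 * k + 1)%:R :> R.
    by rewrite -natrM natr1; congr (_%:R); lia.
  have h4 : (2 * n + j + k + 1)%:R != 0 :> R by rewrite addn1 pnatr_eq0.
  rewrite h1 h2 h3.
  move: (2 * n + j + k + 1)%N (2 * n + 2 * k + 1)%N h4 => a b h4.
  by field; rewrite !fact_neq0 hj h4.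
rewrite -addrA hsplit -/(S _).
rewrite [RHS]mulrDr -!addrA.
by field; rewrite !fact_neq0.
Qed.

(** * Transfer of coefficients from the sphere to the circle *)

Lemma is_sum_ge0_summable {R : realType} (a : nat -> R) s :
  (forall n, 0 <= a n) -> is_sum a s -> abs_summable a.
Proof.
move=> a0 ha; apply: (@ge0_abs_summable _ _ s) => // N.
have ht : is_sum (fun n => if (n < N)%N then a n else 0) (\sum_(0 <= n < N) a n).
  rewrite (_ : \sum_(0 <= n < N) a n = \sum_(0 <= n < N) (if (n < N)%N then a n else 0)).
    by apply: is_sum_finite => n hn; rewrite ltnNge hn.
  by apply: eq_big_nat => n /andP[_ ->].
have hle n : `|if (n < N)%N then a n else 0| <= a n.
  by case: ifP => _; rewrite ?normr0 ?a0 // ger0_norm.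
by apply: le_trans (ler_norm _) (is_sum_abs_le _ _ _ _ ht ha hle).
Qed.

Lemma abs_summableB {R : realType} (a b : nat -> R) :
  abs_summable a -> abs_summable b -> abs_summable (fun n => a n - b n).
Proof.
move=> [C hC] [D hD]; exists (C + D) => n.
apply: le_trans (lerD (hC n) (hD n)); rewrite -big_split /=.
by apply: ler_sum => i _; apply: ler_normB.
Qed.

Lemma zonal0_cos {R : realType} (psi : R) (k : nat) :
  zonal 0 k (cos psi)
  = zonal_const 0 * ((if k == 0%N then 1 else 2) * cos (k%:R * psi)).
Proof. by rewrite /zonal mul0r gegE_cos. Qed.

Lemma zonal0_abs {R : realType} (psi : R) (k : nat) :
  `|zonal 0 k (cos psi)| <= zonal 0 k (1 : R).
Proof.
rewrite -[in leRHS](@cos0 R) !zonal0_cos mulr0 cos0 mulr1.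
rewrite normrM (gtr0_norm (zonal_const_gt0 0)) ler_pM2l ?zonal_const_gt0 //.
by rewrite ler_norml; case: (k == 0%N);
  have := cos_geN1 (k%:R * psi); have := cos_le1 (k%:R * psi); lra.
Qed.

Lemma zonal_even {R : realType} (h l : nat) (u : R) :
  zonal (2 * h) l u = zonal_const (2 * h) * gegE l%:Z h%:R u.
Proof. by rewrite /zonal (_ : (2 * h)%:R / 2 = h%:R) // natrM; field. Qed.

Lemma geo_zonal_summable {R : realType} (h : nat) (q : R) (a : nat -> R) :
  0 < q < 1 -> geo_bounded q a -> abs_summable (fun l => `|a l| * zonal (2 * h) l 1).
Proof.
move=> q01 ha.
apply: (@geo_bounded_summable _ q _ _ (zonal_const (2 * h) * 2) (2 * h + 1)) => //.
  by case: ha => C hC; exists C => n; rewrite normr_id.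
move=> n; rewrite zonal_even normrM (gtr0_norm (zonal_const_gt0 _)) -mulrA.
by rewrite ler_pM2l ?zonal_const_gt0 //; apply: gegE_bound; rewrite lexx andbT; lra.
Qed.

Lemma geo_pathw_summable {R : realType} (d h n k : nat) (th th' : nat -> R) (q : R)
    (a : nat -> R) :
  (d - 2 = 2 * h)%N -> 0 < q < 1 -> geo_bounded q a -> (n <= d - 2)%N ->
  abs_summable (fun l => a l * pathw (fun j k k' => `|Omega d th th' j k k'|) n l k).
Proof.
move=> hd q01 ha hn.
apply: (le_abs_summable _ _ _
  (abs_summableZ (zonal (d - 2 - n) k 1)^-1 _ (geo_zonal_summable h q a q01 ha))) => l.
rewrite normrM mulrCA ler_wpM2l // -hd.
exact: pathw_le_zonal.
Qed.

(** One function of psi is expanded twice. [chain_zonal] and [triangular_sums] turn the first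
    expansion into a cosine series, and [cos_series_unique] is applied to the difference. *)
Lemma zonal_transfer {R : realType} (d h : nat) (th th' : nat -> R) (q qc : R)
    (A B : nat -> R) (s : R -> R) :
  (d - 2 = 2 * h)%N -> 0 < q < 1 -> 0 < qc < 1 -> geo_bounded q A -> geo_bounded qc B ->
  (forall psi, is_sum (fun n => A n *
     gegE n%:Z h%:R (chain_cos th th' (d - 2) (cos psi))) (s psi)) ->
  (forall psi, is_sum (fun n => B n * gegE n%:Z 0 (cos psi)) (s psi)) ->
  forall m, B m = zonal_const 0 / zonal_const (d - 2) *
    limn (series (fun l => A l * pathw (Omega d th th') (d - 2) l m)).
Proof.
move=> hd q01 qc01 hA hB sA sB m.
set K := zonal_const (d - 2) : R; set K0 := zonal_const 0 : R.
have Kp : 0 < K by apply: zonal_const_gt0.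
have K0p : 0 < K0 by apply: zonal_const_gt0.
have zonE l u : zonal (d - 2) l u = K * gegE l%:Z h%:R u by rewrite /K hd zonal_even.
pose w' l k := pathw (fun j k k' => `|Omega d th th' j k k'|) (d - 2) l k.
pose w l k := pathw (Omega d th th') (d - 2) l k.
have ww l k : `|w l k| <= w' l k by apply: pathw_abs.
have w'0 l k : 0 <= w' l k by apply: le_trans (ww l k).
have wbig l k : (l < k)%N -> w l k = 0 by move=> ?; apply: pathw_small.
have zAsum : abs_summable (fun l => `|A l| * zonal (d - 2) l 1).
  by rewrite hd; apply: geo_zonal_summable q01 hA.
have z1 k : 0 < zonal 0 k 1 :> R by apply: zonal_gt0.
have abs_row l : \sum_(0 <= k < l.+1) w' l k * zonal 0 k 1 <= zonal (d - 2) l 1.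
  have := chain_abs d (d - 2) l th th' (leqnn _).
  by rewrite subnn.
(* The bound is taken at psi = 0, which dominates every other psi by [zonal0_abs]. *)
have hrow : abs_summable (fun l => \sum_(0 <= k < l.+1) `|(`|A l * w l k| * zonal 0 k 1)|).
  apply: (le_abs_summable _ _ _ zAsum) => l; rewrite ger0_norm; last by apply: sumr_ge0.
  apply: le_trans (ler_wpM2l (normr_ge0 (A l)) (abs_row l)).
  rewrite big_distrr /=; apply: ler_sum => k _.
  rewrite normrM normr_id (gtr0_norm (z1 k)) normrM -mulrA ler_wpM2l //.
  by rewrite ler_pM2r.
have hcol' k : abs_summable (fun l => `|A l * w l k|).
  have [C hC] := geo_pathw_summable d h (d - 2) k th th' q A hd q01 hA (leqnn _).
  exists C => n; apply: le_trans (hC n); apply: ler_sum => l _.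
  by rewrite normr_id !normrM ler_wpM2l // (le_trans (ww l k)) ?ler_norm.
have hcol k : abs_summable (fun l => A l * w l k).
  by apply: (le_abs_summable _ _ _ (hcol' k)) => l.
pose v k := limn (series (fun l => A l * w l k)).
pose v' k := limn (series (fun l => `|A l * w l k|)).
have vs k : is_sum (fun l => A l * w l k) (v k) by apply: is_sum_lim.
have vs' k : is_sum (fun l => `|A l * w l k|) (v' k) by apply: is_sum_lim.
have vv' k : `|v k| <= v' k by apply: is_sum_abs_le _ _ _ _ (vs k) (vs' k) _.
have v'sum : abs_summable (fun k => v' k * zonal 0 k 1).
  have h0 l k : (l < k)%N -> `|A l * w l k| * zonal 0 k 1 = 0.
    by move=> /wbig ->; rewrite mulr0 normr0 mul0r.
  apply: is_sum_ge0_summable _ _ _ (eq_is_sum _ _ _ _ (triangular_sums _ h0 hrow)) => k.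
    by rewrite mulr_ge0 ?(ltW (z1 k)) // (le_trans _ (vv' k)).
  apply: limn_is_sum; rewrite mulrC.
  by apply: (eq_is_sum _ _ _ _ (is_sumZ (zonal 0 k 1) _ _ (vs' k))) => l; rewrite mulrC.
have vser psi : is_sum (fun k => v k * zonal 0 k (cos psi)) (K * s psi).
  have h0 l k : (l < k)%N -> A l * w l k * zonal 0 k (cos psi) = 0.
    by move=> /wbig ->; rewrite mulr0 mul0r.
  have hr : abs_summable (fun l => \sum_(0 <= k < l.+1) `|A l * w l k * zonal 0 k (cos psi)|).
    apply: (le_abs_summable _ _ _ hrow) => l; rewrite ger0_norm ?sumr_ge0 //.
    apply: ler_sum => k _; rewrite normrM [leRHS]normrM normr_id [X in _ <= _ * X](gtr0_norm (z1 k)).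
    by apply: ler_wpM2l => //; apply: zonal0_abs.
  have := triangular_sums _ h0 hr.
  rewrite (@limn_is_sum _ _ (K * s psi)); last first.
    apply: (eq_is_sum _ _ _ _ (is_sumZ K _ _ (sA psi))) => l.
    rewrite mulrCA -zonE chain_zonal // subnn big_distrr /=.
    by apply: eq_bigr => k _; rewrite mulrA.
  apply: eq_is_sum => k; apply: limn_is_sum; rewrite mulrC.
  by apply: (eq_is_sum _ _ _ _ (is_sumZ (zonal 0 k (cos psi)) _ _ (vs k))) => l; rewrite mulrC.
pose eps (k : nat) : R := if k == 0%N then 1 else 2.
have epsn k : eps k != 0 by rewrite /eps; case: ifP => _; rewrite ?oner_eq0 ?pnatr_eq0.
have z1E k : zonal 0 k 1 = K0 * eps k.
  by rewrite -(@cos0 R) zonal0_cos mulr0 cos0 mulr1.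
(* The second expansion is scaled by K because the kernels in the first one carry that constant. *)
pose c k := v k * (K0 * eps k) - K * (B k * eps k).
have hc : abs_summable c.
  apply: abs_summableB; first apply: (le_abs_summable _ _ _ v'sum) => k.
    by rewrite -z1E normrM (gtr0_norm (z1 k)) ler_wpM2r ?(ltW (z1 k)).
  apply: abs_summableZ.
  apply: (@geo_bounded_summable _ qc _ _ 2 0) => // k.
  by rewrite mulr1 /eps; case: ifP => _; rewrite ger0_norm //; lra.
have : c m = 0.
  apply: (cos_series_unique c hc) => psi.
  have := is_sumB _ _ _ _ (vser psi) (is_sumZ K _ _ (sB psi)); rewrite subrr.
  by apply: eq_is_sum => k; rewrite zonal0_cos gegE_cos -/(eps k) /c /K0; ring.
move=> /eqP; rewrite subr_eq0 => /eqP hm.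
apply: (mulIf (epsn m)); apply: (mulfI (lt0r_neq0 Kp)); rewrite -hm.
by rewrite -/(v m); field; rewrite (lt0r_neq0 Kp).
Qed.

(** * Parameters, constants and the final identity *)

Lemma conj_param {R : realType} (z : R) (E := Num.sqrt (z ^+ 2 - 1)) (q := z - E) :
  1 < z -> [/\ 0 < q < 1, 2 * z = q^-1 + q, 2 * E = q^-1 - q, 0 < E & ln (z + E) = - ln q].
Proof.
move=> z1.
have z2 : 0 < z ^+ 2 - 1 by rewrite subr_gt0 -(expr1n _ 2) ltr_pXn2r ?nnegrE //; lra.
have E0 : 0 < E by rewrite sqrtr_gt0.
have hE : E ^+ 2 = z ^+ 2 - 1 by rewrite sqr_sqrtr // ltW.
have qzE : q * (z + E) = 1 by rewrite /q -subr_sqr hE; ring.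
have zE0 : 0 < z + E by lra.
have qE : q = (z + E)^-1 by rewrite -[RHS]mul1r -qzE mulfK // lt0r_neq0.
have q0 : 0 < q by rewrite qE invr_gt0.
have qV : q^-1 = z + E by rewrite qE invrK.
split=> //.
- by rewrite q0 qE invf_lt1 //; lra.
- by rewrite qV /q; ring.
- by rewrite qV /q; ring.
- by rewrite -qV lnV.
Qed.

Lemma zeta_gt1 {R : realType} (r r' : R) : 0 < r -> 0 < r' -> r <> r' -> 1 < zeta r r'.
Proof.
move=> r0 r'0 /eqP rr'; have d0 : 0 < 2 * r * r' by rewrite !mulr_gt0.
rewrite /zeta ltr_pdivlMr // mul1r -subr_gt0.
rewrite (_ : _ - _ = (r - r') ^+ 2); last by ring.
by rewrite lt0r sqrf_eq0 subr_eq0 rr' sqr_ge0.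
Qed.

(** At t = 1 the right-hand side of [chi_chain] is positive, because zeta > 1 while the cosine u is
    at most 1. *)
Lemma chi_gt1 {R : realType} (d : nat) (x x' : 'rV[R]_d)
    (r r' : R) (th th' : nat -> R) (ph ph' : R) :
  (2 <= d)%N ->
  polyspherical x r th ph -> polyspherical x' r' th' ph' ->
  0 < r -> 0 < r' -> 0 < cylradius d r th -> 0 < cylradius d r' th' -> r <> r' ->
  1 < chi x x' (cylradius d r th) (cylradius d r' th').
Proof.
move=> d2 hx hx' r0 r'0 rho0 rho'0 rr'.
have z1 := zeta_gt1 _ _ r0 r'0 rr'.
have := chi_chain d x x' r r' th th' ph ph' 1 d2 hx hx' r0 r'0 rho0 rho'0.
have h1 : -1 <= (1 : R) <= 1 by rewrite lexx andbT; lra.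
have := chain_cos_bound th th' (d - 2) 1 h1.
set u := chain_cos _ _ _ _; set c := chi _ _ _ _ => /andP[_ u1] e.
have pos : 0 < r * r' * (2 * zeta r r' - 2 * u) by rewrite !mulr_gt0 //; lra.
by move: pos; rewrite -e pmulr_rgt0 ?(mulr_gt0 rho0 rho'0) //; lra.
Qed.

(** Coefficients of (2 z - 2 u)^p (log (2 z - 2 u) + L) in [gegE] of index h. Taking L = log (r r')
    or log (R R') completes the logarithm to that of the value common to both sides. *)
Definition zonal_coef {R : realType} (z q L : R) (H : nat -> R) (p h l : nat) : R :=
  raise_const p h *
    (powcoef z (log_coef (- ln q) q) (p + h) (l + h)%N%:Z
     + (L - (H (p + h)%N - H p)) * powcoef z one_coef (p + h) (l + h)%N%:Z).

Lemma zonal_coef_bounded {R : realType} (z q L : R) (H : nat -> R) p h : 0 < q < 1 ->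
  geo_bounded q (zonal_coef z q L H p h).
Proof.
move=> q01; apply: geo_boundedZ; apply: geo_boundedD.
  by apply: (geo_bounded_int _ (powcoef z (log_coef (- ln q) q) (p + h))) => //;
    apply: powcoef_bound => //; apply: log_coef_bound.
apply: geo_boundedZ; apply: (geo_bounded_int _ (powcoef z one_coef (p + h))) => //.
by apply: powcoef_bound => //; apply: one_coef_bound.
Qed.

Lemma zonal_coef_series {R : realType} (q z u L : R) (H : nat -> R) p h :
  0 < q < 1 -> 2 * z = q^-1 + q -> -1 <= u <= 1 ->
  (forall n, H n.+1 = H n + n.+1%:R^-1) ->
  is_sum (fun n => zonal_coef z q L H p h n * gegE n%:Z h%:R u)
    ((2 * z - 2 * u) ^+ p * (ln (2 * z - 2 * u) + L)).
Proof.
move=> q01 hz hu HS; rewrite mulrDr [_ ^+ p * L]mulrC.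
apply: (eq_is_sum _ _ _ _ (is_sumD _ _ _ _ (zonal_log_series q z u H p h q01 hz hu HS)
  (is_sumZ L _ _ (zonal_pow_series q z u p h q01 hu)))) => n.
by rewrite /zonal_coef; ring.
Qed.

(** The p-th power of the common value times its logarithm is divided by (r r')^p; on the side of
    chi this leaves the factor (R R' / (r r'))^p. *)
Lemma zonal_coef_transfer {R : realType} (d h p m : nat) (x x' : 'rV[R]_d)
    (r r' : R) (th th' : nat -> R) (ph ph' : R) (H : nat -> R)
    (rho := cylradius d r th) (rho' := cylradius d r' th')
    (z := zeta r r') (c := chi x x' rho rho') (q qc : R) :
  d = (2 * h + 2)%N ->
  polyspherical x r th ph -> polyspherical x' r' th' ph' ->
  0 < r -> 0 < r' -> 0 < rho -> 0 < rho' -> r <> r' ->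
  (forall n, H n.+1 = H n + n.+1%:R^-1) ->
  0 < q < 1 -> 2 * z = q^-1 + q -> 0 < qc < 1 -> 2 * c = qc^-1 + qc ->
  (rho * rho' / (r * r')) ^+ p * zonal_coef c qc (ln (rho * rho')) H p 0 m
  = zonal_const 0 / zonal_const (d - 2) *
    limn (series (fun l => zonal_coef z q (ln (r * r')) H p h l
                            * pathw (Omega d th th') (d - 2) l m)).
Proof.
move=> hd hx hx' r0 r'0 rho0 rho'0 rr' HS q01 hz qc01 hc.
pose B k := (rho * rho' / (r * r')) ^+ p * zonal_coef c qc (ln (rho * rho')) H p 0 k.
have d2 : (2 <= d)%N by rewrite hd leq_addl.
have bnd (psi : R) : -1 <= cos psi <= 1 by rewrite cos_geN1 cos_le1.
apply: (zonal_transfer d h th th' q qc (zonal_coef z q (ln (r * r')) H p h) B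
  (fun psi => let u := chain_cos th th' (d - 2) (cos psi) in
     (2 * z - 2 * u) ^+ p * (ln (2 * z - 2 * u) + ln (r * r')))) => //.
- by rewrite hd addnK.
- exact: zonal_coef_bounded.
- by apply: geo_boundedZ; apply: zonal_coef_bounded.
- by move=> psi; apply: zonal_coef_series => //; apply: chain_cos_bound.
move=> psi /=; set t := cos psi.
have := is_sumZ ((rho * rho' / (r * r')) ^+ p) _ _
  (zonal_coef_series qc c t (ln (rho * rho')) H p 0 qc01 hc (bnd psi) HS).
have rr0 : 0 < r * r' by rewrite mulr_gt0.
have rho20 : 0 < rho * rho' := mulr_gt0 rho0 rho'0.
have c1 : 1 < c by apply: (chi_gt1 d x x' r r' th th' ph ph').
have t1 := bnd psi.
have pos : 0 < 2 * c - 2 * t by rewrite -/t in t1; lra.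
have e := chi_chain d x x' r r' th th' ph ph' t d2 hx hx' r0 r'0 rho0 rho'0.
have u1 := chain_cos_bound th th' (d - 2) t t1.
have z1 := zeta_gt1 _ _ r0 r'0 rr'.
have posz : 0 < 2 * z - 2 * chain_cos th th' (d - 2) t by rewrite /z; lra.
have -> : (2 * z - 2 * chain_cos th th' (d - 2) t) ^+ p
    * (ln (2 * z - 2 * chain_cos th th' (d - 2) t) + ln (r * r'))
  = (rho * rho' / (r * r')) ^+ p * ((2 * c - 2 * t) ^+ p
    * (ln (2 * c - 2 * t) + ln (rho * rho'))).
  rewrite -!lnM ?posrE // [RHS]mulrA -exprMn [X in ln X]mulrC -e.
  congr (_ ^+ p * ln _); last by rewrite mulrC.
  apply: (mulfI (lt0r_neq0 rr0)); rewrite -e.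
  by rewrite [RHS]mulrA; congr (_ * _); rewrite [RHS]mulrC divfK ?(lt0r_neq0 rr0).
by apply: eq_is_sum => n; rewrite mulrA.
Qed.

Lemma powR_half {R : realType} (E : R) N : 0 < E ->
  (E ^+ 2) `^ (N%:R / 2 + 1 / 4) = E ^+ N * (E ^+ 2) `^ (1 / 4).
Proof.
move=> E0; rewrite powRD; last by rewrite (lt0r_neq0 (exprn_gt0 2 E0)) implybT.
congr (_ * _); rewrite -(powR_mulrn 2 (ltW E0)) -powRrM mulrCA mulfV ?mulr1 ?powR_mulrn //.
exact: ltW.
Qed.

Lemma powR_quarter_sqr {R : realType} (E : R) : 0 < E ->
  ((E ^+ 2) `^ (1 / 4)) ^+ 2 = E.
Proof.
move=> E0; rewrite -(powR_mulrn 2 (powR_ge0 _ _)) -powRrM.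
rewrite -(powR_mulrn 2 (ltW E0)) -powRrM (_ : 2%:R * _ = 1) ?powRr1 ?(ltW E0) //.
by field.
Qed.

(** Serves both sides: s = (-1)^l with n = l + h for zeta, and s = 1 with n = m for chi. *)
Lemma legendre_bracket {R : realType} (z E q nu s X : R) (n j : nat) :
  0 < q < 1 -> 2 * z = q^-1 + q -> 2 * E = q^-1 - q -> nu = n%:R - 1 / 2 ->
  (s / (j`!%:R * (2 * n + j)`!%:R) * X)%:C * legendreQ nu ((n + j)%:R + 1 / 2) z
  + (s / (2 * n + j)`!%:R)%:C
    * (\sum_(0 <= k < j)
        ((2 * n + 2 * k + 1)%:R / (k`!%:R * (j - k)%:R * (2 * n + j + k + 1)%:R)
         * (1 + k`!%:R * (2 * n + j)`!%:R / ((2 * n + k)`!%:R * j`!%:R)))%:C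
        * legendreQ nu ((n + k)%:R + 1 / 2) z)
  + (s / j`!%:R)%:C
    * (\sum_(0 <= k < n)
        ((2 * k + 1)%:R / ((n + k)`!%:R * (n + j - k)%:R * (n + j + k + 1)%:R))%:C
        * legendreQ nu (k%:R + 1 / 2) z)
  = 0 +i* (s * (legQc z * legbracket z E q n j X)).
Proof.
move=> q01 hz hE hnu.
have Q K : legendreQ nu (K%:R + 1 / 2) z = 0 +i* (legQc z * legS z E q n K).
  exact: legendreQ_half.
have S (c f : nat -> R) N : \sum_(0 <= k < N) (c k)%:C * (0 +i* (legQc z * f k))
    = 0 +i* (legQc z * \sum_(0 <= k < N) c k * f k).
  rewrite big_distrr -sum_im /=; apply: eq_bigr => k _.
  by rewrite mul_realC_im mulrCA.
rewrite (eq_bigr _ (fun k _ => congr1 _ (Q (n + k)%N))).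
rewrite (eq_bigr _ (fun k _ => congr1 _ (Q k))) Q !S !mul_realC_im /legbracket.
apply/eqP; rewrite eq_complex /= !add0r eqxx /=; apply/eqP.
by field; rewrite !fact_neq0.
Qed.

Lemma eq_nested_sum {R : realType} (Om : nat -> nat -> nat -> R) (f g : nat -> R[i]) p n l' :
  (l' <= p)%N -> (forall l, (l <= p)%N -> f l = g l) ->
  nested_sum Om f p n l' = nested_sum Om g p n l'.
Proof.
move=> hl hfg; elim: n l' hl => [|n IH] l' hl /=; first exact: hfg.
by apply: eq_big_nat => l /andP[_ hlp]; rewrite IH.
Qed.

Lemma zonal_coef_bracket {R : realType} (z E q L X : R) (H : nat -> R) p h l :
  q != 0 -> E != 0 -> 2 * z = q^-1 + q -> 2 * E = q^-1 - q ->
  H 0%N = 0 -> (forall n, H n.+1 = H n + n.+1%:R^-1) -> (l <= p)%N ->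
  X = L - ln q + 2 * H (2 * (p + h))%N + H p - H (p + h)%N
      - H (2 * (l + h) + (p - l))%N - H (p - l)%N ->
  zonal_coef z q L H p h l
  = (-1) ^+ (h + p) * h`!%:R * p`!%:R * (2 * E) ^+ (p + h).+1
    * ((-1) ^+ l * legbracket z E q (l + h) (p - l) X).
Proof.
move=> q0 E0 hz hE H0 HS lp hX; rewrite /zonal_coef /raise_const.
have hn : (l + h + (p - l) = p + h)%N by lia.
have := log_leg_bracket z E q (- ln q) (L - (H (p + h)%N - H p)) H (l + h) (p - l)
  q0 E0 hz hE H0 HS.
rewrite hn => ->; rewrite hX.
have -> : (-1) ^+ (p - l) = (-1) ^+ p * (-1) ^+ l :> R.
  by rewrite -exprD -signr_odd -[RHS]signr_odd oddB // oddD.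
rewrite exprD.
have -> : L - (H (p + h)%N - H p) - ln q + 2 * H (2 * (p + h))%N
    - H (2 * (l + h) + (p - l))%N - H (p - l)%N
  = L - ln q + 2 * H (2 * (p + h))%N + H p - H (p + h)%N
      - H (2 * (l + h) + (p - l))%N - H (p - l)%N by ring.
by field; rewrite fact_neq0.
Qed.

(** For l > p the plain power has no coefficient at l + h, so neither L nor any harmonic number
    survives. *)
Lemma zonal_coef_tail {R : realType} (z E q L : R) (H : nat -> R) p h l :
  q != 0 -> E != 0 -> 2 * z = q^-1 + q -> 2 * E = q^-1 - q -> (p < l)%N ->
  zonal_coef z q L H p h l
  = (-1) ^+ (h + p) * h`!%:R * p`!%:R * (2 * E) ^+ (p + h).+1
    * ((-1) ^+ p.+1 * (l - p - 1)`!%:R / (p + l + 2 * h)`!%:R * legS z E q (l + h) (p + h)).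
Proof.
move=> q0 E0 hz hE pl; rewrite /zonal_coef /raise_const.
rewrite delta_far ?mulr0 ?addr0; last by rewrite /=; lia.
rewrite (log_tail z E q (- ln q) q0 E0 hz hE) ?ltn_add2r //.
have -> : (l + h - (p + h) - 1 = l - p - 1)%N by lia.
have -> : (p + h + (l + h) = p + l + 2 * h)%N by lia.
have hs : (-1) ^+ p * (-1) ^+ p = 1 :> R by rewrite -expr2 sqrr_sign.
rewrite exprD (exprS (-1) p).
set s := (-1) ^+ p in hs *; set F := (_ + 2 * h)`!%:R.
have F0 : F != 0 by rewrite /F fact_neq0.
transitivity ((s * s) * ((-1) ^+ h * h`!%:R * p`!%:R / (p + h)`!%:R *
  - ((p + h)`!%:R * (l - p - 1)`!%:R / F * (2 * E) ^+ (p + h).+1 * legS z E q (l + h) (p + h)))).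
  by rewrite hs mul1r.
by field; rewrite F0 fact_neq0.
Qed.

Lemma zonal_const_ratio {R : realType} h :
  zonal_const 0 / zonal_const (2 * h) = pi ^+ h / h`!%:R :> R.
Proof.
have pi0 : (pi : R) != 0 by rewrite lt0r_neq0 // pi_gt0.
rewrite /zonal_const mul0r add0r expr0 exprM sqr_sqrtr ?pi_ge0 //.
have -> : (2 * h)%:R / 2 + 1 = h.+1%:R :> R by rewrite -natr1 natrM; field.
rewrite Gamma_nat Gamma1.
move: (pi : R) pi0 => P P0; by field; rewrite fact_neq0 expf_neq0 P0.
Qed.

(** Bookkeeping of constants, stated for variables so that powers and signs stay opaque to [field].
    Here Xz and Xc stand for fourth roots of E^2 and Ec^2, b for the real bracket on the side of
    chi, and W for the imaginary part of the braces. *)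
Lemma coefficient_ratio {R : realType} (P Pr Q E Ec Xz Xc b W hf pf : R) (h p m : nat) :
  Pr != 0 -> Q != 0 -> hf != 0 -> pf != 0 -> Xz != 0 -> Xc != 0 ->
  Xz ^+ 2 = E -> Xc ^+ 2 = Ec ->
  Pr * ((-1) ^+ p * pf * (2 * Ec) ^+ p.+1 * ((-1) ^+ m * b))
  = P ^+ h / hf * ((-1) ^+ (h + p) * hf * pf * (2 * E) ^+ (p + h).+1 / (Q * Xz) * W) ->
  Q * Xc * b
  = Pr^-1 * (-1) ^+ (m + h) * (2 * P) ^+ h * (E ^+ (p + h) * Xz / (Ec ^+ p * Xc)) * W.
Proof.
move=> Pr0 Q0 hf0 pf0 Xz0 Xc0 hE hEc.
have Ec0 : Ec != 0 by rewrite -hEc expf_neq0.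
have E0 : E != 0 by rewrite -hE expf_neq0.
have s2 : (-1) ^+ m * (-1) ^+ m = 1 :> R by rewrite -expr2 sqrr_sign.
have s0 : (-1) ^+ m != 0 :> R by rewrite signr_eq0.
have t0 : (-1) ^+ p != 0 :> R by rewrite signr_eq0.
rewrite !exprS !exprMn !exprD.
have u0 : 2 ^+ p != 0 :> R by rewrite expf_neq0 // pnatr_eq0.
have v0 : Ec ^+ p != 0 by rewrite expf_neq0.
move: (2 ^+ p) (2 ^+ h) (P ^+ h) ((-1) ^+ p) ((-1) ^+ h) ((-1) ^+ m) (Ec ^+ p) (E ^+ p) (E ^+ h)
  u0 v0 s2 s0 t0 => u v w t s y e f g u0 v0 s2 s0 t0 tr.
have k0 : Pr * (t * pf * (2 * Ec * (u * e)) * y) != 0.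
  by rewrite !mulf_neq0 ?pnatr_eq0.
apply: (mulfI k0).
transitivity (Q * Xc * (Pr * (t * pf * (2 * Ec * (u * e)) * (y * b)))); first by ring.
rewrite tr -hE -hEc.
transitivity (Q * Xc * (y * y) * (w / hf * (s * t * hf * pf * (2 * Xz ^+ 2 * (u * v * (f * g))) / (Q * Xz) * W))).
  by rewrite s2 mulr1.
by field; rewrite Pr0 Q0 hf0 Xz0 Xc0 v0.
Qed.

Theorem theorem7p3 (R : realType) (d p m : nat)
    (hd : (4 <= d)%N) (hd_even : ~~ odd d) (hmp : (m <= p)%N)
    (x x' : 'rV[R]_d)
    (r r' : R) (th th' : nat -> R) (ph ph' : R)
    (hx : polyspherical x r th ph) (hx' : polyspherical x' r' th' ph')
    (hr : 0 < r) (hr' : 0 < r')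
    (hrho : 0 < cylradius d r th) (hrho' : 0 < cylradius d r' th')
    (hrr' : r <> r') :
  let rho := cylradius d r th in
  let rho' := cylradius d r' th' in
  let z := zeta r r' in
  let c := chi x x' rho rho' in
  let H : nat -> R := @harmonic_number R in
  let Om : nat -> nat -> nat -> R := Omega d th th' in
  (* lower order of the Legendre functions on the two sides *)
  let mu0 : R := m%:R - 1 / 2 in
  let nu (l : nat) : R := l%:R + (d%:R - 3) / 2 in
  let inner (l : nat) : R[i] :=
    ((-1) ^+ l / ((p - l)`!%:R * (p + l + d - 2)`!%:R)
      * (ln (r * r') + ln (z + Num.sqrt (z ^+ 2 - 1)) + 2 * H (2 * p + d - 2)%N
         + H p - H (p + d./2 - 1)%N - H (p + l + d - 2)%N - H (p - l)%N))%:C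
      * legendreQ (nu l) (p%:R + (d%:R - 1) / 2) z
    + ((-1) ^+ l / (p + l + d - 2)`!%:R)%:C
      * (\sum_(0 <= k < p - l)
          ((2 * l + 2 * k + d - 1)%:R
             / (k`!%:R * (p - l - k)%:R * (p + l + k + d - 1)%:R)
           * (1 + k`!%:R * (p + l + d - 2)`!%:R
                  / ((k + 2 * l + d - 2)`!%:R * (p - l)`!%:R)))%:C
          * legendreQ (nu l) (k%:R + l%:R + (d%:R - 1) / 2) z)
    + ((-1) ^+ l / (p - l)`!%:R)%:C
      * (\sum_(0 <= k < l + d./2 - 1)
          ((2 * k + 1)%:R
             / ((l + d./2 + k - 1)`!%:R * (p + d./2 - k - 1)%:R
                * (p + d./2 + k)%:R))%:C
          * legendreQ (nu l) (k%:R + 1 / 2) z) in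
  let tail (l : nat) : R[i] :=
    ((-1) ^+ p.+1 * (l - p - 1)`!%:R / (p + l + d - 2)`!%:R)%:C
      * legendreQ (nu l) (p%:R + (d%:R - 1) / 2) z in
  (* the innermost sum of the tail starts at max (p + 1) l_2 *)
  let lo (j l' : nat) : nat := if j == 1%N then maxn p.+1 l' else l' in
  nested_series_cvg lo Om tail (d - 2) m /\
  (1 / ((p + m)`!%:R * (p - m)`!%:R)
    * (ln (rho * rho') + ln (c + Num.sqrt (c ^+ 2 - 1)) + 2 * H (2 * p)%N
       - H (p + m)%N - H (p - m)%N))%:C
    * legendreQ mu0 (p%:R + 1 / 2) c
  + (1 / (p + m)`!%:R)%:C
    * (\sum_(0 <= k < p - m)
        ((2 * m + 2 * k + 1)%:R
           / (k`!%:R * (p - m - k)%:R * (p + m + k + 1)%:R)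
         * (1 + k`!%:R * (p + m)`!%:R
                / ((2 * m + k)`!%:R * (p - m)`!%:R)))%:C
        * legendreQ mu0 (m%:R + k%:R + 1 / 2) c)
  + (1 / (p - m)`!%:R)%:C
    * (\sum_(0 <= k < m)
        ((2 * k + 1)%:R / ((m + k)`!%:R * (p - k)%:R * (p + k + 1)%:R))%:C
        * legendreQ mu0 (k%:R + 1 / 2) c)
  = ((r * r' / (rho * rho')) ^+ p * (-1) ^+ (m + d./2 - 1)
     * (2 * pi) ^+ (d./2 - 1)
     * ((z ^+ 2 - 1) `^ (p%:R / 2 + (d%:R - 1) / 4)
        / (c ^+ 2 - 1) `^ (p%:R / 2 + 1 / 4)))%:C
    * (nested_sum Om inner p (d - 2) m + nested_series lo Om tail (d - 2) m).
Proof.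
move=> rho rho' z c H Om mu0 nu inner tail lo.
have [h hdE] : exists h, d = (2 * h + 2)%N.
  by exists (d./2 - 1)%N; have := odd_double_half d; rewrite (negbTE hd_even); lia.
have hh : (d./2 = h.+1)%N by rewrite hdE; lia.
have dR : d%:R = 2 * h%:R + 2 :> R by rewrite hdE natrD natrM.
have H0 : H 0%N = 0 by rewrite /H /harmonic_number /series /= big_geq.
have HS n : H n.+1 = H n + n.+1%:R^-1.
  by rewrite /H /harmonic_number /series /= big_nat_recr.
have d2 : (2 <= d)%N by lia.
(* Index arithmetic between the truncated subtractions of the statement, written with d, and those
   of the lemmas, written with h = d/2 - 1 and j = p - l. *)
have nat_eq_1 (l : nat) : (l <= p)%N ->
    (p + l + d - 2 = 2 * (l + h) + (p - l))%N by lia.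
have nat_eq_2 : (2 * p + d - 2 = 2 * (p + h))%N by lia.
have nat_eq_3 : (p + d./2 - 1 = p + h)%N by lia.
have nat_eq_4 (l : nat) : (l + d./2 - 1 = l + h)%N by lia.
have nat_eq_5 (l : nat) : (l <= p)%N ->
    (l + h + (p - l) = p + h)%N by lia.
have nat_eq_6 (l k : nat) : (2 * l + 2 * k + d - 1 = 2 * (l + h) + 2 * k + 1)%N by lia.
have nat_eq_7 (l k : nat) : (l <= p)%N ->
    (p + l + k + d - 1 = 2 * (l + h) + (p - l) + k + 1)%N by lia.
have nat_eq_8 (l k : nat) : (k + 2 * l + d - 2 = 2 * (l + h) + k)%N by lia.
have nat_eq_9 (l k : nat) : (l + d./2 + k - 1 = l + h + k)%N by lia.
have nat_eq_10 (l k : nat) : (l <= p)%N ->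
    (p + d./2 - k - 1 = l + h + (p - l) - k)%N by lia.
have nat_eq_11 (l k : nat) : (l <= p)%N ->
    (p + d./2 + k = l + h + (p - l) + k + 1)%N by lia.
have nat_eq_12 (l : nat) : (p + l + d - 2 = p + l + 2 * h)%N by lia.
have nat_eq_13 : (2 * m + (p - m) = p + m)%N by lia.
have nat_eq_14 : (m + (p - m) = p)%N by lia.
have nat_eq_15 : (m + d./2 - 1 = m + h)%N by lia.
have nat_eq_16 : (d - 2 = (d - 3).+1)%N by lia.
have nat_eq_17 : ((d - 3).+1 <= d - 2)%N by lia.
have nat_eq_18 (k : nat) : (m + (p - m) - k = p - k)%N by lia.
have hd2 : (d - 2 = 2 * h)%N by lia.
have z1 : 1 < z by apply: zeta_gt1.
have c1 : 1 < c by apply: (chi_gt1 d x x' r r' th th' ph ph').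
have := conj_param z z1; set E := Num.sqrt _; set q := z - E => -[q01 hz hE E0 lnz].
have := conj_param c c1; set Ec := Num.sqrt _; set qc := c - Ec => -[qc01 hc hEc Ec0 lnc].
have q0 : q != 0 by apply: lt0r_neq0; case/andP: q01.
have qc0 : qc != 0 by apply: lt0r_neq0; case/andP: qc01.
have En0 := lt0r_neq0 E0; have Ecn0 := lt0r_neq0 Ec0.
pose X l := ln (r * r') - ln q + 2 * H (2 * (p + h))%N + H p - H (p + h)%N
      - H (2 * (l + h) + (p - l))%N - H (p - l)%N.
pose G l := (-1) ^+ l * legbracket z E q (l + h) (p - l) (X l).
pose t0 l := (-1) ^+ p.+1 * (l - p - 1)`!%:R / (p + l + 2 * h)`!%:R
  * legS z E q (l + h) (p + h).
have nuE l : nu l = (l + h)%:R - 1 / 2 by rewrite /nu dR natrD; field.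
have muE : p%:R + (d%:R - 1) / 2 = (p + h)%:R + 1 / 2 :> R by rewrite dR natrD; field.
have innerE l : (l <= p)%N -> inner l = 0 +i* (legQc z * G l).
  move=> lp; rewrite /G mulrCA -(legendre_bracket z E q (nu l)) // /inner.
  rewrite (nat_eq_1 l lp).
  rewrite nat_eq_2.
  rewrite nat_eq_3.
  rewrite (nat_eq_4 l).
  congr (_ + _ + _).
  - rewrite (nat_eq_5 l lp).
    by rewrite muE lnz.
  - congr (_ * _); apply: eq_big_nat => k hk.
    rewrite (nat_eq_6 l k).
    rewrite (nat_eq_7 l k lp).
    rewrite (nat_eq_8 l k).
    by congr (_ * legendreQ _ _ _); rewrite dR !natrD; field.
  - congr (_ * _); apply: eq_big_nat => k hk.
    rewrite (nat_eq_9 l k).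
    rewrite (nat_eq_10 l k lp).
    by rewrite (nat_eq_11 l k lp).
have tailE l : tail l = 0 +i* (legQc z * t0 l).
  rewrite /tail (legendreQ_half z E q _ _ (l + h) (p + h)) // mul_realC_im /t0.
  rewrite (nat_eq_12 l).
  by rewrite mulrCA.
have Qz0 : 0 < legQc z.
  by rewrite !mulr_gt0 ?powR_gt0 ?sqrtr_gt0 ?pi_gt0 //; rewrite -sqrtr_gt0.
(* The factor common to the coefficients with l <= p and with l > p. *)
set al := (-1) ^+ (h + p) * h`!%:R * p`!%:R * (2 * E) ^+ (p + h).+1.
have al0 : al != 0.
  by rewrite /al !mulf_neq0 ?signr_eq0 ?fact_neq0 ?expf_neq0 ?mulf_neq0 ?pnatr_eq0.
pose A := zonal_coef z q (ln (r * r')) H p h.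
have AG l : (l <= p)%N -> A l = al * G l by move=> lp; apply: zonal_coef_bracket.
have At l : (p < l)%N -> A l = al * t0 l by move=> pl; apply: zonal_coef_tail.
pose g l := if (l <= p)%N then 0 else legQc z * t0 l.
have gsum n k : (n <= d - 2)%N ->
    abs_summable (fun l => g l * pathw (fun j k k' => `|Om j k k'|) n l k).
  move=> hn; apply: (geo_pathw_summable d h n k th th' q) => //.
  (* Up to the constant legQc z / al, g is [A] with its first terms removed, so it inherits the
     geometric decay. *)
  have [C hC] := geo_boundedZ q (legQc z / al) _
    (zonal_coef_bounded z q (ln (r * r')) H p h q01).
  exists C => l; apply: le_trans (hC l); rewrite /g; case: leqP => [_|pl].
    by rewrite normr0.
  by rewrite -/(A l) At // [X in _ <= `|X|]mulrA divfK.
have tailF : tail = (fun l => 0 +i* (legQc z * t0 l)) by apply: funext.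
have [cvgT serT] : nested_series_cvg lo Om tail (d - 2) m /\
    nested_series lo Om tail (d - 2) m
    = 0 +i* limn (series (fun l => g l * pathw Om (d - 2) l m)).
  rewrite tailF nat_eq_16.
  by apply: (nested_series_im Om _ p (d - 2)).
split=> //.
set T := limn _ in serT.
have Ts : is_sum (fun l => g l * pathw Om (d - 2) l m) T.
  apply: is_sum_lim; have [C hC] := gsum (d - 2)%N m (leqnn _).
  exists C => n; apply: le_trans (hC n); apply: ler_sum => l _.
  by rewrite !normrM ler_wpM2l // (le_trans (pathw_abs _ _ _ _)) ?ler_norm.
pose F := \sum_(0 <= l < p.+1) legQc z * G l * pathw Om (d - 2) l m.
have nsE : nested_sum Om inner p (d - 2) m = 0 +i* F.
  by rewrite (eq_nested_sum _ _ (fun l => 0 +i* (legQc z * G l))) ?nested_sum_im.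
(* The single series over all l is the finite part plus the tail. *)
have As : is_sum (fun l => A l * pathw Om (d - 2) l m) (al / legQc z * (F + T)).
  have Fs := is_sum_finite (fun l => if (l <= p)%N
    then legQc z * G l * pathw Om (d - 2) l m else 0) p.+1.
  have {}Fs : is_sum (fun l => if (l <= p)%N
      then legQc z * G l * pathw Om (d - 2) l m else 0) F.
    rewrite (_ : F = \sum_(0 <= l < p.+1) (if (l <= p)%N
      then legQc z * G l * pathw Om (d - 2) l m else 0)).
      by apply: Fs => l; rewrite ltnNge => /negbTE ->.
    by apply: eq_big_nat => l /andP[_ hl]; rewrite -ltnS hl.
  apply: (eq_is_sum _ _ _ _ (is_sumZ (al / legQc z) _ _ (is_sumD _ _ _ _ Fs Ts))) => l.
  rewrite /g; case: leqP => lp.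
    by rewrite mul0r addr0 AG //; field; rewrite (lt0r_neq0 Qz0).
  by rewrite add0r At //; field; rewrite (lt0r_neq0 Qz0).
have tr := zonal_coef_transfer d h p m x x' r r' th th' ph ph' H q qc hdE hx hx' hr hr'
  hrho hrho' hrr' HS q01 hz qc01 hc.
rewrite (limn_is_sum _ _ As) hd2 zonal_const_ratio in tr.
pose Xc := ln (rho * rho') - ln qc + 2 * H (2 * p)%N - H (2 * m + (p - m))%N - H (p - m)%N.
(* On the side of chi the Gegenbauer index is 0 and the coefficient index is m <= p, so a bracket
   occurs and no tail. *)
rewrite (zonal_coef_bracket c Ec qc _ Xc) ?addn0 // in tr; last by rewrite /Xc; ring.
pose b := legbracket c Ec qc m (p - m) Xc.
transitivity (0 +i* (1 * (legQc c * b))).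
  rewrite -(legendre_bracket c Ec qc mu0) //.
  rewrite nat_eq_13.
  congr (_ + _ + _).
  - rewrite nat_eq_14.
    rewrite /Xc lnc [(p - m)`!%:R * _]mulrC.
    by rewrite nat_eq_13.
  - congr (_ * _); apply: eq_big_nat => k hk.
    by rewrite (natrD _ m k).
  - congr (_ * _); apply: eq_big_nat => k hk.
    by rewrite (nat_eq_18 k) nat_eq_14.
rewrite serT nsE (_ : (0 +i* F) + (0 +i* T) = 0 +i* (F + T)); last first.
  by apply/eqP; rewrite eq_complex /= addr0 !eqxx.
rewrite mul_realC_im; congr (_ +i* _).
set W := F + T in tr *.
have zE2 : z ^+ 2 - 1 = E ^+ 2 by rewrite /E sqr_sqrtr // ltW // -sqrtr_gt0.
have cE2 : c ^+ 2 - 1 = Ec ^+ 2 by rewrite /Ec sqr_sqrtr // ltW // -sqrtr_gt0.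
rewrite (_ : p%:R / 2 + (d%:R - 1) / 4 = (p + h)%:R / 2 + 1 / 4); last first.
  by rewrite dR natrD; field.
rewrite zE2 cE2 !powR_half // nat_eq_15.
have rr0 : r * r' != 0 by rewrite mulf_neq0 // lt0r_neq0.
have rho20 : rho * rho' != 0 by rewrite mulf_neq0 // lt0r_neq0.
set Pr := (rho * rho' / (r * r')) ^+ p in tr.
have Pr0 : Pr != 0 by rewrite expf_neq0 // mulf_neq0 // invr_eq0.
have -> : (r * r' / (rho * rho')) ^+ p = Pr^-1 by rewrite /Pr -exprVn invf_div.
move: tr; rewrite /al /legQc zE2 cE2 -/b.
have := powR_quarter_sqr E E0; have := powR_quarter_sqr Ec Ec0.
have := powR_gt0 (1 / 4) (exprn_gt0 2 E0); have := powR_gt0 (1 / 4) (exprn_gt0 2 Ec0).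
move: (_ `^ _) (_ `^ _) => yz yc /lt0r_neq0 yc0 /lt0r_neq0 yz0 ycE yzE.
have Q0 : Num.sqrt 2 * Num.sqrt pi != 0 :> R.
  by rewrite mulf_neq0 // lt0r_neq0 // sqrtr_gt0 // pi_gt0.
rewrite add0n fact0 mulr1 hh subn1 [1 * _]mul1r.
by apply: coefficient_ratio => //; rewrite fact_neq0.
Qed.
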